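(* Let $\Lambda Z$ be a Sullivan algebra and let $\Lambda V=\Lambda Z\otimes\Lambda W$ (with $V=Z\oplus W$) be a relative Sullivan algebra with base $\Lambda Z$ and fiber $(\Lambda W,\bar d)$. Let $m,n$ be non-negative integers, and suppose that $e_{\Lambda Z}(\Lambda V)=m$ and that $e_{\Lambda W}(\Lambda^{\geq q}W)=n$ for all $q\geq 0$. Then $e_{\Lambda V}(\Lambda V)\leq (m+1)(n+2)-2$. If $\Lambda V$ itself is a minimal Sullivan algebra, then $e_{\Lambda V}(\Lambda V)\leq (m+1)(n+1)-1$.
   Context: The ground ring is a field $\mathbf{k}$ of characteristic $0$. A CDGA is a (graded-)commutative differential graded $\mathbf{k}$-algebra, non-negatively graded, with differential of degree $+1$; it is connected if $H^0=\mathbf{k}$. DG modules over a CDGA may be $\mathbb{Z}$-graded. For a non-negatively graded vector space $V$, $\Lambda V$ is the free graded commutative algebra on $V$, $\Lambda^mV$ is the subspace of elements of wordlength $m$, and $\Lambda^{>m}V$, $\Lambda^{\ge m}V$ are defined analogously. A KS complex is a CDGA $(\Lambda V,d)$ such that $V$ is the union of increasing subspaces $0=V(-1)\subset V(0)\subset V(1)\subset\cdots$ with $dV(k)\subset\Lambda V(k-1)$. A Sullivan algebra is a KS complex with $V$ concentrated in degrees $\ge1$. A Sullivan algebra is minimal if $dV\subset\Lambda^{\ge2}V$. Relative Sullivan algebras: let $B$ be a connected CDGA. A CDGA $B\otimes\Lambda W$, with $W$ concentrated in degrees $\ge1$, is a relative Sullivan algebra with base $B$ if $B\to B\otimes\Lambda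 W$, $b\mapsto b\otimes1$ is a CDGA morphism and $W$ is the union of increasing subspaces $0=W(-1)\subset W(0)\subset\cdots$ with $d(1\otimes W(k))\subset(\mathbf{k}\oplus B^{\ge1})\otimes\Lambda W(k-1)$. Its fiber is $(\Lambda W,\bar d)$, where $\bar d$ is the $\mathbf{k}\otimes\Lambda W$ component of $d$. A DG module $P$ over a CDGA $A$ is semifree if it is the union of an increasing sequence of DG submodules $0=P(-1)\subset P(0)\subset P(1)\subset\cdots$ such that $P(k)/P(k-1)\cong A\otimes Y(k)$ with $dY(k)=0$ for a graded vector space $Y(k)$. A semifree resolution of a DG module $M$ is a quasi-isomorphism $P\to M$ of $A$-modules with $P$ semifree. Toomer invariant: for a connected KS complex $\Lambda V$ and a semifree $\Lambda V$-module $P$, $e_{\Lambda V}(P)$ is the least integer $m\ge0$ (or $\infty$ if none exists) such that the projection $P\to P/(\Lambda^{>m}V\cdot P)$ is injective on cohomology. For a general $\Lambda V$-module $M$, $e_{\Lambda V}(M)$ is defined as $e_{\Lambda V}$ of a semifree resolution of $M$. In the statement, $\Lambda V$ is a $\Lambda Z$-module via the inclusion $\Lambda Z\to\Lambda V$, and $\Lambda^{\ge q}W$ is a DG module over $(\Lambda W,\bar d)$, as an ideal of it. *)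

(* Defs.v *)
From HB Require Import structures.
From mathcomp Require Import all_boot all_order all_algebra.
From mathcomp Require Import generic_quotient ring_quotient.
From mathcomp Require Import boolp classical_sets.
Set Implicit Arguments.
Unset Strict Implicit.
Unset Printing Implicit Defensive.
Import Order.TTheory GRing.Theory Num.Theory.
Local Open Scope ring_scope.

Section Span.
Context {k : fieldType} {V : lmodType k}.
Implicit Type G : set V.

(* Smallest linear subspace containing G. *)
Definition span G : {pred V} :=
  fun x => `[< forall S : submodClosed V,
                 (forall g, G g -> g \in S) -> x \in S >].

Lemma span_closed G : submod_closed (span G).
Proof.
split; first by apply/asboolP=> S _; rewrite rpred0.
move=> a x y /asboolP hx /asboolP hy; apply/asboolP=> S GS.
by rewrite rpredD ?rpredZ ?hx ?hy.
Qed.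

HB.instance Definition _ G :=
  GRing.isSubmodClosed.Build k V (span G) (span_closed G).

Lemma sub_span G x : G x -> x \in span G.
Proof. by move=> Gx; apply/asboolP=> S; apply. Qed.

Lemma span_min G (S : submodClosed V) :
  (forall g, G g -> g \in S) -> {subset span G <= S}.
Proof. by move=> GS x /asboolP; apply. Qed.
End Span.

Section SpanInd.
Context {k : fieldType} {V : lmodType k} (P : V -> Prop).
Context (P0 : P 0) (PL : forall a x y, P x -> P y -> P (a *: x + y)).

Definition prop_pred of P 0 & (forall a x y, P x -> P y -> P (a *: x + y)) :
  {pred V} := fun x => `[< P x >].

Local Notation PP := (prop_pred P0 PL).

Lemma prop_pred_closed : submod_closed PP.
Proof.
split; first exact/asboolP.
by move=> a x y /asboolP hx /asboolP hy; apply/asboolP/PL.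
Qed.

HB.instance Definition _ := GRing.isSubmodClosed.Build k V PP prop_pred_closed.

Lemma span_ind (G : set V) :
  (forall g, G g -> P g) -> forall x, x \in span G -> P x.
Proof.
move=> GP x xG; apply/asboolP; apply: (@span_min _ _ G PP) xG => g Gg.
exact/asboolP/GP.
Qed.
End SpanInd.

(* A grading is given by the projections pr i onto the homogeneous components,
   each element being the sum of finitely many of its components. *)
HB.mixin Record isGraded (k : fieldType) V of GRing.Lmodule k V := {
  pr : int -> {linear V -> V};
  pr_pr : forall i j x, pr i (pr j x) = if i == j then pr j x else 0;
  pr_sum : forall x, exists2 s : seq int, uniq s & x = \sum_(i <- s) pr i x
}.

#[short(type=gradedType)]
HB.structure Definition Graded (k : fieldType) :=
  { V of isGraded k V & GRing.Lmodule k V }.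

Definition homog {k : fieldType} {V : gradedType k} (i : int) : {pred V} :=
  [pred x | pr i x == x].

HB.mixin Record isGCA (k : fieldType) A of GRing.Algebra k A & Graded k A := {
  pr_lt0 : forall (i : int) (x : A), i < 0 -> pr i x = 0;
  homog1 : (1 : A) \in homog 0;
  homogM : forall (i j : int) (x y : A),
    x \in homog i -> y \in homog j -> x * y \in homog (i + j);
  homogC : forall (i j : int) (x y : A),
    x \in homog i -> y \in homog j -> x * y = ((-1) ^ (i * j) : k) *: (y * x)
}.

#[short(type=gcaType)]
HB.structure Definition GCA (k : fieldType) :=
  { A of isGCA k A & GRing.Algebra k A & Graded k A }.

HB.mixin Record isCDGA (k : fieldType) A of GCA k A := {
  diff : {linear A -> A};
  homog_diff : forall (i : int) (x : A),
    x \in homog i -> diff x \in homog (i + 1);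
  diffK : forall x : A, diff (diff x) = 0;
  diffM : forall (i : int) (x y : A), x \in homog i ->
    diff (x * y) = diff x * y + ((-1) ^ i : k) *: (x * diff y)
}.

#[short(type=cdgaType)]
HB.structure Definition CDGA (k : fieldType) := { A of isCDGA k A & GCA k A }.

Section GradedLemmas.
Context {k : fieldType} {V : gradedType k}.

Lemma homogP i (x : V) : reflect (pr i x = x) (x \in homog i).
Proof. exact: eqP. Qed.

Lemma homog_pr i (x : V) : pr i x \in homog i.
Proof. by apply/homogP; rewrite pr_pr eqxx. Qed.

Lemma pr_homog i j (x : V) : x \in homog j -> pr i x = if i == j then x else 0.
Proof. by move=> /homogP <-; rewrite pr_pr; case: eqP. Qed.

Lemma pr_notin (x : V) (s : seq int) i :
  x = \sum_(j <- s) pr j x -> i \notin s -> pr i x = 0.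
Proof.
move=> ex si; rewrite ex linear_sum big_seq big1 // => j js; rewrite pr_pr.
by case: eqP => // ij; rewrite ij js in si.
Qed.

Lemma pr_sum_sub (x : V) (s : seq int) :
  uniq s -> (forall i, i \notin s -> pr i x = 0) -> x = \sum_(i <- s) pr i x.
Proof.
move=> us sx; have [t ut ex] := pr_sum x.
rewrite {1}ex (bigID (mem s)) /= [X in _ + X]big1 ?addr0; last by move=> i /sx.
rewrite [RHS](bigID (mem t)) /= [X in _ = _ + X]big1 ?addr0; last first.
  by move=> i /(pr_notin ex).
rewrite -big_filter -[RHS]big_filter.
apply/perm_big/uniq_perm; rewrite ?filter_uniq //.
by move=> i; rewrite !mem_filter andbC.
Qed.
End GradedLemmas.

Record grmor (k : fieldType) (V W : gradedType k) := GrMor {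
  grmor_fun :> {linear V -> W};
  grmor_homog : forall i x, x \in homog i -> grmor_fun x \in homog i
}.

Record gcamor (k : fieldType) (A B : gcaType k) := GcaMor {
  gcamor_fun :> {lrmorphism A -> B};
  gcamor_homog : forall i x, x \in homog i -> gcamor_fun x \in homog i
}.

Record cdgamor (k : fieldType) (A B : cdgaType k) := CdgaMor {
  cdgamor_gca :> gcamor A B;
  cdgamor_diff : forall x, cdgamor_gca (diff x) = diff (cdgamor_gca x)
}.

Record grsub (k : fieldType) (V : gradedType k) := GrSub {
  grsub_sub :> submodClosed V;
  grsub_pr : forall i x, x \in grsub_sub -> pr i x \in grsub_sub
}.

(* The library's V * W, graded as the direct sum of V and W. *)
Section ProdGraded.
Context {k : fieldType} {V W : gradedType k}.

Definition prod_pr (i : int) (x : V * W) : V * W := (pr i x.1, pr i x.2).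

Lemma prod_pr_linear i : linear (prod_pr i).
Proof. by move=> a x y; rewrite /prod_pr !linearP. Qed.

HB.instance Definition _ i :=
  GRing.isLinear.Build k (V * W)%type (V * W)%type _ (prod_pr i)
    (prod_pr_linear i).

Lemma prod_pr_pr i j x :
  prod_pr i (prod_pr j x) = if i == j then prod_pr j x else 0.
Proof. by rewrite /prod_pr /= !pr_pr; case: eqP. Qed.

Lemma prod_pr_sum x :
  exists2 s : seq int, uniq s & x = \sum_(i <- s) prod_pr i x.
Proof.
have [s1 _ e1] := pr_sum x.1; have [s2 _ e2] := pr_sum x.2.
exists (undup (s1 ++ s2)); first exact: undup_uniq.
have -> : \sum_(i <- undup (s1 ++ s2)) prod_pr i x =
    (\sum_(i <- undup (s1 ++ s2)) pr i x.1, \sum_(i <- undup (s1 ++ s2)) pr i x.2).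
  elim: (undup _) => [|i s IH]; first by rewrite !big_nil.
  by rewrite !big_cons IH.
rewrite -(pr_sum_sub (x := x.1)) ?undup_uniq // -?(pr_sum_sub (x := x.2)) ?undup_uniq //.
- by case: x {e1 e2}.
- by move=> i; rewrite mem_undup mem_cat negb_or => /andP[_ /(pr_notin e2)].
- by move=> i; rewrite mem_undup mem_cat negb_or => /andP[/(pr_notin e1)].
Qed.

HB.instance Definition _ :=
  isGraded.Build k (V * W)%type prod_pr_pr prod_pr_sum.

End ProdGraded.

Definition sub_carrier (k : fieldType) (V : gradedType k) (S : grsub V) : Type :=
  {x : V | x \in (S : submodClosed V)}.

Section SubGraded.
Context {k : fieldType} {V : gradedType k} (S : grsub V).

HB.instance Definition _ := SubChoice.on (sub_carrier S).
HB.instance Definition _ := [SubChoice_isSubLmodule of sub_carrier S by <:].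

Definition sub_pr (i : int) (x : sub_carrier S) : sub_carrier S :=
  Sub (pr i (\val x)) (grsub_pr i (valP x)).

Lemma sub_pr_linear i : linear (sub_pr i).
Proof. by move=> a x y; apply: val_inj; rewrite /= !linearP. Qed.

HB.instance Definition _ i :=
  GRing.isLinear.Build k (sub_carrier S) (sub_carrier S) _ (sub_pr i)
    (sub_pr_linear i).

Lemma sub_pr_pr i j x :
  sub_pr i (sub_pr j x) = if i == j then sub_pr j x else 0.
Proof. by apply: val_inj; rewrite /= pr_pr; case: eqP. Qed.

Lemma sub_pr_sum x : exists2 s : seq int, uniq s & x = \sum_(i <- s) sub_pr i x.
Proof.
have [s us e] := pr_sum (\val x); exists s => //; apply: val_inj.
by rewrite [LHS]e raddf_sum.
Qed.

HB.instance Definition _ :=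
  isGraded.Build k (sub_carrier S) sub_pr_pr sub_pr_sum.

Lemma homog_val i (x : sub_carrier S) : (x \in homog i) = (\val x \in homog i).
Proof.
apply/homogP/homogP => [/(congr1 val) //|e].
by change (sub_pr i x = x); apply: val_inj.
Qed.
End SubGraded.

(* The library's additive quotients ask for a zmodClosed predicate. *)
Section SubmodZmod.
Context {k : fieldType} {V : lmodType k} (S : submodClosed V).

Definition submod_pred : {pred V} := fun x => x \in S.

Lemma submod_pred_zmod : zmod_closed submod_pred.
Proof. exact: GRing.submod_closedB (submodClosedP S). Qed.

HB.instance Definition _ := GRing.isZmodClosed.Build V submod_pred submod_pred_zmod.

Lemma submodB x y : x \in S -> y \in S -> x - y \in S.
Proof. exact: (@rpredB V submod_pred). Qed.
End SubmodZmod.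

Definition quo_carrier (k : fieldType) (V : gradedType k) (S : grsub V) : Type :=
  Quotient.quot (submod_pred (S : submodClosed V)).

Section QuoGraded.
Context {k : fieldType} {V : gradedType k} (S : grsub V).
Local Open Scope quotient_scope.

HB.instance Definition _ := GRing.Zmodule.on (quo_carrier S).

Definition quo_pi (x : V) : quo_carrier S := \pi_(quo_carrier S) x.

Lemma quo_piP x y : reflect (quo_pi x = quo_pi y) (x - y \in (S : submodClosed V)).
Proof.
rewrite -[x - y \in _]/(x - y \in submod_pred S) Quotient.idealrBE; exact: eqP.
Qed.

Lemma quo_pi_surj (u : quo_carrier S) : exists x, u = quo_pi x.
Proof. by exists (repr u); rewrite /quo_pi reprK. Qed.

Lemma quo_pi_repr x : repr (quo_pi x) - x \in (S : submodClosed V).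
Proof. by apply/quo_piP; rewrite /quo_pi reprK. Qed.

Lemma quo_piD x y : quo_pi (x + y) = quo_pi x + quo_pi y.
Proof. exact: Quotient.pi_add. Qed.

Lemma quo_pi0 x : (quo_pi x = 0) <-> (x \in (S : submodClosed V)).
Proof.
have <- : quo_pi 0 = 0 by rewrite /quo_pi; apply: (addrI (quo_pi 0)); rewrite -quo_piD !addr0.
by split=> [/quo_piP|h]; [rewrite subr0|apply/quo_piP; rewrite subr0].
Qed.

(* Descends f to the quotient, whenever f preserves S. *)
Definition quo_lift (f : V -> V) (u : quo_carrier S) : quo_carrier S :=
  quo_pi (f (repr u)).

Lemma quo_liftE (f : V -> V) :
    (forall x y, f (x - y) = f x - f y) ->
    (forall x, x \in (S : submodClosed V) -> f x \in (S : submodClosed V)) ->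
  forall x, quo_lift f (quo_pi x) = quo_pi (f x).
Proof. by move=> fB fS x; apply/quo_piP; rewrite -fB fS ?quo_pi_repr. Qed.

Definition quo_scale (a : k) := quo_lift ( *:%R a).

Lemma quo_scaleE a x : quo_scale a (quo_pi x) = quo_pi (a *: x).
Proof.
by apply: quo_liftE => [y z|y yS]; [rewrite scalerBr|rewrite rpredZ].
Qed.

Fact quo_scaleA a b u : quo_scale a (quo_scale b u) = quo_scale (a * b) u.
Proof. by have [x ->] := quo_pi_surj u; rewrite !quo_scaleE scalerA. Qed.
Fact quo_scale1 : left_id 1 quo_scale.
Proof. by move=> u; have [x ->] := quo_pi_surj u; rewrite quo_scaleE scale1r. Qed.
Fact quo_scaleDr : right_distributive quo_scale +%R.
Proof.
move=> a u v; have [x ->] := quo_pi_surj u; have [y ->] := quo_pi_surj v.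
by rewrite -quo_piD !quo_scaleE -quo_piD scalerDr.
Qed.
Fact quo_scaleDl u : {morph quo_scale^~ u : a b / a + b}.
Proof.
by move=> a b; have [x ->] := quo_pi_surj u; rewrite !quo_scaleE -quo_piD scalerDl.
Qed.

HB.instance Definition _ := GRing.Zmodule_isLmodule.Build k (quo_carrier S)
  quo_scaleA quo_scale1 quo_scaleDr quo_scaleDl.

Lemma quo_pi_linear : linear quo_pi.
Proof. by move=> a x y; rewrite quo_piD -quo_scaleE. Qed.

HB.instance Definition _ :=
  GRing.isLinear.Build k V (quo_carrier S) _ quo_pi quo_pi_linear.

Lemma quo_lift_linear (f : {linear V -> V}) :
    (forall x, x \in (S : submodClosed V) -> f x \in (S : submodClosed V)) ->
  linear (quo_lift f).
Proof.
move=> fS a u v; have [x ->] := quo_pi_surj u; have [y ->] := quo_pi_surj v.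
by rewrite -linearP !quo_liftE ?linearP //; apply: linearB.
Qed.

Definition quo_pr (i : int) : quo_carrier S -> quo_carrier S := quo_lift (pr i).

HB.instance Definition _ i :=
  GRing.isLinear.Build k (quo_carrier S) (quo_carrier S) _ (quo_pr i)
    (quo_lift_linear (@grsub_pr _ _ S i)).

Lemma quo_prE i x : quo_pr i (quo_pi x) = quo_pi (pr i x).
Proof. by apply: quo_liftE; [apply: linearB|apply: grsub_pr]. Qed.

Lemma quo_pr_pr i j u :
  quo_pr i (quo_pr j u) = if i == j then quo_pr j u else 0.
Proof.
have [x ->] := quo_pi_surj u; rewrite !quo_prE pr_pr.
by case: eqP => //; rewrite linear0.
Qed.

Lemma quo_pr_sum u : exists2 s : seq int, uniq s & u = \sum_(i <- s) quo_pr i u.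
Proof.
have [x ->] := quo_pi_surj u; have [s us e] := pr_sum x; exists s => //.
by rewrite {1}e linear_sum; apply: eq_bigr => i _; rewrite quo_prE.
Qed.

HB.instance Definition _ :=
  isGraded.Build k (quo_carrier S) quo_pr_pr quo_pr_sum.

Lemma homog_quo i (u : quo_carrier S) :
  u \in homog i -> exists2 x : V, x \in homog i & u = quo_pi x.
Proof.
have [x ->] := quo_pi_surj u; move=> /homogP e; exists (pr i x).
  exact: homog_pr.
by rewrite -quo_prE.
Qed.

Lemma quo_homog i x : x \in homog i -> quo_pi x \in homog i.
Proof. by move=> /homogP e; apply/homogP; rewrite [LHS]quo_prE e. Qed.
End QuoGraded.

(* DG modules are graded over int, hence may live in negative degrees. *)
Record dgmod (k : fieldType) (A : cdgaType k) := DGMod {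
  dgmod_graded :> gradedType k;
  act : A -> dgmod_graded -> dgmod_graded;
  mdiff : {linear dgmod_graded -> dgmod_graded};
  act_linear : forall a, linear (act a);
  act_linearl : forall x, linear (act^~ x);
  act1 : forall x, act 1 x = x;
  actM : forall a b x, act (a * b) x = act a (act b x);
  homog_act : forall i j a x,
    a \in homog i -> x \in homog j -> act a x \in homog (i + j);
  homog_mdiff : forall i x, x \in homog i -> mdiff x \in homog (i + 1);
  mdiffK : forall x, mdiff (mdiff x) = 0;
  mdiff_act : forall i a x, a \in homog i ->
    mdiff (act a x) = act (diff a) x + ((-1) ^ i : k) *: act a (mdiff x)
}.
Arguments act {k A d}.
Arguments mdiff {k A d}.

Section ActLemmas.
Context {k : fieldType} {A : cdgaType k} {M : dgmod A}.

HB.instance Definition _ a :=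
  GRing.isLinear.Build k M M _ (act a) (@act_linear k A M a).

Definition actl (x : M) : A -> M := act^~ x.

HB.instance Definition _ (x : M) :=
  GRing.isLinear.Build k A M _ (actl x) (@act_linearl k A M x).
End ActLemmas.

Record dgmor (k : fieldType) (A : cdgaType k) (M N : dgmod A) := DGMor {
  dgmor_grmor :> grmor M N;
  dgmor_act : forall a x, dgmor_grmor (act a x) = act a (dgmor_grmor x);
  dgmor_diff : forall x, dgmor_grmor (mdiff x) = mdiff (dgmor_grmor x)
}.

Record dgsub (k : fieldType) (A : cdgaType k) (M : dgmod A) := DGSub {
  dgsub_grsub :> grsub M;
  dgsub_act : forall a x, x \in (dgsub_grsub : submodClosed M) ->
    act a x \in (dgsub_grsub : submodClosed M);
  dgsub_diff : forall x, x \in (dgsub_grsub : submodClosed M) ->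
    mdiff x \in (dgsub_grsub : submodClosed M)
}.

Section SubDG.
Context {k : fieldType} {A : cdgaType k} {M : dgmod A} (S : dgsub M).
Local Notation T := (sub_carrier S).

Definition sub_act (a : A) (x : T) : T := Sub (act a (\val x)) (dgsub_act a (valP x)).
Definition sub_diff (x : T) : T := Sub (mdiff (\val x)) (dgsub_diff (valP x)).

Fact sub_diff_linear : linear sub_diff.
Proof. by move=> a x y; apply: val_inj; rewrite /= !linearP. Qed.
HB.instance Definition _ := GRing.isLinear.Build k T T _ sub_diff sub_diff_linear.

Fact sub_act_linear a : linear (sub_act a).
Proof. by move=> c x y; apply: val_inj; rewrite /= !linearP. Qed.
Fact sub_act_linearl x : linear (sub_act^~ x).
Proof.
by move=> c a b; apply: val_inj; rewrite /= -/(actl _ _) linearP.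
Qed.
Fact sub_act1 x : sub_act 1 x = x.
Proof. by apply: val_inj; rewrite /= act1. Qed.
Fact sub_actM a b x : sub_act (a * b) x = sub_act a (sub_act b x).
Proof. by apply: val_inj; rewrite /= actM. Qed.
Fact sub_homog_act i j a (x : T) :
  a \in homog i -> x \in homog j -> sub_act a x \in homog (i + j).
Proof. by rewrite !homog_val; apply: homog_act. Qed.
Fact sub_homog_diff i (x : T) : x \in homog i -> sub_diff x \in homog (i + 1).
Proof. by rewrite !homog_val; apply: homog_mdiff. Qed.
Fact sub_diffK x : sub_diff (sub_diff x) = 0.
Proof. by apply: val_inj; rewrite /= mdiffK. Qed.
Fact sub_diff_act i a x : a \in homog i ->
  sub_diff (sub_act a x) =
  sub_act (diff a) x + ((-1) ^ i : k) *: sub_act a (sub_diff x).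
Proof. by move=> ai; apply: val_inj; rewrite /= (mdiff_act _ ai). Qed.

Definition sub_dgmod : dgmod A :=
  DGMod sub_act_linear sub_act_linearl sub_act1 sub_actM sub_homog_act
    sub_homog_diff sub_diffK sub_diff_act.
End SubDG.

Section QuoDG.
Context {k : fieldType} {A : cdgaType k} {M : dgmod A} (S : dgsub M).
Local Notation Q := (quo_carrier S).
Local Notation pi := (@quo_pi k M S).

Definition quo_act (a : A) : Q -> Q := quo_lift (act a).
Definition quo_diff : Q -> Q := quo_lift mdiff.

Lemma quo_actE a x : quo_act a (pi x) = pi (act a x).
Proof. by apply: quo_liftE; [apply: linearB|apply: dgsub_act]. Qed.
Lemma quo_diffE x : quo_diff (pi x) = pi (mdiff x).
Proof. by apply: quo_liftE; [apply: linearB|apply: dgsub_diff]. Qed.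

HB.instance Definition _ := GRing.isLinear.Build k Q Q _ quo_diff
  (quo_lift_linear (@dgsub_diff _ _ _ S)).

Fact quo_act_linear a : linear (quo_act a).
Proof. exact: (quo_lift_linear (@dgsub_act _ _ _ S a)). Qed.
Fact quo_act_linearl u : linear (quo_act^~ u).
Proof.
have [x ->] := quo_pi_surj u => c a b; rewrite !quo_actE -linearP.
by congr (pi _); apply: act_linearl.
Qed.
Fact quo_act1 u : quo_act 1 u = u.
Proof. by have [x ->] := quo_pi_surj u; rewrite quo_actE act1. Qed.
Fact quo_actM a b u : quo_act (a * b) u = quo_act a (quo_act b u).
Proof. by have [x ->] := quo_pi_surj u; rewrite !quo_actE actM. Qed.
Fact quo_homog_act i j a (u : Q) :
  a \in homog i -> u \in homog j -> quo_act a u \in homog (i + j).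
Proof.
move=> ai /homog_quo[x xj ->]; rewrite quo_actE.
exact/quo_homog/homog_act.
Qed.
Fact quo_homog_diff i (u : Q) : u \in homog i -> quo_diff u \in homog (i + 1).
Proof.
by move=> /homog_quo[x xi ->]; rewrite quo_diffE; apply/quo_homog/homog_mdiff.
Qed.
Fact quo_diffK u : quo_diff (quo_diff u) = 0.
Proof.
by have [x ->] := quo_pi_surj u; rewrite !quo_diffE mdiffK linear0.
Qed.
Fact quo_diff_act i a u : a \in homog i ->
  quo_diff (quo_act a u) =
  quo_act (diff a) u + ((-1) ^ i : k) *: quo_act a (quo_diff u).
Proof.
have [x ->] := quo_pi_surj u => ai.
by rewrite quo_diffE !quo_actE quo_diffE (mdiff_act _ ai) linearD linearZ.
Qed.

Definition quo_dgmod : dgmod A :=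
  DGMod quo_act_linear quo_act_linearl quo_act1 quo_actM quo_homog_act
    quo_homog_diff quo_diffK quo_diff_act.
End QuoDG.

(* T, or rather its intersection with S, as a DG submodule of S. *)
Section Trace.
Context {k : fieldType} {A : cdgaType k} {M : dgmod A} (S T : dgsub M).

Definition trace_pred : {pred sub_dgmod S} :=
  fun x => (\val (x : sub_carrier S) : M) \in (T : submodClosed M).

Fact trace_closed : submod_closed trace_pred.
Proof.
split; first exact: (submodClosedP T).1.
by move=> a x y; apply: (submodClosedP T).2.
Qed.
HB.instance Definition _ :=
  GRing.isSubmodClosed.Build k (sub_dgmod S) trace_pred trace_closed.

Fact trace_pr i x : x \in trace_pred -> pr i x \in trace_pred.
Proof. exact: (@grsub_pr _ _ T i (\val (x : sub_carrier S))). Qed.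
Fact trace_act a x : x \in trace_pred -> act a x \in trace_pred.
Proof. exact: (@dgsub_act _ _ _ T a (\val (x : sub_carrier S))). Qed.
Fact trace_diff x : x \in trace_pred -> mdiff x \in trace_pred.
Proof. exact: (@dgsub_diff _ _ _ T (\val (x : sub_carrier S))). Qed.

Definition trace_dgsub : dgsub (sub_dgmod S) :=
  @DGSub _ _ _ (@GrSub _ _ (trace_pred : submodClosed _) trace_pr)
    trace_act trace_diff.
End Trace.

Definition regular (k : fieldType) (A : cdgaType k) : dgmod A.
Proof.
refine (@DGMod k A (A : gradedType k) (fun a x => a * x) diff
          _ _ _ _ _ _ _ _).
- by move=> a c x y; rewrite mulrDr scalerAr.
- by move=> x c a b; rewrite mulrDl scalerAl.
- exact: mul1r.
- by move=> a b x; rewrite mulrA.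
- exact: homogM.
- exact: homog_diff.
- exact: diffK.
- by move=> i a x; apply: diffM.
Defined.

Definition restrict (k : fieldType) (A B : cdgaType k) (f : cdgamor A B)
  (M : dgmod B) : dgmod A.
Proof.
refine (@DGMod k A M (fun a x => act (f a) x) mdiff _ _ _ _ _ _ _ _).
- by move=> a c x y; apply: act_linear.
- by move=> x c a b; rewrite linearP; apply: act_linearl.
- by move=> x; rewrite rmorph1 act1.
- by move=> a b x; rewrite rmorphM actM.
- by move=> i j a x ai; apply/homog_act/gcamor_homog.
- exact: homog_mdiff.
- exact: mdiffK.
- move=> i a x ai; rewrite cdgamor_diff; apply: mdiff_act.
  exact: gcamor_homog.
Defined.

(* gen : V -> A exhibits A as the free graded commutative algebra on V. *)
Definition free_on (k : fieldType) (V : gradedType k) (A : gcaType k)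
    (gen : grmor V A) : Prop :=
  forall (B : gcaType k) (f : grmor V B),
    exists g : gcamor A B, (forall v, g (gen v) = f v) /\
      forall g' : gcamor A B, (forall v, g' (gen v) = f v) -> g' =1 g.

(* A CDGA of the form (Lambda V, d). *)
Record freeCDGA (k : fieldType) (V : gradedType k) := FreeCDGA {
  freeCDGA_cdga :> cdgaType k;
  gen : grmor V freeCDGA_cdga;
  gen_nneg : forall (i : int) (v : V), i < 0 -> pr i v = 0;
  gen_free : free_on gen
}.
Arguments gen {k V f}.

(* Span of the words of length >= q with letters in F. For a subspace F of V,
   words_ge L F 0 is Lambda F; words_ge L predT q is Lambda^{>= q} V. *)
Definition words_ge (k : fieldType) (V : gradedType k) (L : freeCDGA V)
    (F : {pred V}) (q : nat) : submodClosed L :=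
  span [set x : L | exists s : seq V,
          [/\ {subset s <= F}, (q <= size s)%N & x = \prod_(v <- s) gen v]].

Section Words.
Context {k : fieldType} {V : gradedType k} {L : freeCDGA V}.

Lemma words_geM F p q x y : x \in words_ge L F p -> y \in words_ge L F q ->
  x * y \in words_ge L F (p + q).
Proof.
move=> + yq; move: x; apply: span_ind.
- by rewrite mul0r rpred0.
- by move=> a x x' hx hx'; rewrite mulrDl -scalerAl rpredD ?rpredZ.
move=> _ [s [sF sp ->]]; move: y yq; apply: span_ind.
- by rewrite mulr0 rpred0.
- by move=> a x x' hx hx'; rewrite mulrDr -scalerAr rpredD ?rpredZ.
move=> _ [t [tF tq ->]]; rewrite -big_cat; apply: sub_span; exists (s ++ t).
split => //; last by rewrite size_cat leq_add.
by move=> v; rewrite mem_cat => /orP[/sF|/tF].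
Qed.

Lemma words_geS F p q : (q <= p)%N -> {subset words_ge L F p <= words_ge L F q}.
Proof.
move=> qp; apply: span_min => _ [s [sF sp ->]]; apply: sub_span; exists s.
by split=> //; apply: leq_trans sp.
Qed.

Lemma words_ge1 F : 1 \in words_ge L F 0.
Proof. by apply: sub_span; exists [::]; rewrite big_nil. Qed.

Lemma words_gen F v : v \in F -> gen v \in words_ge L F 1.
Proof.
move=> vF; apply: sub_span; exists [:: v]; rewrite big_seq1; split=> //.
by move=> w; rewrite inE => /eqP ->.
Qed.

(* Words with homogeneous letters suffice. *)
Definition hwords_ge (F : {pred V}) (q : nat) : submodClosed L :=
  span [set x : L | exists s : seq V,
    [/\ {subset s <= F}, forall v, v \in s -> exists i, v \in homog i,
        (q <= size s)%N & x = \prod_(v <- s) gen v]].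

Lemma hwords_geE (F : grsub V) q x :
  x \in words_ge L (F : submodClosed V) q ->
  x \in hwords_ge (F : submodClosed V) q.
Proof.
move: x; apply: span_min => _ [s [sF sq ->]].
suff H : \prod_(v <- s) gen v \in hwords_ge (F : submodClosed V) (size s).
  move: H; apply: span_min => _ [t [tF th ts ->]]; apply: sub_span; exists t.
  by split => //; apply: leq_trans ts.
elim: s sF {sq} => [|v s IH] sF.
  by rewrite big_nil; apply: sub_span; exists [::]; rewrite big_nil.
have vF : v \in (F : submodClosed V) by apply: sF; rewrite mem_head.
have {IH} : \prod_(w <- s) gen w \in hwords_ge (F : submodClosed V) (size s).
  by apply: IH => w ws; apply: sF; rewrite in_cons ws orbT.
rewrite big_cons /=; move: (\prod_(w <- s) gen w); apply: span_ind.
- by rewrite mulr0 rpred0.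
- by move=> a x x' hx hx'; rewrite mulrDr -scalerAr rpredD ?rpredZ.
move=> _ [t [tF th ts ->]]; have [r _ ->] := pr_sum v.
rewrite linear_sum mulr_suml; apply: rpred_sum => i _; apply: sub_span.
exists (pr i v :: t); rewrite big_cons; split=> //.
- by move=> w; rewrite inE => /orP[/eqP ->|/tF //]; apply: grsub_pr.
- move=> w; rewrite inE => /orP[/eqP ->|/th //]; exists i; exact: homog_pr.
Qed.

Lemma homog_prod (s : seq V) : (forall v, v \in s -> exists i, v \in homog i) ->
  exists i, \prod_(v <- s) (gen v : L) \in homog i.
Proof.
elim: s => [_|v s IH sh]; first by exists 0; rewrite big_nil homog1.
have [i vi] := sh v (mem_head _ _).
have [j sj] := IH (fun w ws => sh w (mem_behead (s := v :: s) ws)).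
by exists (i + j); rewrite big_cons homogM // grmor_homog.
Qed.

Lemma words_ge_pr (F : grsub V) q i x :
  x \in words_ge L (F : submodClosed V) q ->
  pr i x \in words_ge L (F : submodClosed V) q.
Proof.
move/hwords_geE; move: x; apply: span_ind; first by rewrite linear0 rpred0.
  by move=> a x y hx hy; rewrite linearP rpredD ?rpredZ.
move=> _ [s [sF sh sq ->]]; have [j sj] := homog_prod sh.
rewrite (pr_homog i sj); case: eqP => _; rewrite ?rpred0 //.
by apply: sub_span; exists s.
Qed.
End Words.

Section Full.
Context {k : fieldType} (V : gradedType k).
Definition full_pred : {pred V} := predT.
Fact full_closed : submod_closed full_pred. Proof. by []. Qed.
HB.instance Definition _ := GRing.isSubmodClosed.Build k V full_pred full_closed.
Definition full : grsub V :=
  @GrSub k V (full_pred : submodClosed V) (fun i x _ => isT).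
End Full.
Arguments full_pred {k} V.

Section Generation.
Context {k : fieldType} {V : gradedType k} (L : freeCDGA V).

Definition wspan : Type := {x : L | x \in words_ge L (full_pred V) 0}.

Fact words_alg : GRing.subalg_closed (words_ge L (full_pred V) 0).
Proof.
split; first exact: words_ge1.
  by move=> a x y hx hy; rewrite rpredD ?rpredZ.
by move=> x y; apply: words_geM.
Qed.

HB.instance Definition _ := SubChoice.on wspan.
HB.instance Definition _ :=
  GRing.SubChoice_isSubAlgebra.Build k L _ wspan words_alg.

Definition wspan_pr (i : int) (x : wspan) : wspan :=
  Sub (pr i (\val x)) (words_ge_pr (F := full V) i (valP x)).

Fact wspan_pr_linear i : linear (wspan_pr i).
Proof. by move=> a x y; apply: val_inj; rewrite /= !linearP. Qed.
HB.instance Definition _ i :=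
  GRing.isLinear.Build k wspan wspan _ (wspan_pr i) (wspan_pr_linear i).
Fact wspan_pr_pr i j x :
  wspan_pr i (wspan_pr j x) = if i == j then wspan_pr j x else 0.
Proof. by apply: val_inj; rewrite /= pr_pr; case: eqP. Qed.
Fact wspan_pr_sum x : exists2 s : seq int, uniq s & x = \sum_(i <- s) wspan_pr i x.
Proof.
have [s us e] := pr_sum (\val x); exists s => //; apply: val_inj.
by rewrite [LHS]e raddf_sum.
Qed.
HB.instance Definition _ := isGraded.Build k wspan wspan_pr_pr wspan_pr_sum.

Fact homog_wspan i (x : wspan) : (x \in homog i) = (\val x \in homog i).
Proof.
apply/homogP/homogP => [/(congr1 val) //|e].
by change (wspan_pr i x = x); apply: val_inj.
Qed.
Fact wspan_lt0 (i : int) (x : wspan) : i < 0 -> pr i x = 0.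
Proof. by move=> i0; change (wspan_pr i x = 0); apply: val_inj; apply: pr_lt0. Qed.
Fact wspan_1 : (1 : wspan) \in homog 0.
Proof. by rewrite homog_wspan homog1. Qed.
Fact wspan_M (i j : int) (x y : wspan) :
  x \in homog i -> y \in homog j -> x * y \in homog (i + j).
Proof. by rewrite !homog_wspan; apply: homogM. Qed.
Fact wspan_C (i j : int) (x y : wspan) :
  x \in homog i -> y \in homog j -> x * y = ((-1) ^ (i * j) : k) *: (y * x).
Proof. by rewrite !homog_wspan => xi yj; apply: val_inj; apply: homogC. Qed.
HB.instance Definition _ := isGCA.Build k wspan wspan_lt0 wspan_1 wspan_M wspan_C.

Definition wspan_gen (v : V) : wspan :=
  Sub (gen v : L) (words_geS (leq0n 1) (words_gen (F := full_pred V) (v := v) isT)).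
Fact wspan_gen_linear : linear wspan_gen.
Proof. by move=> a x y; apply: val_inj; rewrite /= !linearP. Qed.
HB.instance Definition _ :=
  GRing.isLinear.Build k V wspan _ wspan_gen wspan_gen_linear.
Fact wspan_gen_homog i v : v \in homog i -> wspan_gen v \in homog i.
Proof. by move=> vi; rewrite homog_wspan; apply: grmor_homog. Qed.

Definition wspan_val (x : wspan) : L := \val x.
Fact wspan_val_linear : linear wspan_val.
Proof. by move=> a x y; rewrite /wspan_val linearP. Qed.
Fact wspan_val_monoid : monoid_morphism wspan_val.
Proof. by split=> // x y; rewrite /wspan_val rmorphM. Qed.
HB.instance Definition _ :=
  GRing.isLinear.Build k wspan L _ wspan_val wspan_val_linear.
HB.instance Definition _ :=
  GRing.isMonoidMorphism.Build wspan L wspan_val wspan_val_monoid.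

Lemma words_full (x : L) : x \in words_ge L (full_pred V) 0.
Proof.
have [g [gE _]] := @gen_free k V L _ (GrMor wspan_gen_homog).
pose h : {lrmorphism L -> L} := wspan_val \o g.
have hh i y : y \in homog i -> h y \in homog i.
  by move=> yi; have := gcamor_homog g yi; rewrite homog_wspan.
have [e [_ eU]] := @gen_free k V L L gen.
have he : h x = x.
  rewrite (eU (GcaMor hh)); last by move=> v; rewrite /= gE.
  by rewrite -(eU (@GcaMor k L L (idfun : {lrmorphism L -> L}) (fun _ _ => id))).
rewrite -he; exact: valP (g x).
Qed.
End Generation.

Section WordIdeal.
Context {k : fieldType} {V : gradedType k} (L : freeCDGA V).
Local Notation Lam := (words_ge L (full_pred V)).

Lemma posdeg_words (i : int) (x : L) : 0 < i -> x \in homog i -> x \in Lam 1.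
Proof.
move=> i0 /homogP <-; move: x (words_full x); apply: span_ind.
- by rewrite linear0 rpred0.
- by move=> a x y hx hy; rewrite linearP rpredD ?rpredZ.
move=> _ [[|v s] [sF _ ->]].
  by rewrite big_nil (pr_homog _ homog1) gt_eqF ?rpred0.
apply: (words_ge_pr (F := full V)); apply: sub_span.
by exists (v :: s).
Qed.

Lemma diff_gen v : diff (gen v : L) \in Lam 1.
Proof.
have [s _ ->] := pr_sum v; rewrite !linear_sum; apply: rpred_sum => i _.
have [i0|i0] := ltP i 0; first by rewrite gen_nneg // !linear0 rpred0.
by apply: (@posdeg_words (i + 1)); rewrite ?ltzD1 // homog_diff // grmor_homog // homog_pr.
Qed.

Fact word_ideal_act q (a : L) (x : regular L) : x \in Lam q -> act a x \in Lam q.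
Proof. by move=> xq; apply: (words_geM (p := 0) (words_full a) xq). Qed.

Fact word_ideal_diff q (x : regular L) : x \in Lam q -> mdiff x \in Lam q.
Proof.
move/(hwords_geE (F := full V)); move: x; apply: span_ind.
- by rewrite linear0 rpred0.
- by move=> a x y hx hy; rewrite linearP rpredD ?rpredZ.
move=> _ [s [_ sh sq ->]]; apply: (words_geS sq); elim: s sh {sq} => [|v s IH] sh.
  by rewrite words_full.
have [i vi] := sh v (mem_head _ _).
have {}IH := IH (fun w ws => sh w (mem_behead (s := v :: s) ws)).
have gvi : (gen v : L) \in homog i by exact: grmor_homog.
rewrite big_cons; change (diff ((gen v : L) * \prod_(j <- s) gen j) \in Lam (size s).+1).
rewrite (diffM _ _ _ gvi) rpredD ?rpredZ //.
  apply: (words_geM (p := 1) (diff_gen v)); apply: sub_span.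
  by exists s.
exact: (words_geM (p := 1) (words_gen (F := full_pred V) (v := v) isT) IH).
Qed.

(* Lambda^{>= q} V as a DG ideal of (Lambda V, d). *)
Definition word_ideal (q : nat) : dgsub (regular L) :=
  @DGSub k L (regular L)
    (@GrSub k (regular L) (Lam q) (@words_ge_pr _ _ L (full V) q))
    (@word_ideal_act q) (@word_ideal_diff q).
End WordIdeal.

(* The DG submodule I . M, for a DG ideal I of A. *)
Section IdealAct.
Context {k : fieldType} {A : cdgaType k} (I : dgsub (regular A)) (M : dgmod A).

Definition ideal_act_sub : submodClosed M :=
  span [set x : M | exists (a : A) (y : M),
          a \in (I : submodClosed (regular A)) /\ x = act a y].

Let mem_act (a : A) (y : M) : a \in (I : submodClosed (regular A)) ->
  act a y \in ideal_act_sub.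
Proof. by move=> aI; apply: sub_span; exists a, y. Qed.

Let act_sum (a : A) (x : M) : exists s t,
  act a x = \sum_(i <- s) \sum_(j <- t) act (pr i a) (pr j x).
Proof.
have [s _ es] := pr_sum a; have [t _ et] := pr_sum x; exists s, t.
rewrite {1}es -/(actl x _) linear_sum; apply: eq_bigr => i _ /=.
by rewrite /actl {1}et linear_sum.
Qed.

Fact ideal_act_pr n x : x \in ideal_act_sub -> pr n x \in ideal_act_sub.
Proof.
move: x; apply: span_ind; first by rewrite linear0 rpred0.
  by move=> a x y hx hy; rewrite linearP rpredD ?rpredZ.
move=> _ [a [x [aI ->]]]; have [s [t ->]] := act_sum a x.
rewrite linear_sum; apply: rpred_sum => i _.
rewrite linear_sum; apply: rpred_sum => j _.
rewrite (pr_homog _ (homog_act (homog_pr i a) (homog_pr j x))).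
case: eqP => _; rewrite ?rpred0 //; apply: mem_act.
exact: (@grsub_pr _ _ I).
Qed.

Fact ideal_act_act b x : x \in ideal_act_sub -> act b x \in ideal_act_sub.
Proof.
move: x; apply: span_ind; first by rewrite linear0 rpred0.
  by move=> a x y hx hy; rewrite linearP rpredD ?rpredZ.
move=> _ [a [x [aI ->]]]; rewrite -actM; apply: mem_act.
exact: (@dgsub_act _ _ _ I b a).
Qed.

Fact ideal_act_diff x : x \in ideal_act_sub -> mdiff x \in ideal_act_sub.
Proof.
move: x; apply: span_ind; first by rewrite linear0 rpred0.
  by move=> a x y hx hy; rewrite linearP rpredD ?rpredZ.
move=> _ [a [x [aI ->]]].
have [s _ es] := pr_sum a.
rewrite es -/(actl x _) !linear_sum; apply: rpred_sum => i _ /=.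
have aiI : pr i a \in (I : submodClosed (regular A)) by exact: (@grsub_pr _ _ I i a).
rewrite /actl (mdiff_act _ (homog_pr i a)) rpredD ?rpredZ ?mem_act //.
exact: (@dgsub_diff _ _ _ I).
Qed.

Definition ideal_act : dgsub M :=
  @DGSub k A M (@GrSub k M ideal_act_sub ideal_act_pr)
    ideal_act_act ideal_act_diff.
End IdealAct.

Definition bilinear_map (k : fieldType) (U V T : lmodType k) (b : U -> V -> T) :
    Prop :=
  (forall u, linear (b u)) /\ (forall v, linear (b^~ v)).

(* b exhibits T as the tensor product of U and V over k. *)
Definition is_tensor (k : fieldType) (U V T : lmodType k) (b : U -> V -> T) :
    Prop :=
  bilinear_map b /\
  forall (X : lmodType k) (c : U -> V -> X), bilinear_map c ->
    exists g : {linear T -> X}, (forall u v, g (b u v) = c u v) /\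
      forall g' : {linear T -> X}, (forall u v, g' (b u v) = c u v) -> g' =1 g.

(* Exhaustive increasing sequences of subspaces; F n is the (n-1)-st term of
   the sequence, which is usually indexed from -1. *)
Definition filtration (k : fieldType) (V : gradedType k) (F : nat -> grsub V) :
    Prop :=
  [/\ forall v, v \in (F 0 : submodClosed V) -> v = 0,
      forall n, {subset (F n : submodClosed V) <= (F n.+1 : submodClosed V)}
    & forall v, exists n, v \in (F n : submodClosed V)].

Definition concentrated_ge1 (k : fieldType) (V : gradedType k) : Prop :=
  forall (i : int) (v : V), i < 1 -> pr i v = 0.

Definition KS_complex (k : fieldType) (V : gradedType k) (L : freeCDGA V) :
    Prop :=
  exists F : nat -> grsub V, filtration F /\
    forall n v, v \in (F n.+1 : submodClosed V) ->
      diff (gen v : L) \in words_ge L (F n : submodClosed V) 0.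

Definition sullivan (k : fieldType) (V : gradedType k) (L : freeCDGA V) : Prop :=
  KS_complex L /\ concentrated_ge1 V.

Definition minimal_sullivan (k : fieldType) (V : gradedType k)
    (L : freeCDGA V) : Prop :=
  sullivan L /\ forall v, diff (gen v : L) \in words_ge L predT 2.

(* H^0(A) is the ground field: A vanishes in degree -1, so H^0(A) consists of
   the cocycles of degree 0. *)
Definition connected (k : fieldType) (A : cdgaType k) : Prop :=
  forall x : A, x \in homog 0 -> diff x = 0 -> exists c : k, x = c%:A.

Definition posdeg (k : fieldType) (A : gcaType k) : set A :=
  [set x | forall i : int, i < 1 -> pr i x = 0].

(* C is a relative Sullivan algebra B (x) Lambda W with fiber L = (Lambda W, dbar),
   where i b = b (x) 1 and j x = 1 (x) x; j is not required to commute with the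
   differentials. *)
Record relative_sullivan (k : fieldType) (B C : cdgaType k) (W : gradedType k)
    (L : freeCDGA W) (i : cdgamor B C) (j : gcamor L C) : Prop := RelSullivan {
  rs_base : connected B;
  rs_gens : concentrated_ge1 W;
  rs_tensor : is_tensor (fun (b : B) (x : L) => i b * j x);
  rs_filtration : exists F : nat -> grsub W, filtration F /\
    forall n w, w \in (F n.+1 : submodClosed W) ->
      diff (j (gen w)) \in
        span [set c : C | exists b x, [/\ exists a : k, posdeg (b - a%:A),
                x \in words_ge L (F n : submodClosed W) 0 & c = i b * j x]];
  (* dbar is the k (x) Lambda W component of d *)
  rs_fiber : forall x : L, diff (j x) - j (diff x) \in
    span [set c : C | exists b y, posdeg b /\ c = i b * j y]
}.

Section Cohomology.
Context {k : fieldType} {A : cdgaType k} {M N : dgmod A}.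

Definition cohomology_inj (f : M -> N) : Prop :=
  forall x, mdiff x = 0 -> (exists y, f x = mdiff y) -> exists z, x = mdiff z.

Definition cohomology_surj (f : M -> N) : Prop :=
  forall y, mdiff y = 0 -> exists x, mdiff x = 0 /\ exists z, y - f x = mdiff z.

Definition quasi_iso (f : dgmor M N) : Prop :=
  cohomology_inj f /\ cohomology_surj f.
End Cohomology.

(* Q is isomorphic to A (x) Y with dY = 0, through a (x) y |-> a . t y. *)
Definition free_on_cocycles (k : fieldType) (A : cdgaType k) (Q : dgmod A) :
    Prop :=
  exists (Y : gradedType k) (t : grmor Y Q),
    (forall y, mdiff (t y) = 0) /\
    is_tensor (fun (a : A) (y : Y) => act a (t y)).

Definition semifree (k : fieldType) (A : cdgaType k) (P : dgmod A) : Prop :=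
  exists F : nat -> dgsub P, filtration F /\
    forall n, free_on_cocycles (quo_dgmod (trace_dgsub (F n.+1) (F n))).

(* The least natural number satisfying Q, None standing for infinity. *)
Definition least (Q : nat -> Prop) : option nat :=
  if pselect (exists n, `[< Q n >]) is left h then Some (ex_minn h) else None.

Section Toomer.
Context {k : fieldType} {V : gradedType k} (L : freeCDGA V).

Definition toomer_semifree (P : dgmod L) : option nat :=
  least (fun m => cohomology_inj
    (quo_pi _ : P -> quo_dgmod (ideal_act (word_ideal L m.+1) P))).

(* Toomer invariant e_L(M). The value does not depend on the semifree
   resolution, so one is chosen. *)
Definition toomer (M : dgmod L) : option nat :=
  xget None [set e | exists (P : dgmod L) (f : dgmor P M),
               [/\ semifree P, quasi_iso f & e = toomer_semifree P]].
End Toomer.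

Definition inf_leq (e : option nat) (n : nat) : bool :=
  if e is Some r then (r <= n)%N else false.

(* Main.v *)
From HB Require Import structures.
From mathcomp Require Import all_boot all_order all_algebra.
From mathcomp Require Import generic_quotient boolp classical_sets zify.
Require Import Defs.
Set Implicit Arguments.
Unset Strict Implicit.
Unset Printing Implicit Defensive.
Import Order.TTheory GRing.Theory Num.Theory.
Local Open Scope ring_scope.

(** Write A = (Lambda W, dbar) for the fibre.  The proof has two halves.

    In the fibre, if e_A(Lambda^{>=q}W) = n, then a cocycle of A of word length
    > n + q is the coboundary of an element of word length >= q
    ([toomer_ideal_exact]).  By definition of e, a cocycle of Lambda^{>n}W . P is
    a coboundary when P is a semifree resolution of Lambda^{>=q}W, and this
    passes from the resolution to any module filtered like a semifree one and
    mapped to Lambda^{>=q}W ([ideal_cocycle_exact]).  So a long cocycle z has to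
    be recognized as the image of a cocycle of Lambda^{>n}W . P for such a
    module P.  It is found in the path algebra C = A (x) Lambda(W + sW), which
    has three letters hat w, lam w, sus w for each w.  The letters lam generate
    a copy of A, onto which C projects, and the letters hat and sus generate a
    contractible factor.  A chain map pathmap : A -> C, sending w to
    lam w + hat w + corrections, makes C a semifree A-module, and its composite
    with the projection is the identity of A.  If z has length > n + q, then
    pathmap z is a sum of products of at least n + 1 + q factors pathmap w; modulo
    coboundaries these can be exchanged, one at a time, for letters lam
    ([trade]).  After q exchanges z has become the projection of a cocycle with
    n + 1 factors pathmap w and q letters lam, that is, of a cocycle of
    Lambda^{>n}W . P, where P, spanned by the products with at least q letters
    lam, projects to Lambda^{>=q}W.  An exchange uses the contraction of the
    letters hat, which divides by the number of letters (characteristic 0), and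
    an automorphism [twist] of C that commutes with the differential up to
    terms with one more letter lam.

    In the total algebra, the first half gives a linear null homotopy of
    Lambda^{>=q+n+1}W -> Lambda^{>=q}W.  Extended over Lambda Z, it changes a
    cocycle of base length >= p by a coboundary into one of base length >= p + 1,
    at a loss of n + 1 in total word length, or of n if the differential
    raises word length ([push_stage]).  After m + 1 such steps the cocycle lies
    in Lambda^{>m}Z . Lambda V, where it is a coboundary because
    e_{Lambda Z}(Lambda V) = m ([base_exact]).  The two bounds are those for which
    the initial word length suffices for all the steps. *)

(** * Linear choice *)

Definition linear_of (k : fieldType) (U V : lmodType k) (f : U -> V) (fL : linear f) :
    {linear U -> V} := HB.pack f (GRing.isLinear.Build k U V _ f fL).

Section LinearChoice.
Context {k : fieldType} {U V : lmodType k}.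

Definition linear_rel (R : U -> V -> Prop) : Prop :=
  R 0 0 /\ forall (a : k) u v u' v', R u v -> R u' v' -> R (a *: u + u') (a *: v + v').

Lemma linear_relD (R : U -> V -> Prop) u v u' v' : linear_rel R -> R u v -> R u' v' -> R (u + u') (v + v').
Proof. by move=> [_ h] h1 h2; have := h 1 _ _ _ _ h1 h2; rewrite !scale1r. Qed.
Lemma linear_relZ (R : U -> V -> Prop) a u v : linear_rel R -> R u v -> R (a *: u) (a *: v).
Proof. by move=> [h0 h] h1; have := h a _ _ _ _ h1 h0; rewrite !addr0. Qed.
Lemma linear_relB (R : U -> V -> Prop) u v u' v' : linear_rel R -> R u v -> R u' v' -> R (u - u') (v - v').
Proof. by move=> lR h1 h2; apply: linear_relD => //; rewrite -!scaleN1r; apply: linear_relZ. Qed.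

(** A maximal linear graph compatible with R is total, by Zorn's lemma.  Homotopies,
    sections and projections below are all obtained in this way, without bases. *)
Lemma linear_choice (R : U -> V -> Prop) : linear_rel R ->
  exists f : {linear U -> V}, forall u v, R u v -> R u (f u).
Proof.
move=> lR.
pose good (G : set (U * V)) :=
  (forall a u v u' v', G (u, v) -> G (u', v') -> G (a *: u + u', a *: v + v')) /\
  (forall v, G (0, v) -> v = 0) /\
  (forall u v, G (u, v) -> (exists v', R u v') -> R u v).
have [|G [[GL [G0 GR]] Gmax]] := @Zorn_bigcup _ good.
  move=> F Fgood Ftot.
  have two x y : (\bigcup_(X in F) X)%classic x -> (\bigcup_(X in F) X)%classic y ->
      exists2 X, F X & X x /\ X y.
    move=> [X FX Xx] [X' FX' Xy]; have [h|h] := Ftot X X' FX FX'.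
      by exists X' => //; split=> //; apply: h.
    by exists X => //; split=> //; apply: h.
  split; last split.
  - move=> a u v u' v' h1 h2; have [X FX [X1 X2]] := two _ _ h1 h2.
    by exists X => //; apply: (Fgood X FX).1.
  - by move=> v [X FX Xv]; apply: (Fgood X FX).2.1.
  - by move=> u v [X FX Xv]; apply: (Fgood X FX).2.2.
have GG : exists x, G x.
  apply: contrapT => hG.
  apply: (Gmax [set (0, 0)]%classic).
    split=> [x Gx|h]; first by case: hG; exists x.
    by apply: hG; exists (0, 0); apply: h.
  split; [|split].
  - by move=> a u v u' v' [-> ->] [-> ->]; rewrite !scaler0 !addr0.
  - by move=> v [].
  - by move=> u v [-> ->] _; apply: lR.1.
have G00 : G (0, 0).
  case: GG => -[u v] Guv; have := GL (-1) _ _ _ _ Guv Guv.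
  by rewrite !scaleN1r !addNr.
have GZ a u v : G (u, v) -> G (a *: u, a *: v).
  by move=> h; have := GL a _ _ _ _ h G00; rewrite !addr0.
have GD u v u' v' : G (u, v) -> G (u', v') -> G (u + u', v + v').
  by move=> h h'; have := GL 1 _ _ _ _ h h'; rewrite !scale1r.
have GB u v u' v' : G (u, v) -> G (u', v') -> G (u - u', v - v').
  by move=> h h'; rewrite -!scaleN1r; apply: GD => //; apply: GZ.
have tot u : exists v, G (u, v).
  apply: contrapT => nu.
  (* the value at u is forced by any pair (g + u, v) of R with g in the domain of G;
    if there is none, 0 will do *)
  have [v0 Hv0] : exists v0, forall g vg a, G (g, vg) -> (exists v', R (g + a *: u) v') ->
    R (g + a *: u) (vg + a *: v0).
    have [[g [vg [v [Gg Rv]]]]|no] := pselect (exists g vg v, G (g, vg) /\ R (g + u) v).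
      exists (v - vg) => g' vg' a Gg' [v' Rv'].
      have Rd : R (g' - a *: g) (vg' - a *: vg).
        apply: GR; first by apply: GB => //; apply: GZ.
        exists (v' - a *: v).
        have := linear_relB lR Rv' (linear_relZ a lR Rv).
        by rewrite scalerDr opprD addrACA subrr addr0.
      have := linear_relD lR Rd (linear_relZ a lR Rv).
      rewrite !(scalerDr, scalerN).
      by rewrite addrA subrK -[_ - _ + _]addrA [- _ + _]addrC.
    exists 0 => g vg a Gg [v' Rv']; rewrite scaler0 addr0.
    have [a0|a0] := eqVneq a 0.
      by rewrite a0 scale0r addr0 in Rv' *; apply: GR => //; exists v'.
    case: no; exists (a^-1 *: g), (a^-1 *: vg), (a^-1 *: v'); split; first exact: GZ.
    by have := linear_relZ a^-1 lR Rv'; rewrite scalerDr scalerA mulVf // scale1r.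
  pose G' := [set x : U * V | exists g vg a, G (g, vg) /\ x = (g + a *: u, vg + a *: v0)]%classic.
  apply: (Gmax G').
    split=> [[x y] Gx|h]; first by exists x, y, 0; rewrite !scale0r !addr0.
    by apply: nu; exists v0; apply: h; exists 0, 0, 1; rewrite !scale1r !add0r.
  split; [|split].
  - move=> a x y x' y' [g [vg [b [Gg [-> ->]]]]] [g' [vg' [b' [Gg' [-> ->]]]]].
    exists (a *: g + g'), (a *: vg + vg'), (a * b + b'); split; first exact: GL.
    by rewrite !scalerDr !scalerDl !scalerA !addrA; congr (_, _); rewrite -!addrA; congr (_ + _);
      rewrite addrCA.
  - move=> v [g [vg [a [Gg [e ->]]]]].
    have [a0|a0] := eqVneq a 0.
      by move: e; rewrite a0 !scale0r !addr0 => e; apply: G0; rewrite e.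
    case: nu; exists (- a^-1 *: vg).
    have -> : u = - a^-1 *: g.
      have /eqP : g + a *: u = 0 by [].
      rewrite addr_eq0 => /eqP ->.
      by rewrite scalerN scaleNr opprK scalerA mulVf // scale1r.
    exact: GZ.
  - move=> x y [g [vg [a [Gg [-> ->]]]]]; exact: Hv0.
have [f fG] := choice tot.
have Gu u v v' : G (u, v) -> G (u, v') -> v = v'.
  by move=> h h'; apply/eqP; rewrite -subr_eq0; apply/eqP/G0; have := GB _ _ _ _ h h'; rewrite subrr.
have fL : linear f.
  by move=> a x y; apply: (Gu (a *: x + y)) => //; apply: GL.
by exists (linear_of fL) => u v Ruv; apply: GR => //; exists v.
Qed.
End LinearChoice.

(** * Homogeneous components and signs *)

Section Sign.
Context {k : fieldType}.
Definition sg (i : int) : k := (-1) ^ i.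
Lemma sgD i j : sg (i + j) = sg i * sg j.
Proof. by rewrite /sg expfzDr // oppr_eq0 oner_eq0. Qed.
Lemma sg0 : sg 0 = 1. Proof. by []. Qed.
Lemma sg1 : sg 1 = -1. Proof. by []. Qed.
Lemma sgN i : sg (- i) = sg i.
Proof. by rewrite /sg -exprz_inv invrN invr1. Qed.
Lemma sgK i : sg i * sg i = 1.
Proof. by rewrite -{2}sgN -sgD subrr. Qed.
End Sign.

Section LinExt.
Context {k : fieldType} {V : gradedType k}.

Lemma homog_ind (P : V -> Prop) : P 0 -> (forall a x y, P x -> P y -> P (a *: x + y)) ->
  (forall i x, x \in homog i -> P x) -> forall x, P x.
Proof.
move=> P0 PL Ph x; have [s _ ->] := pr_sum x.
elim: s => [|i s IH]; first by rewrite big_nil.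
by rewrite big_cons -[pr i x]scale1r; apply: PL => //; apply: Ph (homog_pr i x).
Qed.

Lemma linear_homog_eq (U : lmodType k) (f g : {linear V -> U}) :
  (forall i x, x \in homog i -> f x = g x) -> f =1 g.
Proof.
move=> h; apply: homog_ind; first by rewrite !linear0.
  by move=> a x y fx fy; rewrite !linearP fx fy.
exact: h.
Qed.

Lemma cover_sum (X : lmodType k) (phi : int -> {linear V -> X}) (x : V) (s t : seq int) :
  uniq s -> uniq t -> (forall i, i \notin s -> pr i x = 0) -> (forall i, i \notin t -> pr i x = 0) ->
  \sum_(i <- s) phi i (pr i x) = \sum_(i <- t) phi i (pr i x).
Proof.
move=> us ut sx tx.
rewrite (bigID (mem t)) /= [X in _ + X]big1 ?addr0; last by move=> i /tx ->; rewrite linear0.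
rewrite [RHS](bigID (mem s)) /= [X in _ = _ + X]big1 ?addr0; last by move=> i /sx ->; rewrite linear0.
rewrite -big_filter -[RHS]big_filter.
apply/perm_big/uniq_perm; rewrite ?filter_uniq //.
by move=> i; rewrite !mem_filter andbC.
Qed.

Definition supp (x : V) : seq int := s2val (cid2 (pr_sum x)).
Lemma supp_uniq x : uniq (supp x).
Proof. exact: s2valP (cid2 (pr_sum x)). Qed.
Lemma supp_sum x : x = \sum_(i <- supp x) pr i x.
Proof. exact: s2valP' (cid2 (pr_sum x)). Qed.
Lemma supp_notin x i : i \notin supp x -> pr i x = 0.
Proof. exact: pr_notin (supp_sum x). Qed.

Definition hsum (X : lmodType k) (phi : int -> {linear V -> X}) (x : V) : X :=
  \sum_(i <- supp x) phi i (pr i x).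

Lemma hsumE (X : lmodType k) (phi : int -> {linear V -> X}) (x : V) (t : seq int) :
  uniq t -> (forall i, i \notin t -> pr i x = 0) ->
  hsum phi x = \sum_(i <- t) phi i (pr i x).
Proof. by move=> ut tx; apply: cover_sum; rewrite ?supp_uniq //; apply: supp_notin. Qed.

Fact hsum_linear (X : lmodType k) (phi : int -> {linear V -> X}) : linear (hsum phi).
Proof.
move=> a x y; have um := undup_uniq (supp x ++ supp y).
have hx i : i \notin undup (supp x ++ supp y) -> pr i x = 0.
  by rewrite mem_undup mem_cat negb_or => /andP[/supp_notin].
have hy i : i \notin undup (supp x ++ supp y) -> pr i y = 0.
  by rewrite mem_undup mem_cat negb_or => /andP[_ /supp_notin].
rewrite !(hsumE phi (t := undup (supp x ++ supp y))) //; last first.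
  by move=> i hi; rewrite linearP /= hx ?hy // scaler0 addr0.
by rewrite scaler_sumr -big_split /=; apply: eq_bigr => i _; rewrite !linearP.
Qed.
HB.instance Definition _ (X : lmodType k) (phi : int -> {linear V -> X}) :=
  GRing.isLinear.Build k V X _ (hsum phi) (hsum_linear phi).

Lemma hsum_homog (X : lmodType k) (phi : int -> {linear V -> X}) i x :
  x \in homog i -> hsum phi x = phi i x.
Proof.
move=> xi; rewrite (hsumE phi (t := [:: i])) //; first by rewrite big_seq1 (pr_homog _ xi) eqxx.
by move=> j; rewrite inE (pr_homog _ xi) => /negbTE ->.
Qed.

(** The operator (-1)^|x|: with it the Leibniz rules need no homogeneity hypothesis. *)
Definition sgn : {linear V -> V} := hsum (fun i => sg i \*: idfun).

Lemma sgn_homog i (x : V) : x \in homog i -> sgn x = sg i *: x.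
Proof. by move=> xi; rewrite /sgn /= (hsum_homog _ xi). Qed.

Lemma sgnK x : sgn (sgn x) = x.
Proof.
apply: (linear_homog_eq (f := sgn \o sgn) (g := idfun)) => i y yi /=.
by rewrite (sgn_homog yi) linearZ /= (sgn_homog yi) scalerA sgK scale1r.
Qed.

Lemma sgn_pr i x : pr i (sgn x) = sg i *: pr i x.
Proof.
apply: (linear_homog_eq (f := pr i \o sgn) (g := sg i \*: pr i)) => j y yj /=.
rewrite (sgn_homog yj) linearZ /= (pr_homog _ yj).
by case: eqP => [->|_]; rewrite ?scaler0.
Qed.

Lemma homog_sgn i x : (sgn x \in homog i) = (x \in homog i).
Proof.
suff h y : y \in homog i -> sgn y \in homog i.
  by apply/idP/idP => [/h|/h //]; rewrite sgnK.
by move=> yi; apply/homogP; rewrite sgn_pr (sgn_homog yi); move/homogP: yi => ->.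
Qed.

Lemma homog_submod i : submod_closed (homog i : {pred V}).
Proof.
split; first by apply/homogP; rewrite linear0.
by move=> a x y /homogP xi /homogP yi; apply/homogP; rewrite linearP xi yi.
Qed.
Lemma homog0 i : (0 : V) \in homog i. Proof. by case: (homog_submod i). Qed.
Lemma homogL i a (x y : V) : x \in homog i -> y \in homog i -> a *: x + y \in homog i.
Proof. by case: (homog_submod i) => _; apply. Qed.
Lemma homogD i (x y : V) : x \in homog i -> y \in homog i -> x + y \in homog i.
Proof. by move=> h1 h2; have := homogL 1 h1 h2; rewrite scale1r. Qed.
Lemma homogZ i a (x : V) : x \in homog i -> a *: x \in homog i.
Proof. by move=> h; have := homogL a h (homog0 i); rewrite addr0. Qed.
Lemma homogN i (x : V) : x \in homog i -> - x \in homog i.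
Proof. by rewrite -scaleN1r; apply: homogZ. Qed.
Lemma homogB i (x y : V) : x \in homog i -> y \in homog i -> x - y \in homog i.
Proof. by move=> h1 h2; apply/homogD/homogN. Qed.

Lemma grsub_sgn (S : grsub V) x :
  x \in (S : submodClosed V) -> sgn x \in (S : submodClosed V).
Proof.
move=> xS; have [s us e] := pr_sum x.
rewrite {1}e linear_sum; apply: rpred_sum => i _.
by rewrite (sgn_homog (homog_pr i x)) rpredZ // grsub_pr.
Qed.

Lemma pr_nneg_homog (i : int) (x : V) : (forall j y, j < 0 -> pr j (y : V) = 0) ->
  i < 0 -> x \in homog i -> x = 0.
Proof. by move=> h i0 /homogP <-; apply: h. Qed.
End LinExt.

Lemma sgn_mor (k : fieldType) (V W : gradedType k) (f : {linear V -> W}) :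
  (forall i x, x \in homog i -> f x \in homog i) -> forall x, f (sgn x) = sgn (f x).
Proof.
move=> fh; apply: (linear_homog_eq (f := f \o sgn) (g := sgn \o f)) => i y yi /=.
by rewrite (sgn_homog yi) linearZ /= (sgn_homog (fh _ _ yi)).
Qed.

Lemma sgn_odd (k : fieldType) (V W : gradedType k) (f : {linear V -> W}) (e : int) :
  sg e = -1 :> k ->
  (forall i x, x \in homog i -> f x \in homog (i + e)) -> forall x, f (sgn x) = - sgn (f x).
Proof.
move=> e1 fh; apply: (linear_homog_eq (f := f \o sgn) (g := \- (sgn \o f))) => i y yi /=.
by rewrite (sgn_homog yi) linearZ /= (sgn_homog (fh _ _ yi)) sgD e1 mulrN1 scaleNr opprK.
Qed.

Section SignAlg.
Context {k : fieldType} {A : gcaType k}.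

Lemma sgn1 : sgn (1 : A) = 1.
Proof. by rewrite (sgn_homog (homog1 (s := A))) sg0 scale1r. Qed.

Lemma sgnM (x y : A) : sgn (x * y) = sgn x * sgn y.
Proof.
move: x; apply: homog_ind; first by rewrite mul0r !linear0 mul0r.
  by move=> a x x' hx hx'; rewrite mulrDl -scalerAl !linearP hx hx' mulrDl -scalerAl.
move=> i x xi; move: y; apply: homog_ind; first by rewrite mulr0 !linear0 mulr0.
  by move=> a y y' hy hy'; rewrite mulrDr -scalerAr !linearP hy hy' mulrDr -scalerAr.
move=> j y yj; rewrite (sgn_homog (homogM _ _ _ _ xi yj)) (sgn_homog xi) (sgn_homog yj).
by rewrite -scalerAl -scalerAr scalerA sgD.
Qed.

Lemma gca_comm (i j : int) (x y : A) : x \in homog i -> y \in homog j ->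
  x * y = sg (i * j) *: (y * x).
Proof. exact: homogC. Qed.
End SignAlg.

Section SignCDGA.
Context {k : fieldType} {A : cdgaType k}.

Lemma diff_sgn (x : A) : diff (sgn x) = - sgn (diff x).
Proof. by apply: (sgn_odd (e := 1) sg1) => i y; apply: homog_diff. Qed.

Lemma diffMs (x y : A) : diff (x * y) = diff x * y + sgn x * diff y.
Proof.
move: x; apply: homog_ind; first by rewrite mul0r !linear0 !mul0r addr0.
  move=> a x x' hx hx'; rewrite mulrDl -scalerAl !linearP hx hx' !mulrDl -!scalerAl.
  by rewrite scalerDr addrACA.
by move=> i x xi; rewrite (diffM _ _ _ xi) (sgn_homog xi) scalerAl.
Qed.

Lemma diff1 : diff (1 : A) = 0.
Proof.
have := diffMs 1 1; rewrite sgn1 !mul1r mulr1 => /eqP.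
by rewrite -subr_eq subrr eq_sym => /eqP.
Qed.

Lemma actLl (M : dgmod A) c (a b : A) (x : M) : act (c *: a + b) x = c *: act a x + act b x.
Proof. exact: (act_linearl x c a b). Qed.
Lemma act0l (M : dgmod A) (x : M) : act (0 : A) x = 0.
Proof. exact: (linear0 (actl x)). Qed.
Lemma actZl (M : dgmod A) c (a : A) (x : M) : act (c *: a) x = c *: act a x.
Proof. exact: (linearZ_LR (actl x)). Qed.

Lemma mdiff_acts (M : dgmod A) (a : A) (x : M) :
  mdiff (act a x) = act (diff a) x + act (sgn a) (mdiff x).
Proof.
move: a; apply: homog_ind.
- by rewrite !linear0 !act0l linear0 addr0.
- move=> c a b ha hb.
  by rewrite !linearP /= !actLl linearP ha hb /= scalerDr addrACA.
- by move=> i a ai; rewrite (mdiff_act _ ai) (sgn_homog ai) actZl.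
Qed.
End SignCDGA.

(** * Cocycles of a filtered tensor product *)

Section TensorExt.
Context {k : fieldType} {U V T : lmodType k} {b : U -> V -> T} (bt : is_tensor b).

Definition tensor_lift (X : lmodType k) (c : U -> V -> X) (bc : bilinear_map c) :
  {linear T -> X} := sval (cid (bt.2 X c bc)).
Lemma tensor_liftE (X : lmodType k) (c : U -> V -> X) (bc : bilinear_map c) u v :
  tensor_lift bc (b u v) = c u v.
Proof. by rewrite /tensor_lift; case: (cid _) => g [gE _] /=. Qed.
Lemma tensor_eq (X : lmodType k) (g g' : {linear T -> X}) :
  (forall u v, g (b u v) = g' (b u v)) -> g =1 g'.
Proof.
move=> gg'; have bc : bilinear_map (fun u v => g (b u v)).
  case: bt.1 => bl br; split=> [u a x y|v a x y]; first by rewrite bl linearP.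
  by rewrite br linearP.
have [h [_ hU]] := bt.2 X _ bc => x.
by rewrite (hU g) // (hU g') // => u v; rewrite gg'.
Qed.
End TensorExt.

Section Lift.
Context {k : fieldType} {A : cdgaType k} {P M : dgmod A} {f : dgmor P M}.
Hypothesis fq : quasi_iso f.
Context {T Y : lmodType k} {al : A -> T -> T} {D : {linear T -> T}} {t : {linear Y -> T}}.
Hypothesis alR : forall a, linear (al a).
Hypothesis alM : forall a b x, al (a * b) x = al a (al b x).
Hypothesis Dal : forall a x, D (al a x) = al (diff a) x + al (sgn a) (D x).
Hypothesis DD : forall x, D (D x) = 0.
Hypothesis tens : is_tensor (fun a y => al a (t y)).
Context {F : nat -> submodClosed Y}.
Hypothesis FS : forall n, {subset F n <= F n.+1}.
Hypothesis F0 : forall y, y \in F 0%N -> y = 0.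
Definition action_span (E : submodClosed Y) : submodClosed T :=
  span [set x | exists a y, y \in E /\ x = al a (t y)]%classic.
Hypothesis FD : forall n y, y \in F n.+1 -> D (t y) \in action_span (F n).
Context {eps : {linear T -> M}}.
Hypothesis eps_act : forall a y, eps (al a (t y)) = act a (eps (t y)).
Hypothesis epsD : forall n y, y \in F n -> mdiff (eps (t y)) = eps (D (t y)).

Let kP_ex : exists kP : {linear P -> P}, forall x y, x = mdiff y -> mdiff (kP x) = x.
Proof.
have [|g gE] := @linear_choice k P P (fun x y => x = mdiff y).
  by split=> [|a u v u' v' -> ->]; rewrite ?linear0 ?linearP.
by exists g => x y /gE.
Qed.

Let rk_ex : exists (r : {linear M -> P}) (kM : {linear M -> M}),
  forall m, mdiff m = 0 -> mdiff (r m) = 0 /\ m - f (r m) = mdiff (kM m).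
Proof.
have [|g gE] := @linear_choice k M (P * M)%type
    (fun m q => mdiff q.1 = 0 /\ m - f q.1 = mdiff q.2).
  split=> [|a u v u' v' [h1 h2] [h3 h4]] /=; first (split; first exact: linear0).
    by change (0 - f 0 = mdiff 0 :> M); rewrite !linear0 addr0.
  by rewrite !linearP /= h1 h3 scaler0 addr0 -h2 -h4 addrACA -scalerDr.
have l1 : linear (fun m => (g m).1) by move=> a x y; rewrite linearP.
have l2 : linear (fun m => (g m).2) by move=> a x y; rewrite linearP.
exists (linear_of l1), (linear_of l2) => m m0.
have [p [p0 [z e]]] := fq.2 m m0.
by have [] := gE m (p, z) (conj p0 e).
Qed.

Let bil (X : dgmod A) (g : {linear Y -> X}) : bilinear_map (fun a y => act a (g y)).
Proof.
by split=> [a c x y|y c a b]; [rewrite !linearP|rewrite actLl].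
Qed.
Let bils (X : dgmod A) (g : {linear Y -> X}) : bilinear_map (fun a y => act (sgn a) (g y)).
Proof.
by split=> [a c x y|y c a b]; [rewrite !linearP|rewrite linearP actLl].
Qed.
Let ext (X : dgmod A) (g : {linear Y -> X}) : {linear T -> X} := tensor_lift tens (bil g).
Let exts (X : dgmod A) (g : {linear Y -> X}) : {linear T -> X} := tensor_lift tens (bils g).
Let extE (X : dgmod A) (g : {linear Y -> X}) a y : ext g (al a (t y)) = act a (g y).
Proof. exact: (tensor_liftE tens (bil g)). Qed.
Let extsE (X : dgmod A) (g : {linear Y -> X}) a y : exts g (al a (t y)) = act (sgn a) (g y).
Proof. exact: (tensor_liftE tens (bils g)). Qed.

Let ext_al (X : dgmod A) (g : {linear Y -> X}) E a x : x \in action_span E ->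
  ext g (al a x) = act a (ext g x).
Proof.
move: x; apply: span_ind.
- by rewrite -[al a]/(linear_of (alR a) : T -> T) !linear0.
- by move=> c x y hx hy; rewrite alR !linearP hx hy.
- by move=> _ [b [y [yE ->]]]; rewrite -alM !extE actM.
Qed.

Let exts_al (X : dgmod A) (g : {linear Y -> X}) E a x : x \in action_span E ->
  exts g (al a x) = act (sgn a) (exts g x).
Proof.
move: x; apply: span_ind.
- by rewrite -[al a]/(linear_of (alR a) : T -> T) !linear0.
- by move=> c x y hx hy; rewrite alR !linearP hx hy.
- by move=> _ [b [y [yE ->]]]; rewrite -alM !extsE sgnM actM.
Qed.

Let eqs_span (g : {linear Y -> P}) (h : {linear Y -> M}) (E : submodClosed Y) :
  (forall y, y \in E ->
      [/\ mdiff (g y) = ext g (D (t y)),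
       f (g y) - eps (t y) = mdiff (h y) + exts h (D (t y)) &
       D (t y) \in action_span E]) ->
    forall x, x \in action_span E ->
    mdiff (ext g x) = ext g (D x) /\
    f (ext g x) - eps x = mdiff (exts h x) + exts h (D x).
Proof.
move=> hy; apply: span_ind.
- by rewrite !linear0 !addr0.
- move=> a x y [h1 h2] [h3 h4]; split; first by rewrite !linearP h1 h3.
  by rewrite !linearP /= addrACA -scalerDr h2 h4 scalerDr addrACA.
- move=> _ [a [y [yi ->]]]; have [h1 h2 h3] := hy y yi.
  rewrite Dal !linearD /= (ext_al _ _ h3) (exts_al _ _ h3) !extE !extsE sgnK.
  split; first by rewrite mdiff_acts h1.
  rewrite dgmor_act eps_act -linearB h2 mdiff_acts diff_sgn sgnK linearD.
  rewrite -[- sgn _]scaleN1r actZl scaleN1r addrACA.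
  by rewrite addNr add0r.
Qed.

(** The comparison of a semifree module with a resolution: the lift and the homotopy
    are built along the filtration, the lift being corrected at each stage by a
    preimage under f.  The corrections are given by linear maps, so Y needs
    neither a basis nor a grading. *)
Lemma lift_homotopy n : exists (G : {linear T -> P}) (H : {linear T -> M}) (g : Y -> P),
  (forall a y, G (al a (t y)) = act a (g y)) /\
  forall x, x \in action_span (F n) ->
    mdiff (G x) = G (D x) /\ f (G x) - eps x = mdiff (H x) + H (D x).
Proof.
have [kP kPE] := kP_ex; have [r [kM rkE]] := rk_ex.
(* mid y is the cocycle of M that obstructs the lift kP (ext g (D (t y)));
  r and kM move it into the image of f up to a boundary *)
pose mid (x : {linear Y -> P} * {linear Y -> M}) : {linear Y -> M} :=
  ((f \o kP \o ext x.1 \o D \o t) \- (eps \o t)) \- (exts x.2 \o D \o t).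
pose step (x : {linear Y -> P} * {linear Y -> M}) : {linear Y -> P} * {linear Y -> M} :=
  ((((kP \o ext x.1 \o D \o t) \- (r \o mid x)) : {linear Y -> P}), ((kM \o mid x) : {linear Y -> M})).
pose X i := iter i step ((\0 : {linear Y -> P}), (\0 : {linear Y -> M})).
have ext_agree (Q : dgmod A) (g g' : {linear Y -> Q}) (E : submodClosed Y) :
    (forall y, y \in E -> g y = g' y) ->
    forall x, x \in action_span E -> ext g x = ext g' x /\ exts g x = exts g' x.
  move=> gg; apply: span_ind; first by rewrite !linear0.
    by move=> a x y [hx1 hx2] [hy1 hy2]; rewrite !linearP hx1 hy1 hx2 hy2.
  by move=> _ [a [y [yE ->]]]; rewrite !extE !extsE gg.
have Xstable i y : y \in F i -> (X i.+1).1 y = (X i).1 y /\ (X i.+1).2 y = (X i).2 y.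
  elim: i y => [|i IH] y yi; first by rewrite (F0 yi) !linear0.
  have [e1 _] := ext_agree _ _ _ _ (fun y yi => (IH y yi).1) _ (FD yi).
  have [_ e2] := ext_agree _ _ _ _ (fun y yi => (IH y yi).2) _ (FD yi).
  have em : mid (X i.+1) y = mid (X i) y by rewrite /mid /= e1 e2.
  split; last by rewrite -[LHS]/(kM (mid (X i.+1) y)) em.
  rewrite -[LHS]/(kP (ext (X i.+1).1 (D (t y))) - r (mid (X i.+1) y)) em e1.
  by [].
have key i : forall y, y \in F i ->
      [/\ mdiff ((X i).1 y) = ext (X i).1 (D (t y)),
       f ((X i).1 y) - eps (t y) = mdiff ((X i).2 y) + exts (X i).2 (D (t y)) &
       D (t y) \in action_span (F i)].
  elim: i => [|i IH] y yi.
    by rewrite (F0 yi) !linear0 !addr0; split=> //; exact: rpred0.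
  have Dy := FD yi.
  have [e1 e2] : ext (X i.+1).1 (D (t y)) = ext (X i).1 (D (t y)) /\
      exts (X i.+1).2 (D (t y)) = exts (X i).2 (D (t y)).
    split; first exact: (ext_agree _ _ _ _ (fun y yi => (Xstable i y yi).1) _ Dy).1.
    exact: (ext_agree _ _ _ _ (fun y yi => (Xstable i y yi).2) _ Dy).2.
  have [k1 k2] := eqs_span IH Dy.
  rewrite DD !linear0 ?addr0 in k1 k2.
  have Ge : ext (X i).1 (D (t y)) = mdiff (kP (ext (X i).1 (D (t y)))).
    have [z zE] : exists z, ext (X i).1 (D (t y)) = mdiff z.
      apply: fq.1 => //; exists (eps (t y) + exts (X i).2 (D (t y))).
      by rewrite linearD /= -k2 (epsD yi) addrC subrK.
    by rewrite (kPE _ _ zE).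
  have m0 : mdiff (mid (X i) y) = 0.
    rewrite -[mid _ _]/(f (kP (ext (X i).1 (D (t y)))) - eps (t y) - exts (X i).2 (D (t y))).
    by rewrite !linearB /= -dgmor_diff -Ge (epsD yi) k2 subrr.
  have [r1 r2] := rkE _ m0.
  rewrite e1 e2 -[(X i.+1).1 y]/(kP (ext (X i).1 (D (t y))) - r (mid (X i) y)).
  rewrite -[(X i.+1).2 y]/(kM (mid (X i) y)) linearB /= -Ge r1 subr0.
  split=> //.
    rewrite linearB /= -r2; move: (f (r (mid (X i) y))) => w.
    rewrite -[mid _ _]/(f (kP (ext (X i).1 (D (t y)))) - eps (t y) - exts (X i).2 (D (t y))).
    by rewrite [RHS]addrAC subrK addrAC.
  move: Dy; apply: span_min => _ [a [z [zi ->]]]; apply: sub_span.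
  by exists a, z; split=> //; apply: FS.
exists (ext (X n).1), (exts (X n).2), (X n).1; split=> [a y|x xn]; first exact: extE.
by have := eqs_span (key n) xn.
Qed.

(** The lift carries the cocycle into I . P, where it becomes a coboundary, and the
    homotopy brings the conclusion back to M.  In this way a value of the Toomer
    invariant, computed on some resolution P, acts on a module T that is easier
    to handle. *)
Lemma ideal_cocycle_exact (I : dgsub (regular A)) n (c : T) :
  cohomology_inj (quo_pi _ : P -> quo_dgmod (ideal_act I P)) ->
  c \in span [set x | exists a y, [/\ a \in (I :
    submodClosed (regular A)), y \in F n & x = al a (t y)]]%classic ->
  D c = 0 -> exists m, eps c = mdiff m.
Proof.
move=> inj cI Dc; have [G [H [g [GE GH]]]] := lift_homotopy n.
have cF : c \in action_span (F n).
  move: cI; apply: span_min => _ [a [y [_ yn ->]]]; apply: sub_span; by exists a, y.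
have [G1 G2] := GH c cF; rewrite Dc !linear0 ?addr0 in G1 G2.
have [z zE] : exists z, G c = mdiff z.
  apply: inj => //; exists 0; rewrite [RHS]linear0; apply: (proj2 (@quo_pi0 _ _ (ideal_act I P) _)).
  move: (c) cI; apply: span_ind; first by rewrite linear0 rpred0.
    by move=> a x y hx hy; rewrite linearP rpredD ?rpredZ.
  by move=> _ [a [y [aI _ ->]]]; rewrite GE; apply: sub_span; exists a, (g y).
exists (f z - H c); rewrite linearB /= -G2 -dgmor_diff -zE opprB addrCA subrr.
by rewrite addr0.
Qed.
End Lift.

(** * Introducing and bounding the Toomer invariant *)

(** The field as a graded algebra concentrated in degree 0, the target of augmentations. *)
Definition ground (k : fieldType) : Type := k^o.
Section Ground.
Context {k : fieldType}.
HB.instance Definition _ := GRing.ComAlgebra.on (ground k).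

Definition ground_pr (i : int) (x : ground k) : ground k := if i == 0 then x else 0.
Fact ground_pr_linear i : linear (ground_pr i).
Proof. by move=> a x y; rewrite /ground_pr; case: eqP; rewrite // scaler0 addr0. Qed.
HB.instance Definition _ i :=
  GRing.isLinear.Build k (ground k) (ground k) _ (ground_pr i) (ground_pr_linear i).
Fact ground_pr_pr i j x : ground_pr i (ground_pr j x) = if i == j then ground_pr j x else 0.
Proof.
rewrite /ground_pr; case: (eqVneq i j) => [->|ij]; first by case: eqP.
by case: (eqVneq i 0) => // i0; case: eqP => // j0; rewrite i0 j0 eqxx in ij.
Qed.
Fact ground_pr_sum x : exists2 s : seq int, uniq s & x = \sum_(i <- s) ground_pr i x.
Proof. by exists [:: 0] => //; rewrite big_seq1. Qed.
HB.instance Definition _ := isGraded.Build k (ground k) ground_pr_pr ground_pr_sum.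

Lemma ground_homog0 (x : ground k) : x \in homog 0.
Proof. by apply/homogP; rewrite /pr /= /ground_pr eqxx. Qed.
Lemma ground_homog i (x : ground k) : x \in homog i -> i != 0 -> x = 0.
Proof. by move=> /homogP <- /negbTE i0; rewrite /pr /= /ground_pr i0. Qed.

Fact ground_lt0 (i : int) (x : ground k) : i < 0 -> pr i x = 0.
Proof. by move=> i0; rewrite /pr /= /ground_pr lt_eqF. Qed.
Fact ground_M (i j : int) (x y : ground k) :
  x \in homog i -> y \in homog j -> x * y \in homog (i + j).
Proof.
move=> xi yj; have [i0|i0] := eqVneq i 0; last by rewrite (ground_homog xi i0) mul0r homog0.
have [j0|j0] := eqVneq j 0; last by rewrite (ground_homog yj j0) mulr0 homog0.
by rewrite i0 j0 ground_homog0.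
Qed.
Fact ground_C (i j : int) (x y : ground k) :
  x \in homog i -> y \in homog j -> x * y = ((-1) ^ (i * j) : k) *: (y * x).
Proof.
move=> xi yj; have [i0|i0] := eqVneq i 0.
  by rewrite i0 mul0r expr0z scale1r mulrC.
by rewrite (ground_homog xi i0) mul0r mulr0 scaler0.
Qed.
HB.instance Definition _ := isGCA.Build k (ground k) ground_lt0 (ground_homog0 1) ground_M ground_C.
End Ground.

Section ZeroPred.
Context {k : fieldType} (V : lmodType k).
Definition zero_pred : {pred V} := fun x => x == 0.
Fact zero_closed : submod_closed zero_pred.
Proof.
split=> [|a x y]; rewrite !unfold_in // => /eqP -> /eqP ->.
by rewrite scaler0 addr0.
Qed.
HB.instance Definition _ := GRing.isSubmodClosed.Build k V zero_pred zero_closed.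
End ZeroPred.

Definition zero_grsub (k : fieldType) (V : gradedType k) : grsub V.
Proof.
refine (@GrSub k V (@zero_pred k V : submodClosed V) _).
by move=> i x; rewrite !unfold_in => /eqP ->; rewrite linear0.
Defined.
Lemma zero_grsubP (k : fieldType) (V : gradedType k) (x : V) :
  x \in (zero_grsub V : submodClosed V) -> x = 0.
Proof. by rewrite unfold_in => /eqP. Qed.

Section ToomerIntro.
Context {k : fieldType} {V : gradedType k} {L : freeCDGA V}.

Lemma toomer_someE (M : dgmod L) n : toomer M = Some n ->
  exists (P : dgmod L) (f : dgmor P M), quasi_iso f /\
    cohomology_inj (quo_pi _ : P -> quo_dgmod (ideal_act (word_ideal L n.+1) P)).
Proof.
rewrite /toomer; case: xgetP => [e -> [P [f [_ fq ->]]]|//].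
rewrite /toomer_semifree /least; case: pselect => // h [<-].
by exists P, f; split=> //; case: ex_minnP => m /asboolP.
Qed.

Fact zero_act (M : dgmod L) (a : L) (x : M) : x \in @zero_pred k M -> act a x \in @zero_pred k M.
Proof. by rewrite !unfold_in => /eqP ->; rewrite linear0. Qed.
Fact zero_diff (M : dgmod L) (x : M) : x \in @zero_pred k M -> mdiff x \in @zero_pred k M.
Proof. by rewrite !unfold_in => /eqP ->; rewrite linear0. Qed.
Definition zero_dgsub (M : dgmod L) : dgsub M :=
  @DGSub k L M (zero_grsub M) (@zero_act M) (@zero_diff M).

Definition full_dgsub (M : dgmod L) : dgsub M :=
  @DGSub k L M (full M) (fun _ _ _ => isT) (fun _ _ => isT).

Definition grsub_val (M : gradedType k) (S : grsub M) : {linear sub_carrier S -> M}.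
Proof.
refine (linear_of (f := fun x : sub_carrier S => \val x) _).
by move=> a x y.
Defined.

Lemma free_on_zero (Q : dgmod L) : (forall x : Q, x = 0) -> free_on_cocycles Q.
Proof.
move=> Q0.
have th i (x : sub_carrier (zero_dgsub Q)) : x \in homog i -> grsub_val (zero_dgsub Q) x \in homog i.
  by rewrite homog_val.
exists (sub_carrier (zero_dgsub Q)), (GrMor th); split=> [y|]; first by rewrite [LHS]Q0.
split; first by split=> u a x y; exact: (eq_trans (Q0 _) (esym (Q0 _))).
move=> X c [c1 c2]; exists \0; split=> [u v|g' _ x].
  have -> : v = 0 by apply: val_inj; apply: Q0.
  exact: esym (linear0 (linear_of (c1 u))).
by rewrite (Q0 x) (linear0 g') .
Qed.

Lemma regular_semifree : semifree (regular L).
Proof.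
pose F n := if n is 0 then zero_dgsub (regular L) else full_dgsub (regular L).
exists F; split.
  split=> [v /eqP //|[|n] v //|v]; by exists 1%N.
case=> [|n]; last first.
  apply: free_on_zero => u; have [x ->] := quo_pi_surj u.
  exact: (proj2 (@quo_pi0 _ _ (trace_dgsub (F n.+2) (F n.+1)) x) isT).
set Q := quo_dgmod _.
pose inS (x : L) : sub_carrier (F 1) := Sub (x : regular L) isT.
pose q (x : L) : Q := quo_pi _ (inS x).
have inSL : linear inS by move=> a x y; apply: val_inj.
have qL : linear q by move=> a x y; rewrite /q inSL linearP.
have q_act a x : act a (q x) = q (a * x).
  rewrite /q [LHS]quo_actE; congr quo_pi; exact: val_inj.
have q_homog i x : x \in homog i -> q x \in homog i.
  by move=> xi; apply: quo_homog; rewrite homog_val.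
have qI x : q x = 0 -> x = 0.
  by move/(@quo_pi0 _ _ (trace_dgsub (F 1) (F 0)) _)/eqP.
have qS u : exists x, u = q x.
  have [y ->] := quo_pi_surj u; exists (\val y : L); congr quo_pi.
  exact: val_inj.
have tL : linear (fun c : ground k => q ((c : k) *: 1)).
  by move=> a x y; rewrite -qL scalerDl scalerA.
have th i (c : ground k) : c \in homog i -> linear_of tL c \in homog i.
  move=> ci; apply: q_homog; have [i0|i0] := eqVneq i 0.
    by rewrite i0; apply/homogZ/homog1.
  by rewrite (ground_homog ci i0) scale0r homog0.
pose T := GrMor th.
have qE a (c : ground k) : act a (T c) = q ((c : k) *: a).
  by rewrite -[T c]/(q ((c : k) *: 1)) q_act -scalerAr mulr1.
exists (ground k), T; split=> [c|].
  rewrite -[T c]/(q ((c : k) *: 1)) /q [LHS]quo_diffE -[RHS](linear0 (quo_pi (trace_dgsub (F 1) (F 0)))).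
  by congr quo_pi; apply: val_inj; rewrite /= linearZ /= diff1 scaler0.
split.
  split=> [a b x y|c b x y]; rewrite !qE -qL; congr q.
    by rewrite scalerDl scalerA.
  by rewrite scalerDr !scalerA mulrC.
move=> X c [c1 c2].
have [inv invE] := choice qS.
have qinj x y : q x = q y -> x = y.
  move=> e; apply/eqP; rewrite -subr_eq0; apply/eqP/qI.
  by rewrite -[q]/(linear_of qL : _ -> _) linearB /= e subrr.
have gL : linear (fun u => c (inv u) (1 : ground k)).
  move=> a u v; rewrite -c2; congr (c _ _); apply: qinj.
  by rewrite -invE qL -!invE.
exists (linear_of gL); split=> [a d|g' g'E u].
  rewrite -[LHS]/(c (inv (act a (T d))) 1).
  have -> : inv (act a (T d)) = (d : k) *: a by apply: qinj; rewrite -invE qE.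
  have := linearZ_LR (linear_of (c2 1)) d a; rewrite /= => ->.
  have := linearZ_LR (linear_of (c1 a)) d (1 : ground k); rewrite /= => <-.
  by congr (c a _); apply: mulr1.
have := g'E (inv u) 1; rewrite qE scale1r -invE => ->.
by [].
Qed.

(** A resolution f : P -> A carries Lambda^{>N} . P into Lambda^{>N}, so the hypothesis
    bounds the invariant computed on P; that a resolution exists at all is
    [regular_semifree]. *)
Lemma toomer_regular_le N :
  (forall z : L, diff z = 0 -> z \in words_ge L (full_pred V) N.+1 -> exists y, z = diff y) ->
  inf_leq (toomer (regular L)) N.
Proof.
move=> h; rewrite /toomer.
case: xgetP => [e -> [P [f [_ fq ->]]]|].
  have inj : cohomology_inj (quo_pi _ : P -> quo_dgmod (ideal_act (word_ideal L N.+1) P)).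
    move=> x dx [u]; have [y ->] := quo_pi_surj u.
    rewrite [mdiff _]quo_diffE => /quo_piP xy.
    have fxy : f (x - mdiff y) \in words_ge L (full_pred V) N.+1.
      move: (x - mdiff y) xy; apply: span_ind; first by rewrite linear0 rpred0.
        by move=> a u' v hu hv; rewrite linearP rpredD ?rpredZ.
      move=> _ [a [v [aI ->]]]; rewrite dgmor_act.
      by rewrite -[N.+1]addn0; apply: words_geM (words_full _).
    have [|y' y'E] := h _ _ fxy.
      by rewrite -[diff _]/(mdiff _) -dgmor_diff linearB /= mdiffK subr0 dx linear0.
    apply: fq.1 => //; exists (f y + y').
    have <- : f (x - mdiff y) + f (mdiff y) = f x by rewrite -linearD subrK.
    by rewrite y'E dgmor_diff addrC linearD.
  rewrite /toomer_semifree /least; case: pselect => [ex|]; last first.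
    by case; exists N; apply/asboolP.
  by rewrite /inf_leq; case: ex_minnP => r _; apply; apply/asboolP.
move=> /(_ (toomer_semifree (regular L))); case.
pose idm : grmor (regular L) (regular L) := @GrMor k (regular L) (regular L) idfun (fun _ _ => id).
pose idd : dgmor (regular L) (regular L) := @DGMor _ _ _ _ idm (fun _ _ => erefl) (fun _ => erefl).
have ide x : idd x = x by [].
exists (regular L), idd; split=> //.
  exact: regular_semifree.
split=> [x _ [y e]|y dy]; first by exists y; rewrite -e.
by exists y; split=> //; exists 0; rewrite ide subrr linear0.
Qed.
End ToomerIntro.

(** * Free graded commutative algebras *)

Lemma grmor_pr (k : fieldType) (V W : gradedType k) (f : {linear V -> W}) :
  (forall i x, x \in homog i -> f x \in homog i) -> forall i x, pr i (f x) = f (pr i x).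
Proof.
move=> fh i; apply: (linear_homog_eq (f := pr i \o f) (g := f \o pr i)) => j y yj /=.
by rewrite (pr_homog _ (fh _ _ yj)) (pr_homog _ yj); case: eqP => // _; rewrite linear0.
Qed.

Section FreeGCA.
Local Open Scope quotient_scope.
Context {k : fieldType} (U : gradedType k).

(** Terms will be identified when they have the same value in every graded commutative
    algebra, which gives the free algebra without normal forms for monomials.
    The constructor Pr puts the homogeneous components into the syntax. *)
Inductive tm : Type :=
  | Var of U | Zero | One | Add of tm & tm | Scale of k & tm | Mul of tm & tm
  | Pr of int & tm.

HB.instance Definition _ := gen_eqMixin tm.
HB.instance Definition _ := gen_choiceMixin tm.

Fixpoint ev (B : gcaType k) (f : U -> B) (t : tm) : B :=
  match t with
  | Var u => f u
  | Zero => 0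
  | One => 1
  | Add s t => ev f s + ev f t
  | Scale a t => a *: ev f t
  | Mul s t => ev f s * ev f t
  | Pr i t => pr i (ev f t)
  end.

Definition teq (s t : tm) : bool :=
  `[< forall (B : gcaType k) (f : grmor U B), ev f s = ev f t >].
Fact teq_refl : reflexive teq. Proof. by move=> s; apply/asboolP. Qed.
Fact teq_sym : symmetric teq.
Proof. by move=> s t; apply/asboolP/asboolP => h B f; rewrite h. Qed.
Fact teq_trans : transitive teq.
Proof. by move=> t s r /asboolP h /asboolP h'; apply/asboolP => B f; rewrite h h'. Qed.
Canonical teq_equiv := EquivRel teq teq_refl teq_sym teq_trans.

Definition fgca : Type := {eq_quot teq_equiv}.
HB.instance Definition _ := Choice.on fgca.

Definition tcl (t : tm) : fgca := \pi_({eq_quot teq_equiv}) t.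
Lemma tclP s t : (forall (B : gcaType k) (f : grmor U B), ev f s = ev f t) <-> tcl s = tcl t.
Proof.
split=> [h|/eqmodP /asboolP //]; by apply/eqmodP/asboolP.
Qed.
Definition trep (x : fgca) : tm := repr (x : {eq_quot teq_equiv}).
Lemma tclK x : tcl (trep x) = x. Proof. exact: reprK. Qed.
Lemma ev_trep t (B : gcaType k) (f : grmor U B) : ev f (trep (tcl t)) = ev f t.
Proof. exact: (proj2 (tclP _ _) (tclK (tcl t))). Qed.

Definition fevf (B : gcaType k) (f : grmor U B) (x : fgca) : B := ev f (trep x).
Lemma fgca_eq x y : (forall (B : gcaType k) (f : grmor U B), fevf f x = fevf f y) -> x = y.
Proof. by move=> h; rewrite -(tclK x) -(tclK y); apply/tclP => B f; apply: h. Qed.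

Definition fzero := tcl Zero.
Definition fone := tcl One.
Definition fadd x y := tcl (Add (trep x) (trep y)).
Definition fopp x := tcl (Scale (-1) (trep x)).
Definition fscale a x := tcl (Scale a (trep x)).
Definition fmul x y := tcl (Mul (trep x) (trep y)).
Definition fpr i x := tcl (Pr i (trep x)).
Definition fvar u := tcl (Var u).

Ltac solve_ev := move=> *; apply: fgca_eq => B f;
  rewrite /fevf /fzero /fone /fadd /fopp /fscale /fmul /fpr /fvar; do 5 (rewrite ?ev_trep /=).

Fact faddA : associative fadd. Proof. by solve_ev; rewrite addrA. Qed.
Fact faddC : commutative fadd. Proof. by solve_ev; rewrite addrC. Qed.
Fact fadd0 : left_id fzero fadd. Proof. by solve_ev; rewrite add0r. Qed.
Fact faddN : left_inverse fzero fopp fadd. Proof. by solve_ev; rewrite scaleN1r addNr. Qed.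
HB.instance Definition _ := GRing.isZmodule.Build fgca faddA faddC fadd0 faddN.

Fact fmulA : associative fmul. Proof. by solve_ev; rewrite mulrA. Qed.
Fact fmul1 : left_id fone fmul. Proof. by solve_ev; rewrite mul1r. Qed.
Fact fmulr1 : right_id fone fmul. Proof. by solve_ev; rewrite mulr1. Qed.
Fact fmulDl : left_distributive fmul fadd. Proof. by solve_ev; rewrite mulrDl. Qed.
Fact fmulDr : right_distributive fmul fadd. Proof. by solve_ev; rewrite mulrDr. Qed.
Fact fone_neq0 : fone != fzero.
Proof.
have zh i (x : U) : x \in homog i -> (\0 : {linear U -> ground k}) x \in homog i.
  by move=> _; apply: homog0.
apply/eqP => e; have /eqP := proj2 (tclP _ _) e _ (GrMor zh).
by rewrite /= oner_eq0.
Qed.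
HB.instance Definition _ := GRing.Zmodule_isNzRing.Build fgca
  fmulA fmul1 fmulr1 fmulDl fmulDr fone_neq0.

Fact fscaleA a b x : fscale a (fscale b x) = fscale (a * b) x.
Proof. by solve_ev; rewrite scalerA. Qed.
Fact fscale1 : left_id 1 fscale. Proof. by solve_ev; rewrite scale1r. Qed.
Fact fscaleDr : right_distributive fscale +%R. Proof. by solve_ev; rewrite scalerDr. Qed.
Fact fscaleDl x : {morph fscale^~ x : a b / a + b}. Proof. by solve_ev; rewrite scalerDl. Qed.
HB.instance Definition _ := GRing.Zmodule_isLmodule.Build k fgca fscaleA fscale1 fscaleDr fscaleDl.
Fact fscaleAl (a : k) (x y : fgca) : a *: (x * y) = (a *: x) * y.
Proof. by solve_ev; rewrite scalerAl. Qed.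
HB.instance Definition _ := GRing.Lmodule_isLalgebra.Build k fgca fscaleAl.
Fact fscaleAr (a : k) (x y : fgca) : a *: (x * y) = x * (a *: y).
Proof. by solve_ev; rewrite scalerAr. Qed.
HB.instance Definition _ := GRing.Lalgebra_isAlgebra.Build k fgca fscaleAr.

Fact fpr_linear i : linear (fpr i).
Proof.
move=> a x y; change (fpr i (fadd (fscale a x) y) = fadd (fscale a (fpr i x)) (fpr i y)).
by solve_ev; rewrite linearP.
Qed.
HB.instance Definition _ i := GRing.isLinear.Build k fgca fgca _ (fpr i) (fpr_linear i).
Fact fpr_pr i j x : fpr i (fpr j x) = if i == j then fpr j x else 0.
Proof.
case: ifP => ij; apply: fgca_eq => B f; rewrite /fevf /fpr !ev_trep /= !ev_trep /= ?ev_trep pr_pr ij //.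
Qed.

Lemma fevf_sum (B : gcaType k) (f : grmor U B) (s : seq int) x :
  fevf f (\sum_(i <- s) fpr i x) = \sum_(i <- s) pr i (fevf f x).
Proof.
elim: s => [|i s IH]; first by rewrite !big_nil; exact: ev_trep.
rewrite !big_cons -IH [LHS]ev_trep /=; congr (_ + _).
by rewrite -/(fevf f _) /fpr /fevf ev_trep.
Qed.

Let cover (B : gcaType k) (x : B) (s t : seq int) : {subset s <= t} -> uniq t ->
  x = \sum_(i <- s) pr i x -> x = \sum_(i <- t) pr i x.
Proof.
move=> st ut ex; apply: pr_sum_sub => // i it; apply: (pr_notin ex).
by apply: contra it; apply: st.
Qed.

(** Finitely many degrees support all values of a term; hence elements of the quotient
    are finite sums of homogeneous components. *)
Fact tm_bound t : exists2 s : seq int, uniq s &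
  forall (B : gcaType k) (f : grmor U B), ev f t = \sum_(i <- s) pr i (ev f t).
Proof.
elim: t => [u|||s [S uS hS] t [T uT hT]|a t [T uT hT]|s [S uS hS] t [T uT hT]|j t [T uT hT]].
- have [s us e] := pr_sum u; exists s => // B f /=; rewrite {1}e linear_sum.
  by apply: eq_bigr => i _; rewrite (grmor_pr (@grmor_homog _ _ _ f)).
- by exists [::] => // B f; rewrite big_nil.
- exists [:: 0] => // B f /=; rewrite big_seq1 (pr_homog 0 (homog1 (s := B))) //.
- exists (undup (S ++ T)) => [|B f]; first exact: undup_uniq.
  rewrite /= {1}(cover _ (undup_uniq (S ++ T)) (hS B f)); last by move=> i; rewrite mem_undup mem_cat => ->.
  rewrite {1}(cover _ (undup_uniq (S ++ T)) (hT B f)); last by move=> i;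
    rewrite mem_undup mem_cat orbC => ->.
  by rewrite -big_split; apply: eq_bigr => i _; rewrite linearD.
- exists T => // B f /=; rewrite {1}hT scaler_sumr; apply: eq_bigr => i _.
  by rewrite linearZ.
- exists (undup [seq i + j | i <- S, j <- T]) => [|B f /=]; first exact: undup_uniq.
  apply: pr_sum_sub; first exact: undup_uniq.
  move=> n; rewrite mem_undup => nST.
  rewrite {1}hS {1}hT mulr_suml linear_sum big_seq big1 // => i iS.
  rewrite mulr_sumr linear_sum big_seq big1 // => j jT.
  rewrite (pr_homog _ (homogM _ _ _ _ (homog_pr i _) (homog_pr j _))).
  by case: eqP => // nij; case/negP: nST; rewrite nij; apply: allpairs_f.
- exists [:: j] => // B f /=; by rewrite big_seq1 pr_pr eqxx.
Qed.

Fact fpr_sum x : exists2 s : seq int, uniq s & x = \sum_(i <- s) fpr i x.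
Proof.
have [s us h] := tm_bound (trep x); exists s => //.
by apply: fgca_eq => B f; rewrite fevf_sum -h.
Qed.
HB.instance Definition _ := isGraded.Build k fgca fpr_pr fpr_sum.

Lemma fevf_pr (B : gcaType k) (f : grmor U B) i x : fevf f (pr i x) = pr i (fevf f x).
Proof. exact: ev_trep. Qed.
Lemma fevf_homog (B : gcaType k) (f : grmor U B) i x : x \in homog i -> fevf f x \in homog i.
Proof. by move=> /homogP e; apply/homogP; rewrite -fevf_pr e. Qed.
Lemma fgca_homog i x : (forall (B : gcaType k) (f : grmor U B), fevf f x \in homog i) -> x \in homog i.
Proof. by move=> h; apply/homogP/fgca_eq => B f; rewrite fevf_pr; apply/homogP; apply: h. Qed.

Lemma fevfD (B : gcaType k) (f : grmor U B) : {morph fevf f : x y / x + y}.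
Proof. by move=> x y; apply: ev_trep. Qed.
Lemma fevfM (B : gcaType k) (f : grmor U B) : {morph fevf f : x y / x * y}.
Proof. by move=> x y; apply: ev_trep. Qed.
Lemma fevfZ (B : gcaType k) (f : grmor U B) a : {morph fevf f : x / a *: x}.
Proof. by move=> x; apply: ev_trep. Qed.
Lemma fevf0 (B : gcaType k) (f : grmor U B) : fevf f 0 = 0. Proof. exact: ev_trep. Qed.
Lemma fevf1 (B : gcaType k) (f : grmor U B) : fevf f 1 = 1. Proof. exact: ev_trep. Qed.

Fact fpr_lt0 (i : int) (x : fgca) : i < 0 -> pr i x = 0.
Proof. by move=> i0; apply: fgca_eq => B f; rewrite fevf_pr pr_lt0 // fevf0. Qed.
Fact fhomog1 : (1 : fgca) \in homog 0.
Proof. by apply: fgca_homog => B f; rewrite fevf1 homog1. Qed.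
Fact fhomogM (i j : int) (x y : fgca) :
  x \in homog i -> y \in homog j -> x * y \in homog (i + j).
Proof.
by move=> xi yj; apply: fgca_homog => B f; rewrite fevfM homogM // fevf_homog.
Qed.
Fact fhomogC (i j : int) (x y : fgca) :
  x \in homog i -> y \in homog j -> x * y = ((-1) ^ (i * j) : k) *: (y * x).
Proof.
move=> xi yj; apply: fgca_eq => B f; rewrite fevfZ !fevfM.
by apply: homogC; apply: fevf_homog.
Qed.
HB.instance Definition _ := isGCA.Build k fgca fpr_lt0 fhomog1 fhomogM fhomogC.

(** Only the words of this algebra matter; the zero differential makes it a [freeCDGA]. *)
Definition fdiff : {linear fgca -> fgca} := \0.
Fact fhomog_diff (i : int) (x : fgca) : x \in homog i -> fdiff x \in homog (i + 1).
Proof. by move=> _; apply: homog0. Qed.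
Fact fdiffK (x : fgca) : fdiff (fdiff x) = 0. Proof. by []. Qed.
Fact fdiffM (i : int) (x y : fgca) : x \in homog i ->
  fdiff (x * y) = fdiff x * y + ((-1) ^ i : k) *: (x * fdiff y).
Proof. by move=> _; rewrite mul0r mulr0 scaler0 addr0. Qed.
HB.instance Definition _ := isCDGA.Build k fgca fhomog_diff fdiffK fdiffM.

Fact fvar_linear : linear fvar.
Proof.
move=> a x y; change (fvar (a *: x + y) = fadd (fscale a (fvar x)) (fvar y)).
by solve_ev; rewrite linearP.
Qed.
Fact fvar_homog i u : u \in homog i -> linear_of fvar_linear u \in homog i.
Proof.
move=> ui; apply: fgca_homog => B f.
by rewrite [fevf _ _]ev_trep; apply: grmor_homog.
Qed.
Definition fgen : grmor U fgca := GrMor fvar_homog.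

Fact fevf_linear (B : gcaType k) (f : grmor U B) : linear (fevf f).
Proof. by move=> a x y; rewrite fevfD fevfZ. Qed.
Fact fevf_monoid (B : gcaType k) (f : grmor U B) : monoid_morphism (fevf f).
Proof. by split; [apply: fevf1|apply: fevfM]. Qed.
HB.instance Definition _ (B : gcaType k) (f : grmor U B) :=
  GRing.isLinear.Build k fgca B _ (fevf f) (fevf_linear f).
HB.instance Definition _ (B : gcaType k) (f : grmor U B) :=
  GRing.isMonoidMorphism.Build fgca B (fevf f) (fevf_monoid f).
Definition fev (B : gcaType k) (f : grmor U B) : gcamor fgca B :=
  @GcaMor k fgca B (fevf f) (@fevf_homog B f).

Lemma fgen_free : free_on fgen.
Proof.
move=> B f; exists (fev f); split=> [u|g gE x]; first exact: (ev_trep (Var u) f).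
rewrite -(tclK x) -[RHS]/(ev f (trep (tcl (trep x)))) ev_trep.
have E s t : g (tcl (Add s t)) = g (tcl s) + g (tcl t).
  by rewrite -linearD; congr (g _); apply/tclP => C h; rewrite /= !ev_trep.
elim: (trep x) => [u|||s IHs t IHt|a t IH|s IHs t IHt|i t IH] /=.
- exact: gE.
- exact: (linear0 g).
- exact: (rmorph1 g).
- by rewrite E IHs IHt.
- by rewrite -IH -linearZ /=; congr (g _); apply/tclP => C h; rewrite /= !ev_trep.
- by rewrite -IHs -IHt -rmorphM /=; congr (g _); apply/tclP => C h; rewrite /= !ev_trep.
- rewrite -IH (grmor_pr (@gcamor_homog _ _ _ g)); congr (g _).
  by apply/tclP => C h; rewrite /= !ev_trep.
Qed.
End FreeGCA.

(** * Derivations of a free algebra *)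

(** Degree i of the shift is degree i + e of V: for e = 1 a suspended letter sits one
    degree below the original. *)
Definition shift (k : fieldType) (e : int) (V : gradedType k) : Type := V.
Section Shift.
Context {k : fieldType} (e : int) {V : gradedType k}.
HB.instance Definition _ := GRing.Lmodule.on (shift e V).
Definition shift_pr (i : int) (x : shift e V) : shift e V := pr (i + e) (x : V).
Fact shift_pr_linear i : linear (shift_pr i).
Proof. by move=> a x y; rewrite /shift_pr linearP. Qed.
HB.instance Definition _ i :=
  GRing.isLinear.Build k (shift e V) (shift e V) _ (shift_pr i) (shift_pr_linear i).
Fact shift_pr_pr i j x : shift_pr i (shift_pr j x) = if i == j then shift_pr j x else 0.
Proof. by rewrite /shift_pr pr_pr (inj_eq (addIr e)). Qed.
Fact shift_pr_sum x : exists2 s : seq int, uniq s & x = \sum_(i <- s) shift_pr i x.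
Proof.
have [s us ex] := pr_sum (x : V); exists [seq i - e | i <- s].
  by rewrite map_inj_uniq //; apply: addIr.
rewrite big_map {1}ex; apply: eq_bigr => i _.
by rewrite /shift_pr subrK.
Qed.
HB.instance Definition _ := isGraded.Build k (shift e V) shift_pr_pr shift_pr_sum.
Lemma homog_shift i (x : V) : ((x : shift e V) \in homog i) = (x \in homog (i + e)).
Proof. by apply/homogP/homogP. Qed.
End Shift.

Section NonNeg.
Context {k : fieldType} {V : gradedType k}.
Definition nneg_pred : {pred V} := fun x => `[< forall i : int, i < 0 -> pr i x = 0 >].
Fact nneg_closed : submod_closed nneg_pred.
Proof.
split; first by apply/asboolP => i _; rewrite linear0.
move=> a x y /asboolP hx /asboolP hy; apply/asboolP => i i0.
by rewrite linearP /= hx // hy // scaler0 addr0.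
Qed.
HB.instance Definition _ := GRing.isSubmodClosed.Build k V nneg_pred nneg_closed.
Fact nneg_pr i x : x \in nneg_pred -> pr i x \in nneg_pred.
Proof.
move=> /asboolP h; apply/asboolP => j j0; rewrite pr_pr; case: eqP => // <-.
exact: h.
Qed.
Definition nneg : grsub V := @GrSub k V (nneg_pred : submodClosed V) nneg_pr.
End NonNeg.

(** Non-negatively graded, as the square-zero extension has to be a [gcaType]. *)
Record bimod (k : fieldType) (B : gcaType k) := BiMod {
  bimod_graded :> gradedType k;
  lact : B -> bimod_graded -> bimod_graded;
  ract : bimod_graded -> B -> bimod_graded;
  bimod_lt0 : forall (i : int) x, i < 0 -> pr i (x : bimod_graded) = 0;
  lactL : forall b, linear (lact b);
  lactR : forall x, linear (lact^~ x);
  ractL : forall x, linear (ract x);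
  ractR : forall b, linear (ract^~ b);
  lact1 : forall x, lact 1 x = x;
  ract1 : forall x, ract x 1 = x;
  lactM : forall a b x, lact (a * b) x = lact a (lact b x);
  ractM : forall a b x, ract x (a * b) = ract (ract x a) b;
  lrA : forall a b x, ract (lact a x) b = lact a (ract x b);
  lact_homog : forall i j b x, b \in homog i -> x \in homog j -> lact b x \in homog (i + j);
  lract_comm : forall i j b x, b \in homog i -> x \in homog j ->
    lact b x = ((-1) ^ (i * j) : k) *: ract x b
}.

Definition sqz (k : fieldType) (B : gcaType k) (M : bimod B) : Type := (B * M)%type.
Section SquareZero.
Context {k : fieldType} {B : gcaType k} (M : bimod B).
HB.instance Definition _ := Graded.on (sqz M).
Definition sqz_one : sqz M := (1, 0).
Definition sqz_mul (x y : sqz M) : sqz M := (x.1 * y.1, lact x.1 y.2 + ract x.2 y.1).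

Let lD b := linearD (linear_of (@lactL k B M b)).
Let lZ b := linearZ_LR (linear_of (@lactL k B M b)).
Let l0 b := linear0 (linear_of (@lactL k B M b)).
Let rD b := linearD (linear_of (@ractR k B M b)).
Let rZ b := linearZ_LR (linear_of (@ractR k B M b)).
Let r0 b := linear0 (linear_of (@ractR k B M b)).
Let lD' b := linearD (linear_of (@lactR k B M b)).
Let lZ' b := linearZ_LR (linear_of (@lactR k B M b)).
Let rD' b := linearD (linear_of (@ractL k B M b)).
Let rZ' b := linearZ_LR (linear_of (@ractL k B M b)).

Fact sqz_mulA : associative sqz_mul.
Proof.
move=> x y z; rewrite /sqz_mul /= mulrA; congr (_, _).
by rewrite [lact _ (_ + _)]lD [ract (_ + _) _]rD /= lactM ractM lrA addrA.
Qed.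
Fact sqz_mul1 : left_id sqz_one sqz_mul.
Proof. by move=> [a x]; rewrite /sqz_mul /= mul1r lact1 [ract 0 _]r0 addr0. Qed.
Fact sqz_mulr1 : right_id sqz_one sqz_mul.
Proof. by move=> [a x]; rewrite /sqz_mul /= mulr1 ract1 [lact _ 0]l0 add0r. Qed.
Fact sqz_mulDl : left_distributive sqz_mul +%R.
Proof.
move=> x y z; rewrite /sqz_mul /=; apply: injective_projections => /=; first exact: mulrDl.
by rewrite [lact (_ + _) _]lD' [ract (_ + _) _]rD /= addrACA.
Qed.
Fact sqz_mulDr : right_distributive sqz_mul +%R.
Proof.
move=> x y z; rewrite /sqz_mul /=; apply: injective_projections => /=; first exact: mulrDr.
by rewrite [lact _ (_ + _)]lD [ract _ (_ + _)]rD' /= addrACA.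
Qed.
Fact sqz_one_neq0 : sqz_one != 0.
Proof. by apply/eqP => /(congr1 fst) /= /eqP; rewrite oner_eq0. Qed.
HB.instance Definition _ := GRing.Zmodule_isNzRing.Build (sqz M)
  sqz_mulA sqz_mul1 sqz_mulr1 sqz_mulDl sqz_mulDr sqz_one_neq0.
Fact sqz_scaleAl (a : k) (x y : sqz M) : a *: (x * y) = (a *: x) * y.
Proof.
apply: injective_projections => /=; first exact: scalerAl.
by rewrite [lact (_ *: _) _]lZ' [ract (_ *: _) _]rZ /= scalerDr.
Qed.
HB.instance Definition _ := GRing.Lmodule_isLalgebra.Build k (sqz M) sqz_scaleAl.
Fact sqz_scaleAr (a : k) (x y : sqz M) : a *: (x * y) = x * (a *: y).
Proof.
apply: injective_projections => /=; first exact: scalerAr.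
by rewrite [lact _ (_ *: _)]lZ [ract _ (_ *: _)]rZ' /= scalerDr.
Qed.
HB.instance Definition _ := GRing.Lalgebra_isAlgebra.Build k (sqz M) sqz_scaleAr.

Lemma homog_sqz i (x : sqz M) : (x \in homog i) = (x.1 \in homog i) && (x.2 \in homog i).
Proof.
apply/homogP/andP => [e|[/homogP e1 /homogP e2]].
  by split; apply/homogP; rewrite -[in RHS]e.
by apply: injective_projections.
Qed.
Fact sqz_lt0 (i : int) (x : sqz M) : i < 0 -> pr i x = 0.
Proof. by move=> i0; apply: injective_projections => /=; [apply: pr_lt0|apply: bimod_lt0]. Qed.
Fact sqz_homog1 : (1 : sqz M) \in homog 0.
Proof. by rewrite homog_sqz /= homog1 homog0. Qed.
Fact sqz_homogC (i j : int) (x y : sqz M) :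
  x \in homog i -> y \in homog j -> x * y = ((-1) ^ (i * j) : k) *: (y * x).
Proof.
rewrite !homog_sqz => /andP[x1 x2] /andP[y1 y2]; apply: injective_projections => /=.
  exact: homogC.
rewrite (lract_comm x1 y2) (lract_comm y1 x2) scalerDr addrC scalerA.
by rewrite [j * i]mulrC -/(sg (i * j)) sgK scale1r.
Qed.
Fact sqz_homogM (i j : int) (x y : sqz M) :
  x \in homog i -> y \in homog j -> x * y \in homog (i + j).
Proof.
rewrite !homog_sqz => /andP[x1 x2] /andP[y1 y2] /=; rewrite homogM //=.
apply: homogD; first exact: lact_homog.
have -> : ract x.2 y.1 = sg (j * i) *: lact y.1 x.2.
  by rewrite (lract_comm y1 x2) scalerA -/(sg (j * i)) sgK scale1r.
by apply: homogZ; rewrite addrC; apply: lact_homog.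
Qed.
HB.instance Definition _ := isGCA.Build k (sqz M) sqz_lt0 sqz_homog1 sqz_homogM sqz_homogC.
End SquareZero.

Lemma linear_pr_shift (k : fieldType) (V W : gradedType k) (f : {linear V -> W}) (e : int) :
  (forall i x, x \in homog i -> f x \in homog (i + e)) ->
  forall i x, pr (i + e) (f x) = f (pr i x).
Proof.
move=> fh i; apply: (linear_homog_eq (f := pr (i + e) \o f) (g := f \o pr i)) => j y yj /=.
rewrite (pr_homog _ (fh _ _ yj)) (pr_homog _ yj) (inj_eq (addIr e)).
by case: eqP => // _; rewrite linear0.
Qed.

Definition gcamor_of (k : fieldType) (A B : gcaType k) (f : A -> B)
  (fL : linear f) (fM : monoid_morphism f)
  (fH : forall i x, x \in homog i -> f x \in homog i) : gcamor A B :=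
  @GcaMor k A B (HB.pack f (GRing.isLinear.Build k A B _ f fL)
    (GRing.isMonoidMorphism.Build A B f fM)) fH.

Definition gca_id (k : fieldType) (A : gcaType k) : gcamor A A :=
  @GcaMor k A A idfun (fun _ _ => id).

Definition gca_comp (k : fieldType) (A B C : gcaType k) (g : gcamor B C) (f : gcamor A B) :
    gcamor A C :=
  @GcaMor k A C (g \o f) (fun i x xi => gcamor_homog g (gcamor_homog f xi)).

Lemma free_on_eq (k : fieldType) (U : gradedType k) (Q B : gcaType k) (g : grmor U Q)
    (gfree : free_on g) (f f' : gcamor Q B) :
  (forall u, f (g u) = f' (g u)) -> f =1 f'.
Proof.
move=> e.
pose h := @GrMor k U B (f \o g) (fun i u ui => gcamor_homog f (grmor_homog g ui)).
have [h' [_ hU]] := gfree B h.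
by move=> x; rewrite (hU f) // (hU f') // => u; rewrite -e.
Qed.

Section ExtendDerivation.
Context {k : fieldType} {U : gradedType k} {Q B : gcaType k} {g : grmor U Q}.
Hypothesis gfree : free_on g.

(** A derivation is the second component of an algebra map to a square-zero extension,
    which the universal property provides. *)
Lemma sqz_derivation (M : bimod B) (f : gcamor Q B) (del : grmor U M) :
  exists Del : {linear Q -> M},
  [/\ forall u, Del (g u) = del u,
      forall i x, x \in homog i -> Del x \in homog i &
      forall x y, Del (x * y) = lact (f x) (Del y) + ract (Del x) (f y)].
Proof.
pose h0 (u : U) : sqz M := (f (g u), del u).
have h0L : linear h0.
  by move=> a x y; apply: injective_projections; rewrite /= !linearP.
have h0H i u : u \in homog i -> linear_of h0L u \in homog i.
  by move=> ui; rewrite homog_sqz /= gcamor_homog ?grmor_homog //.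
have [h [hE _]] := gfree (GrMor h0H).
have f1L : linear (fun x => (h x).1) by move=> a x y; rewrite linearP.
have f2L : linear (fun x => (h x).2) by move=> a x y; rewrite linearP.
have f1M : monoid_morphism (fun x => (h x).1).
  by split=> [|x y]; rewrite ?rmorph1 ?rmorphM.
have f1H i x : x \in homog i -> (h x).1 \in homog i.
  by move=> xi; have := gcamor_homog h xi; rewrite homog_sqz => /andP[].
have fE x : (h x).1 = f x.
  apply: (free_on_eq gfree (f := gcamor_of f1L f1M f1H)) => u /=.
  by rewrite hE.
exists (linear_of f2L); split=> [u|i x xi|x y] /=.
- by rewrite hE.
- by have := gcamor_homog h xi; rewrite homog_sqz => /andP[].
- by rewrite rmorphM /= !fE.
Qed.
End ExtendDerivation.

Section ShiftBimod.
Context {k : fieldType} (B : gcaType k) (e : int).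
Local Notation S := (@nneg k (shift e B)).
Local Notation M := (sub_carrier S).
Hypothesis e1 : sg e = -1 :> k.

Lemma nneg_shift_mul (a x b : B) :
  (x : shift e B) \in (S : submodClosed _) ->
  (a * x * b : shift e B) \in (S : submodClosed _).
Proof.
move=> /asboolP hx; apply/asboolP => i i0; change (pr (i + e) (a * x * b) = 0 :> B).
have {}hx j : j < e -> pr j x = 0.
  move=> je; have := hx (j - e); rewrite subr_lt0 => /(_ je).
  by rewrite -[LHS]/(pr (j - e + e) x) subrK.
have [s1 _ ea] := pr_sum a; have [s2 _ ex] := pr_sum x; have [s3 _ eb] := pr_sum b.
rewrite {1}ea {1}ex {1}eb -mulrA mulr_suml linear_sum big1 // => p _.
rewrite mulr_suml mulr_sumr linear_sum big1 // => q _.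
rewrite !mulr_sumr linear_sum big1 // => r _.
have [p0|p0] := ltP p 0; first by rewrite (pr_lt0 p a p0) mul0r linear0.
have [r0|r0] := ltP r 0; first by rewrite (pr_lt0 r b r0) !mulr0 linear0.
have [qe|qe] := ltP q e; first by rewrite hx // mul0r mulr0 linear0.
rewrite (pr_homog _ (homogM _ _ _ _ (homog_pr p a) (homogM _ _ _ _ (homog_pr q x) (homog_pr r b)))).
case: eqP => // E; exfalso; move: i0; rewrite -subr_ge0 in qe.
have -> : i = p + r + (q - e) by rewrite -[i](addrK e) E [q + r]addrC !addrA.
by rewrite ltNge (addr_ge0 (addr_ge0 p0 r0) qe).
Qed.

(** The sign is that of moving an operator of odd degree e past b. *)
Definition shl (b : B) (m : M) : M.
Proof.
by exists (sgn b * \val m); have := nneg_shift_mul (sgn b) 1 (valP m); rewrite mulr1.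
Defined.
Definition shr (m : M) (b : B) : M.
Proof.
by exists (\val m * b); have := nneg_shift_mul 1 b (valP m); rewrite mul1r.
Defined.

Definition shift_bimod : bimod B.
Proof.
refine (@BiMod k B M shl shr _ _ _ _ _ _ _ _ _ _ _ _).
- by move=> i x i0; apply: val_inj; have /asboolP := valP x; apply.
- by move=> b a x y; apply: val_inj; rewrite /= mulrDr scalerAr.
- by move=> x a b c; apply: val_inj; rewrite /= linearP mulrDl scalerAl.
- by move=> x a b c; apply: val_inj; rewrite /= mulrDr scalerAr.
- by move=> b a x y; apply: val_inj; rewrite /= mulrDl scalerAl.
- by move=> x; apply: val_inj; rewrite /= sgn1 mul1r.
- by move=> x; apply: val_inj; rewrite /= mulr1.
- by move=> a b x; apply: val_inj; rewrite /= sgnM mulrA.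
- by move=> a b x; apply: val_inj; rewrite /= mulrA.
- by move=> a b x; apply: val_inj; rewrite /= mulrA.
- move=> i j b x bi; rewrite !homog_val !homog_shift /= => xj.
  by rewrite -addrA homogM // homog_sgn.
- move=> i j b x bi; rewrite homog_val homog_shift => xj; apply: val_inj => /=.
  have sie : sg (i * e) = sg i :> k by rewrite mulrC /sg -exprz_exp -/(sg e) e1.
  by rewrite (sgn_homog bi) -scalerAl (gca_comm bi xj) scalerA mulrDr sgD sie mulrCA sgK mulr1.
Defined.

End ShiftBimod.

(** Derivations of odd degree are maps to the square-zero extension by the shifted algebra,
    cut off below degree 0. *)
Lemma free_derivation (k : fieldType) (U : gradedType k) (Q : gcaType k) (g : grmor U Q)
    (e : int) (del : {linear U -> Q}) :
  free_on g -> sg e = -1 :> k -> (forall (i : int) (u : U), i < 0 -> pr i u = 0) ->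
  (forall i u, u \in homog i -> del u \in homog (i + e)) ->
  exists Del : {linear Q -> Q},
  [/\ forall u, Del (g u) = del u,
      forall i x, x \in homog i -> Del x \in homog (i + e) &
      forall x y, Del (x * y) = Del x * y + sgn x * Del y].
Proof.
move=> gfree e1 U0 delH.
have delN u : (del u : shift e Q) \in (@nneg k (shift e Q) : submodClosed _).
  apply/asboolP => i i0; change (pr (i + e) (del u) = 0).
  by rewrite (linear_pr_shift delH) U0 // linear0.
pose d (u : U) : shift_bimod Q e1 := (Sub (del u : shift e Q) (delN u) : sub_carrier nneg).
have dL : linear d by move=> a x y; apply: val_inj; rewrite /= linearP.
have dH i u : u \in homog i -> linear_of dL u \in homog i.
  by move=> ui; rewrite [_ \in _]homog_val homog_shift; apply: delH.
have [D [D1 D2 D3]] := sqz_derivation gfree (gca_id Q) (GrMor dH).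
have vL : linear (fun x => \val (D x : sub_carrier nneg) : Q).
  by move=> a x y; rewrite linearP.
exists (linear_of vL); split=> [u|i x xi|x y] /=.
- by rewrite D1.
- by have h := D2 i x xi; rewrite [_ \in _]homog_val homog_shift in h.
- by rewrite D3 /= addrC.
Qed.

Section LinearPart.
Context {k : fieldType} {W : gradedType k}.
Hypothesis W0 : forall (i : int) (v : W), i < 0 -> pr i v = 0.

Definition ground_bimod : bimod (ground k).
Proof.
refine (@BiMod k (ground k) W (fun b x => (b : k) *: x) (fun x b => (b : k) *: x) W0
  _ _ _ _ _ _ _ _ _ _ _).
- by move=> b a x y; rewrite scalerDr !scalerA mulrC.
- by move=> x a b c; rewrite scalerDl scalerA.
- by move=> x a b c; rewrite scalerDl scalerA.
- by move=> b a x y; rewrite scalerDr !scalerA mulrC.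
- by move=> x; rewrite scale1r.
- by move=> x; rewrite scale1r.
- by move=> a b x; rewrite scalerA.
- by move=> a b x; rewrite scalerA mulrC.
- by move=> a b x; rewrite !scalerA mulrC.
- move=> i j b x bi xj; have [i0|i0] := eqVneq i 0.
    by rewrite i0 add0r; apply: homogZ.
  by rewrite (ground_homog bi i0) scale0r homog0.
- move=> i j b x bi xj; have [i0|i0] := eqVneq i 0.
    by rewrite i0 mul0r expr0z scale1r.
  by rewrite (ground_homog bi i0) scale0r scaler0.
Defined.
End LinearPart.

Section FreeCDGA.
Context {k : fieldType} {W : gradedType k} (L : freeCDGA W).

Lemma aug_ex : exists ep : gcamor L (ground k), forall v, ep (gen v) = 0.
Proof.
have zh i (x : W) : x \in homog i -> (\0 : {linear W -> ground k}) x \in homog i.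
  by move=> _; apply: homog0.
by have [ep [epE _]] := gen_free L (GrMor zh); exists ep.
Qed.
Definition aug : gcamor L (ground k) := sval (cid aug_ex).
Lemma aug_gen v : aug (gen v) = 0. Proof. by rewrite /aug; case: (cid _). Qed.
Lemma aug_words q x : (0 < q)%N -> x \in words_ge L (full_pred W) q -> aug x = 0.
Proof.
move=> q0; move: x; apply: span_ind; first by rewrite linear0.
  by move=> a x y hx hy; rewrite linearP /= hx hy scaler0 addr0.
move=> _ [[|v s] [_ sq ->]]; first by rewrite leqn0 in sq; rewrite (eqP sq) in q0.
by rewrite big_cons rmorphM /= aug_gen mul0r.
Qed.

Lemma linear_part_ex : exists lp : {linear L -> W},
  [/\ forall v, lp (gen v) = v, forall i x, x \in homog i -> lp x \in homog i,
      lp 1 = 0 & forall x y, lp (x * y) = (aug x : k) *: lp y + (aug y : k) *: lp x].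
Proof.
have ih i (x : W) : x \in homog i -> (idfun : {linear W -> W}) x \in homog i by [].
have [D [D1 D2 D3]] := sqz_derivation (gen_free L) (M := ground_bimod (gen_nneg L)) aug (GrMor ih).
exists D; split=> //.
have := D3 1 1; rewrite !rmorph1 mulr1 /= !scale1r => /eqP.
by rewrite -subr_eq subrr eq_sym => /eqP.
Qed.
(** The projection to words of length 1, as the derivation over the augmentation that
    extends the identity of W. *)
Definition lpart : {linear L -> W} := sval (cid linear_part_ex).
Lemma lpart_gen v : lpart (gen v) = v.
Proof. by rewrite /lpart; case: (cid _) => D []. Qed.
Lemma lpart_homog i x : x \in homog i -> lpart x \in homog i.
Proof. by rewrite /lpart; case: (cid _) => D [] /= _ h _ _; apply: h. Qed.
Lemma lpart1 : lpart 1 = 0.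
Proof. by rewrite /lpart; case: (cid _) => D []. Qed.
Lemma lpartM x y : lpart (x * y) = (aug x : k) *: lpart y + (aug y : k) *: lpart x.
Proof. by rewrite /lpart; case: (cid _) => D []. Qed.
Lemma lpart_words F q x : (1 < q)%N -> x \in words_ge L F q -> lpart x = 0.
Proof.
move=> q0; move: x; apply: span_ind; first by rewrite linear0.
  by move=> a x y hx hy; rewrite linearP hx hy scaler0 addr0.
move=> _ [[|v [|w s]] [_ sq ->]]; try by have := leq_trans q0 sq.
by rewrite !big_cons lpartM rmorphM /= !aug_gen mul0r !scale0r addr0.
Qed.
End FreeCDGA.

(** * Tensor products of graded commutative algebras *)

Section Tensor.
Local Open Scope quotient_scope.
Context {k : fieldType} (U V : lmodType k).

(** Formal sums will be identified when all bilinear maps agree on them, which gives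
    the tensor product without bases. *)
Definition fsums : Type := seq (U * V).
HB.instance Definition _ := Choice.on fsums.
Definition fsum_ev (X : lmodType k) (c : U -> V -> X) (s : fsums) : X :=
  \sum_(p <- s) c p.1 p.2.
Definition fsum_eq (s t : fsums) : bool :=
  `[< forall (X : lmodType k) (c : U -> V -> X), bilinear_map c -> fsum_ev c s = fsum_ev c t >].
Fact fsum_refl : reflexive fsum_eq. Proof. by move=> s; apply/asboolP. Qed.
Fact fsum_sym : symmetric fsum_eq.
Proof. by move=> s t; apply/asboolP/asboolP => h X c bc; rewrite h. Qed.
Fact fsum_trans : transitive fsum_eq.
Proof. by move=> t s r /asboolP h /asboolP h'; apply/asboolP => X c bc; rewrite h ?h'. Qed.
Canonical fsum_equiv := EquivRel fsum_eq fsum_refl fsum_sym fsum_trans.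

Definition tensor : Type := {eq_quot fsum_equiv}.
HB.instance Definition _ := Choice.on tensor.
Definition tns (s : fsums) : tensor := \pi_({eq_quot fsum_equiv}) s.
Definition tnr (x : tensor) : fsums := repr (x : {eq_quot fsum_equiv}).
Lemma tnK x : tns (tnr x) = x. Proof. exact: reprK. Qed.
Lemma tnsP s t : (forall (X : lmodType k) (c : U -> V -> X), bilinear_map c ->
  fsum_ev c s = fsum_ev c t) <-> tns s = tns t.
Proof. by split=> [h|/eqmodP /asboolP //]; apply/eqmodP/asboolP. Qed.
Lemma ev_tnr (X : lmodType k) (c : U -> V -> X) s : bilinear_map c -> fsum_ev c (tnr (tns s)) = fsum_ev c s.
Proof. exact: (proj2 (tnsP _ _) (tnK (tns s))). Qed.
Definition tev (X : lmodType k) (c : U -> V -> X) (x : tensor) : X := fsum_ev c (tnr x).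
Lemma tensor_ext x y : (forall (X : lmodType k) (c : U -> V -> X), bilinear_map c ->
  tev c x = tev c y) -> x = y.
Proof. by move=> h; rewrite -(tnK x) -(tnK y); apply/tnsP => X c bc; apply: h. Qed.

Definition tzero := tns [::].
Definition tadd x y := tns (tnr x ++ tnr y).
Definition tscale a x := tns [seq (a *: p.1, p.2) | p <- tnr x].
Definition topp x := tscale (-1) x.

Section Ev.
Context (X : lmodType k) (c : U -> V -> X) (bc : bilinear_map c).
Lemma bilZl a u v : c (a *: u) v = a *: c u v. Proof. exact: (linearZ_LR (linear_of (bc.2 v))). Qed.
Lemma bilDl u u' v : c (u + u') v = c u v + c u' v. Proof. exact: (linearD (linear_of (bc.2 v))). Qed.
Lemma bilZr a u v : c u (a *: v) = a *: c u v. Proof. exact: (linearZ_LR (linear_of (bc.1 u))). Qed.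
Lemma bilDr u v v' : c u (v + v') = c u v + c u v'. Proof. exact: (linearD (linear_of (bc.1 u))). Qed.
Lemma tev0 : tev c tzero = 0. Proof. by rewrite /tev ev_tnr // /fsum_ev big_nil. Qed.
Lemma tevD x y : tev c (tadd x y) = tev c x + tev c y.
Proof. by rewrite /tev ev_tnr // /fsum_ev big_cat. Qed.
Lemma tevZ a x : tev c (tscale a x) = a *: tev c x.
Proof.
rewrite /tev ev_tnr // /fsum_ev big_map scaler_sumr; apply: eq_bigr => p _.
exact: bilZl.
Qed.
End Ev.

Let tevE (X : lmodType k) (c : U -> V -> X) (bc : bilinear_map c) := (tevD bc, tevZ bc, tev0 bc).
Ltac solve_tev := apply: tensor_ext; let X := fresh in let c := fresh in let bc := fresh in move=> X c
  bc; rewrite ?(tevE bc).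
Fact taddA : associative tadd. Proof. by move=> x y z; solve_tev; rewrite addrA. Qed.
Fact taddC : commutative tadd. Proof. by move=> x y; solve_tev; rewrite addrC. Qed.
Fact tadd0 : left_id tzero tadd. Proof. by move=> x; solve_tev; rewrite add0r. Qed.
Fact taddN : left_inverse tzero topp tadd.
Proof. by move=> x; solve_tev; rewrite scaleN1r addNr. Qed.
HB.instance Definition _ := GRing.isZmodule.Build tensor taddA taddC tadd0 taddN.
Fact tscaleA a b x : tscale a (tscale b x) = tscale (a * b) x.
Proof. by solve_tev; rewrite scalerA. Qed.
Fact tscale1 : left_id 1 tscale. Proof. by move=> x; solve_tev; rewrite scale1r. Qed.
Fact tscaleDr : right_distributive tscale +%R.
Proof. by move=> a x y; change (tscale a (tadd x y) = tadd (tscale a x) (tscale a y)); solve_tev;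
  rewrite scalerDr. Qed.
Fact tscaleDl x : {morph tscale^~ x : a b / a + b}.
Proof. by move=> a b; change (tscale (a + b) x = tadd (tscale a x) (tscale b x)); solve_tev;
  rewrite scalerDl. Qed.
HB.instance Definition _ := GRing.Zmodule_isLmodule.Build k tensor tscaleA tscale1 tscaleDr tscaleDl.

Definition pure (u : U) (v : V) : tensor := tns [:: (u, v)].
Lemma tev_pure (X : lmodType k) (c : U -> V -> X) (bc : bilinear_map c) u v : tev c (pure u v) = c u v.
Proof. by rewrite /tev ev_tnr // /fsum_ev big_seq1. Qed.
Lemma tev_linear (X : lmodType k) (c : U -> V -> X) (bc : bilinear_map c) : linear (tev c).
Proof. by move=> a x y; rewrite -(tevZ bc) -(tevD bc). Qed.
Lemma pure_bilinear : bilinear_map pure.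
Proof.
split=> [u a v v'|v a u u']; apply: tensor_ext => X c bc;
  rewrite (tev_linear bc) !(tev_pure bc).
  by rewrite bilDr // bilZr.
by rewrite bilDl // bilZl.
Qed.
Lemma tensor_sum x : x = \sum_(p <- tnr x) pure p.1 p.2.
Proof.
rewrite -{1}(tnK x); elim: (tnr x) => [|p s IH]; first by rewrite big_nil.
rewrite big_cons -IH; apply: tensor_ext => X c bc.
rewrite [RHS](tevD bc) tev_pure // /tev !ev_tnr // /fsum_ev big_cons.
by [].
Qed.
Lemma tensor_is_tensor : is_tensor pure.
Proof.
split; first exact: pure_bilinear.
move=> X c bc; exists (linear_of (tev_linear bc)); split=> [u v|g gE x].
  exact: tev_pure.
rewrite [in LHS](tensor_sum x) linear_sum /= /tev /fsum_ev.
by apply: eq_bigr => p _; rewrite gE.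
Qed.
Lemma tensor_ind (P : tensor -> Prop) : P 0 -> (forall a x y, P x -> P y -> P (a *: x + y)) ->
  (forall u v, P (pure u v)) -> forall x, P x.
Proof.
move=> P0 PL Pp x; rewrite (tensor_sum x); elim: (tnr x) => [|p s IH]; first by rewrite big_nil.
by rewrite big_cons -[pure _ _]scale1r; apply: PL.
Qed.
End Tensor.

Definition gtensor (k : fieldType) (A B : gcaType k) : Type := tensor A B.

Local Notation tpure := (@pure _ _ _).
Section GTensor.
Context {k : fieldType} (A B : gcaType k).
HB.instance Definition _ := GRing.Lmodule.on (gtensor A B).
Local Notation T := (gtensor A B).
Local Notation pure := (@pure k A B : A -> B -> T).
Lemma gtensor_is_tensor : is_tensor (pure : A -> B -> T).
Proof. exact: (@tensor_is_tensor k A B). Qed.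
Let tT := gtensor_is_tensor.

Let pL a : {linear B -> T} := linear_of (tT.1.1 a).
Let pR b : {linear A -> T} := linear_of (tT.1.2 b).

Lemma gtensor_ind (P : T -> Prop) : P 0 -> (forall a x y, P x -> P y -> P (a *: x + y)) ->
  (forall i j a b, a \in homog i -> b \in homog j -> P (pure a b)) -> forall x, P x.
Proof.
move=> P0 Plin Pp; apply: tensor_ind => // a b.
rewrite (supp_sum a) -[pure _ _]/(pR b _) linear_sum.
elim: (supp a) => [|i s IH]; first by rewrite big_nil.
rewrite big_cons -[pR _ _]scale1r; refine (Plin _ _ _ _ IH).
rewrite -[pR _ _]/(pure (pr i a) b).
rewrite (supp_sum b) -[pure _ _]/(pL (pr i a) _) linear_sum.
elim: (supp b) => [|j t IH']; first by rewrite big_nil.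
rewrite big_cons -[pL _ _]scale1r; refine (Plin _ _ _ _ IH').
exact: (Pp i j _ _ (homog_pr i a) (homog_pr j b)).
Qed.

Lemma gtensor_eq (X : lmodType k) (f g : {linear T -> X}) :
  (forall i j a b, a \in homog i -> b \in homog j -> f (pure a b) = g (pure a b)) -> f =1 g.
Proof.
move=> h; apply: gtensor_ind => [|a x y hx hy|]; first by rewrite !linear0.
  by rewrite !linearP hx hy.
exact: h.
Qed.

Fact gt_pr_bil n : bilinear_map (fun (a : A) (b : B) =>
  hsum (fun i => pR (pr (n - i) b)) a).
Proof.
split=> [a c x y|b c x y]; last by rewrite linearP.
rewrite /hsum scaler_sumr -big_split; apply: eq_bigr => i _.
by rewrite -[pR (pr _ (_ + _)) _]/(pL _ _) !linearP.
Qed.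
Definition gt_pr n : T -> T := tensor_lift tT (gt_pr_bil n).
Lemma gt_prE n i j a b : a \in homog i -> b \in homog j ->
  gt_pr n (pure a b) = if n == i + j then pure a b else 0.
Proof.
move=> ai bj; rewrite /gt_pr tensor_liftE (hsum_homog _ ai) /= (pr_homog _ bj).
rewrite -[X in if X then b else 0](inj_eq (addIr i)) subrK [j + i]addrC.
by case: eqP => // _; exact: (linear0 (pL a)).
Qed.
HB.instance Definition _ n := GRing.Linear.on (gt_pr n).
Fact gt_pr_pr n p x : gt_pr n (gt_pr p x) = if n == p then gt_pr p x else 0.
Proof.
case: (eqVneq n p) => [->|np]; move: x.
  apply: (gtensor_eq (f := gt_pr p \o gt_pr p) (g := gt_pr p)) => i j a b ai bj /=.
  rewrite (gt_prE p ai bj); case: (eqVneq p (i + j)) => [e|_]; last by rewrite linear0.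
  by rewrite (gt_prE _ ai bj) e eqxx.
apply: (gtensor_eq (f := gt_pr n \o gt_pr p) (g := \0)) => i j a b ai bj /=.
rewrite (gt_prE p ai bj); case: (eqVneq p (i + j)) => [e|_]; last by rewrite linear0.
by rewrite (gt_prE _ ai bj) -e (negbTE np).
Qed.
Fact gt_pr_sum x : exists2 s : seq int, uniq s & x = \sum_(i <- s) gt_pr i x.
Proof.
have ext s u y : uniq s -> uniq u -> {subset s <= u} -> y = \sum_(i <- s) gt_pr i y ->
    y = \sum_(i <- u) gt_pr i y.
  move=> us uu su ey; rewrite [LHS]ey [RHS](bigID (mem s)) /= [X in _ = _ + X]big1 => [|i si].
    rewrite addr0 -[RHS]big_filter; apply/perm_big/uniq_perm; rewrite ?filter_uniq // => i.
    by rewrite mem_filter; case: (boolP (i \in s)) => // /su ->.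
  rewrite ey linear_sum big_seq big1 // => j js; rewrite [LHS]gt_pr_pr; case: eqP => // ij.
  by rewrite ij js in si.
move: x; apply: gtensor_ind.
- by exists [::] => //; rewrite big_nil.
- move=> a x y [s us ex] [t ut ey]; have um := undup_uniq (s ++ t).
  exists (undup (s ++ t)) => //.
  rewrite {1}(ext _ _ _ us um _ ex) => [|i]; last by rewrite mem_undup mem_cat => ->.
  rewrite {1}(ext _ _ _ ut um _ ey) => [|i]; last by rewrite mem_undup mem_cat orbC => ->.
  by rewrite scaler_sumr -big_split; apply: eq_bigr => i _; rewrite linearP.
- by move=> i j a b ai bj; exists [:: i + j] => //; rewrite big_seq1 (gt_prE _ ai bj) eqxx.
Qed.
HB.instance Definition _ := isGraded.Build k T gt_pr_pr gt_pr_sum.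
Lemma homog_pure i j a b : a \in homog i -> b \in homog j -> pure a b \in homog (i + j).
Proof. by move=> ai bj; apply/homogP; rewrite [LHS](gt_prE _ ai bj) eqxx. Qed.

Definition sgp (V : gradedType k) (i : int) : {linear V -> V} := hsum (fun j => sg (i * j) \*: idfun).
Lemma sgp_homog (V : gradedType k) i j (x : V) : x \in homog j -> sgp V i x = sg (i * j) *: x.
Proof. by move=> xj; rewrite /sgp /= (hsum_homog _ xj). Qed.
(** The exchange of factors with the Koszul sign (-1)^{|a||b|}. *)
Definition swp (b : B) (a : A) : T := hsum (fun i => pL (sgp A i a)) b.
Lemma swp_bil : bilinear_map swp.
Proof.
split=> [b c x y|a c x y]; last by rewrite /swp linearP.
rewrite /swp /hsum scaler_sumr -big_split; apply: eq_bigr => i _.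
by rewrite -![pL _ _]/(pR _ _) !linearP.
Qed.
Lemma swpE i j b a : b \in homog i -> a \in homog j -> swp b a = sg (i * j) *: pure a b.
Proof.
move=> bi aj; rewrite /swp (hsum_homog _ bi) (sgp_homog _ aj).
by rewrite -[LHS]/(pR b _) linearZ.
Qed.

Let lm_bil a : bilinear_map (fun (x : A) (y : B) => pure (a * x) y).
Proof.
split=> [x c y y'|y c x x']; first by rewrite -[LHS]/(pL _ _) linearP.
by rewrite mulrDr -scalerAr -[LHS]/(pR _ _) linearP.
Qed.
Let rm_bil b : bilinear_map (fun (x : A) (y : B) => pure x (y * b)).
Proof.
split=> [x c y y'|y c x x']; last by rewrite -[LHS]/(pR _ _) linearP.
by rewrite mulrDl -scalerAl -[LHS]/(pL _ _) linearP.
Qed.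
Let lm a : {linear T -> T} := tensor_lift tT (lm_bil a).
Let rm b : {linear T -> T} := tensor_lift tT (rm_bil b).
Let lmE a x y : lm a (pure x y) = pure (a * x) y. Proof. exact: tensor_liftE. Qed.
Let rmE b x y : rm b (pure x y) = pure x (y * b). Proof. exact: tensor_liftE. Qed.
Let lmL c a a' x : lm (c *: a + a') x = c *: lm a x + lm a' x.
Proof.
move: x; apply: (tensor_eq tT (g := lm (c *: a + a')) (g' := c \*: lm a \+ lm a')) => u v /=.
by rewrite !lmE mulrDl -scalerAl -[LHS]/(pR _ _) linearP.
Qed.
Let rmL c a a' x : rm (c *: a + a') x = c *: rm a x + rm a' x.
Proof.
move: x; apply: (tensor_eq tT (g := rm (c *: a + a')) (g' := c \*: rm a \+ rm a')) => u v /=.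
by rewrite !rmE mulrDr -scalerAr -[LHS]/(pL _ _) linearP.
Qed.

Let mul1_bil a b : bilinear_map (fun (a' : A) (b' : B) => lm a (rm b' (swp b a'))).
Proof.
split=> [a' c x y|b' c x y]; first by rewrite rmL linearP.
by rewrite (swp_bil.1 b) !linearP.
Qed.
Let mul1 a b : {linear T -> T} := tensor_lift tT (mul1_bil a b).
Let mul1E a b a' b' : mul1 a b (pure a' b') = lm a (rm b' (swp b a')).
Proof. exact: tensor_liftE. Qed.
Let mul2_bil t : bilinear_map (fun (a : A) (b : B) => mul1 a b t).
Proof.
split=> [a c x y|b c x y]; move: t.
  apply: (tensor_eq tT (g := mul1 a (c *: x + y)) (g' := c \*: mul1 a x \+ mul1 a y)) => u v /=.
  by rewrite !mul1E (swp_bil.2 u) !linearP.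
apply: (tensor_eq tT (g := mul1 (c *: x + y) b) (g' := c \*: mul1 x b \+ mul1 y b)) => u v /=.
by rewrite !mul1E lmL.
Qed.
Definition gt_mul (s t : T) : T := tensor_lift tT (mul2_bil t) s.
Fact gt_mulL t : linear (gt_mul^~ t).
Proof. by move=> c x y; rewrite /gt_mul linearP. Qed.
Let gt_mulE0 a b t : gt_mul (pure a b) t = mul1 a b t.
Proof. by rewrite /gt_mul tensor_liftE. Qed.
Fact gt_mulR s : linear (gt_mul s).
Proof.
move=> c x y; move: s.
apply: (tensor_eq tT (g := linear_of (gt_mulL (c *: x + y)))
  (g' := c \*: linear_of (gt_mulL x) \+ linear_of (gt_mulL y))) => u v /=.
by rewrite !gt_mulE0 linearP.
Qed.
Lemma gt_mul_pure i j a b a' b' : b \in homog i -> a' \in homog j ->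
  gt_mul (pure a b) (pure a' b') = sg (i * j) *: pure (a * a') (b * b').
Proof.
move=> bi aj; rewrite gt_mulE0 mul1E (swpE bi aj) !linearZ /=.
by rewrite rmE lmE.
Qed.

Definition gt_one : T := pure 1 1.
Fact gt_mulA : associative gt_mul.
Proof.
move=> x y z; move: x.
apply: (gtensor_eq (f := linear_of (gt_mulL (gt_mul y z)))
  (g := linear_of (gt_mulL z) \o linear_of (gt_mulL y))) => i j a b ai bj /=.
move: y; apply: (gtensor_eq (f := linear_of (gt_mulR (pure a b)) \o linear_of (gt_mulL z))
  (g := linear_of (gt_mulL z) \o linear_of (gt_mulR (pure a b)))) => i' j' a' b' ai' bj' /=.
move: z; apply: (gtensor_eq (f := linear_of (gt_mulR (pure a b)) \o linear_of (gt_mulR (pure a' b')))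
  (g := linear_of (gt_mulR (gt_mul (pure a b) (pure a' b'))))) => i'' j'' a'' b'' ai'' bj'' /=.
have Z1 c x y : gt_mul (c *: x) y = c *: gt_mul x y := linearZ_LR (linear_of (gt_mulL y)) c x.
have Z2 c x y : gt_mul y (c *: x) = c *: gt_mul y x := linearZ_LR (linear_of (gt_mulR y)) c x.
rewrite (gt_mul_pure _ _ bj' ai'') Z2 (gt_mul_pure _ _ bj (homogM _ _ _ _ ai' ai'')).
rewrite (gt_mul_pure _ _ bj ai') Z1 (gt_mul_pure _ _ (homogM _ _ _ _ bj bj') ai'').
by rewrite !scalerA !mulrA; congr (_ *: _); rewrite mulrDr mulrDl !sgD mulrC mulrA.
Qed.
Fact gt_mul1 : left_id gt_one gt_mul.
Proof.
apply: (gtensor_eq (f := linear_of (gt_mulR gt_one)) (g := idfun)) => i j a b ai bj /=.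
by rewrite (gt_mul_pure _ _ (homog1 (s := B)) ai) !mul1r mul0r sg0 scale1r.
Qed.
Fact gt_mulr1 : right_id gt_one gt_mul.
Proof.
apply: (gtensor_eq (f := linear_of (gt_mulL gt_one)) (g := idfun)) => i j a b ai bj /=.
by rewrite (gt_mul_pure _ _ bj (homog1 (s := A))) !mulr1 mulr0 sg0 scale1r.
Qed.
Fact gt_mulDl : left_distributive gt_mul +%R.
Proof. by move=> x y z; exact: (linearD (linear_of (gt_mulL z))). Qed.
Fact gt_mulDr : right_distributive gt_mul +%R.
Proof. by move=> x y z; exact: (linearD (linear_of (gt_mulR x))). Qed.

(** The product of two such functionals shows that 1 (x) 1 is not 0. *)
Lemma unit_functional (V : algType k) : exists f : {linear V -> k^o}, f 1 = 1.
Proof.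
have [|f fE] := @linear_choice k V k^o (fun x c => x = (c : k) *: 1).
  split=> [|a u v u' v' -> ->]; first by rewrite scale0r.
  by rewrite scalerDl scalerA.
exists f; have := fE 1 1; rewrite scale1r => /(_ erefl) e.
have /eqP : ((f 1 : k) - 1) *: (1 : V) = 0 by rewrite scalerBl -e scale1r subrr.
by rewrite scaler_eq0 oner_eq0 orbF subr_eq0 => /eqP.
Qed.
Fact gt_one_neq0 : gt_one != 0.
Proof.
have [f f1] := unit_functional A; have [g g1] := unit_functional B.
have bc : bilinear_map (fun a b => (f a : k) * g b : k^o).
  split=> [a c x y|b c x y]; first by rewrite linearP mulrDr; congr (_ + _); exact: mulrCA.
  by rewrite linearP mulrDl; congr (_ + _); exact: esym (mulrA _ _ _).
apply/eqP => /(congr1 (tensor_lift tT bc)); rewrite linear0 /gt_one tensor_liftE f1 g1 mulr1.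
by move/eqP; rewrite oner_eq0.
Qed.
HB.instance Definition _ := GRing.Zmodule_isNzRing.Build T
  gt_mulA gt_mul1 gt_mulr1 gt_mulDl gt_mulDr gt_one_neq0.
Fact gt_scaleAl (a : k) (x y : T) : a *: (x * y) = (a *: x) * y.
Proof. by apply/esym; exact: (linearZ_LR (linear_of (gt_mulL y))). Qed.
HB.instance Definition _ := GRing.Lmodule_isLalgebra.Build k T gt_scaleAl.
Fact gt_scaleAr (a : k) (x y : T) : a *: (x * y) = x * (a *: y).
Proof. by apply/esym; exact: (linearZ_LR (linear_of (gt_mulR x))). Qed.
HB.instance Definition _ := GRing.Lalgebra_isAlgebra.Build k T gt_scaleAr.
Lemma mul_pure i j a b a' b' : b \in homog i -> a' \in homog j ->
  (pure a b * pure a' b' : T) = sg (i * j) *: pure (a * a') (b * b').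
Proof. exact: gt_mul_pure. Qed.

Lemma homog_gtensor n (P : T -> Prop) : P 0 -> (forall a x y, P x -> P y -> P (a *: x + y)) ->
  (forall i j a b, a \in homog i -> b \in homog j -> i + j = n -> P (pure a b)) ->
  forall x, x \in homog n -> P x.
Proof.
move=> P0 Plin Pp x /homogP <-; move: x; apply: gtensor_ind.
- by rewrite linear0.
- by move=> a x y hx hy; rewrite linearP; apply: Plin.
- move=> i j a b ai bj; rewrite [pr n _](gt_prE _ ai bj); case: eqP => // e.
  exact: Pp bj (esym e).
Qed.

Fact gt_lt0 (i : int) (x : T) : i < 0 -> pr i x = 0.
Proof.
move=> i0; apply: (homog_gtensor (P := fun x => x = 0)) (homog_pr i x) => //.
  by move=> a u v -> ->; rewrite scaler0 addr0.
move=> p q a b ap bq e; have [p0|p0] := ltP p 0.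
  by rewrite (pr_nneg_homog (@pr_lt0 _ A) p0 ap) -[pure _ _]/(pR b 0) linear0.
have [q0|q0] := ltP q 0.
  by rewrite (pr_nneg_homog (@pr_lt0 _ B) q0 bq) -[pure _ _]/(pL a 0) linear0.
by move: i0; rewrite -e ltNge addr_ge0.
Qed.
Fact gt_homog1 : (1 : T) \in homog 0.
Proof. by rewrite -[0]addr0; apply: homog_pure; apply: homog1. Qed.
Fact gt_homogM (i j : int) (x y : T) : x \in homog i -> y \in homog j -> x * y \in homog (i + j).
Proof.
move=> xi yj; apply: (homog_gtensor (P := fun x => x * y \in homog (i + j))) xi.
- by rewrite mul0r homog0.
- by move=> a u v hu hv; rewrite mulrDl -scalerAl homogL.
move=> p q a b ap bq e.
apply: (homog_gtensor (P := fun y => pure a b * y \in homog (i + j))) yj.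
- by rewrite mulr0 homog0.
- by move=> c u v hu hv; rewrite mulrDr -scalerAr homogL.
move=> p' q' a' b' ap' bq' e'.
rewrite (mul_pure _ _ bq ap'); apply: homogZ.
by rewrite -e -e' addrACA; apply: homog_pure; apply: homogM.
Qed.
Fact gt_homogC (i j : int) (x y : T) : x \in homog i -> y \in homog j ->
  x * y = ((-1) ^ (i * j) : k) *: (y * x).
Proof.
move=> xi yj; apply: (homog_gtensor (P := fun x => x * y = ((-1) ^ (i * j) : k) *: (y * x))) xi.
- by rewrite mul0r mulr0 scaler0.
- move=> a u v hu hv; rewrite mulrDl -scalerAl hu hv mulrDr -scalerAr scalerDr.
  by rewrite !scalerA [a * _]mulrC.
move=> p q a b ap bq e.
apply: (homog_gtensor (P := fun y => pure a b * y = ((-1) ^ (i * j) : k) *: (y * pure a b))) yj.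
- by rewrite mul0r mulr0 scaler0.
- move=> c u v hu hv; rewrite mulrDr -scalerAr hu hv mulrDl -scalerAl scalerDr.
  by rewrite !scalerA [c * _]mulrC.
move=> p' q' a' b' ap' bq' e'.
rewrite (mul_pure _ _ bq ap') (mul_pure _ _ bq' ap) (gca_comm ap ap') (gca_comm bq bq').
rewrite -[X in _ *: X = _]/(pR _ _) linearZ /= -[pure _ (_ *: _)]/(pL _ _) linearZ /= !scalerA.
rewrite -[tpure (a' * a) (sg _ *: _)]/(pL (a' * a) (sg (q * q') *: (b' * b))) linearZ /= scalerA.
congr (_ *: _); rewrite -/(sg (i * j)) -e -e' mulrDl !mulrDr !sgD [q' * p]mulrC.
by rewrite [RHS]mulrAC -[X in _ = X * _]mulrA sgK mulr1 mulrA.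
Qed.
HB.instance Definition _ := isGCA.Build k T gt_lt0 gt_homog1 gt_homogM gt_homogC.
End GTensor.

Section GcaMorLemmas.
Context {k : fieldType} {A B : gcaType k} (f : gcamor A B).
Lemma gmorD x y : f (x + y) = f x + f y. Proof. exact: linearD. Qed.
Lemma gmorB x y : f (x - y) = f x - f y. Proof. exact: linearB. Qed.
Lemma gmorN x : f (- x) = - f x. Proof. exact: linearN. Qed.
Lemma gmorZ c x : f (c *: x) = c *: f x. Proof. exact: linearZ. Qed.
Lemma gmorL c x y : f (c *: x + y) = c *: f x + f y. Proof. exact: linearP. Qed.
Lemma gmor0 : f 0 = 0. Proof. exact: linear0. Qed.
Lemma gmor1 : f 1 = 1. Proof. exact: rmorph1. Qed.
Lemma gmorM x y : f (x * y) = f x * f y. Proof. exact: rmorphM. Qed.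
Lemma gmor_sgn x : f (sgn x) = sgn (f x).
Proof. by apply: (sgn_mor (f := f)) => i y; apply: gcamor_homog. Qed.
End GcaMorLemmas.

Section Coproduct.
Context {k : fieldType} (A B : gcaType k).
Local Notation T := (gtensor A B).
Local Notation pure := (@pure k A B : A -> B -> T).
Let tT := gtensor_is_tensor A B.

Lemma pureDl a a' b : pure (a + a') b = pure a b + pure a' b.
Proof. exact: (linearD (linear_of (tT.1.2 b))). Qed.
Lemma pureDr a b b' : pure a (b + b') = pure a b + pure a b'.
Proof. exact: (linearD (linear_of (tT.1.1 a))). Qed.
Lemma pureZl c a b : pure (c *: a) b = c *: pure a b.
Proof. exact: (linearZ_LR (linear_of (tT.1.2 b))). Qed.
Lemma pureZr c a b : pure a (c *: b) = c *: pure a b.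
Proof. exact: (linearZ_LR (linear_of (tT.1.1 a))). Qed.

Lemma pure0l b : pure 0 b = 0.
Proof. exact: (linear0 (linear_of (tT.1.2 b))). Qed.
Lemma pure0r a : pure a 0 = 0.
Proof. exact: (linear0 (linear_of (tT.1.1 a))). Qed.

Lemma mul_pure1 (a a' : A) (b : B) : pure a 1 * pure a' b = pure (a * a') b.
Proof.
move: a'; apply: homog_ind => [|c x y hx hy|i a' ai].
- by rewrite mulr0 !pure0l mulr0.
- by rewrite mulrDr -scalerAr !pureDl !pureZl mulrDr -scalerAr hx hy.
- by rewrite (mul_pure _ _ (homog1 (s := B)) ai) mul0r sg0 scale1r mul1r.
Qed.
Lemma mul_pure2 (a : A) (b b' : B) : pure a b * pure 1 b' = pure a (b * b').
Proof.
move: b; apply: homog_ind => [|c x y hx hy|i b bi].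
- by rewrite mul0r !pure0r mul0r.
- by rewrite mulrDl -scalerAl !pureDr !pureZr mulrDl -scalerAl hx hy.
- by rewrite (mul_pure _ _ bi (homog1 (s := A))) mulr0 sg0 scale1r mulr1.
Qed.
Lemma pureE a b : pure a b = pure a 1 * pure 1 b.
Proof. by rewrite mul_pure1 mulr1. Qed.

Fact inl_linear : linear (fun a => pure a 1). Proof. exact: tT.1.2. Qed.
Fact inl_monoid : monoid_morphism (fun a => pure a 1).
Proof. by split=> // a a'; rewrite mul_pure1. Qed.
Fact inl_homog i a : a \in homog i -> pure a 1 \in homog i.
Proof. by move=> ai; rewrite -[i]addr0; apply: homog_pure ai (homog1 (s := B)). Qed.
Definition in_l : gcamor A T := gcamor_of inl_linear inl_monoid inl_homog.
Fact inr_linear : linear (fun b => pure 1 b). Proof. exact: tT.1.1. Qed.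
Fact inr_monoid : monoid_morphism (fun b => pure 1 b).
Proof. by split=> // a a'; rewrite mul_pure2. Qed.
Fact inr_homog i b : b \in homog i -> pure 1 b \in homog i.
Proof. by move=> ai; rewrite -[i]add0r; apply: homog_pure ai; apply: (homog1 (s := A)). Qed.
Definition in_r : gcamor B T := gcamor_of inr_linear inr_monoid inr_homog.
Arguments in_l : simpl never.
Arguments in_r : simpl never.
Lemma in_lE a : in_l a = pure a 1. Proof. by []. Qed.
Lemma in_rE b : in_r b = pure 1 b. Proof. by []. Qed.
Lemma in_lrE a b : in_l a * in_r b = pure a b. Proof. by rewrite [RHS]pureE. Qed.

Section Copair.
Context {X : gcaType k} (f : gcamor A X) (g : gcamor B X).
Fact copair_bil : bilinear_map (fun a b => f a * g b).
Proof.
split=> [a c x y|b c x y]; first by rewrite linearP mulrDr -scalerAr.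
by rewrite linearP mulrDl -scalerAl.
Qed.
Definition copair_fun : {linear T -> X} := tensor_lift tT copair_bil.
Lemma copair_pure a b : copair_fun (pure a b) = f a * g b.
Proof. exact: tensor_liftE. Qed.
Fact copair_monoid : monoid_morphism copair_fun.
Proof.
split; first by rewrite -[1]/(pure 1 1) copair_pure !rmorph1 mulr1.
move=> x y; move: x; apply: gtensor_ind.
- by rewrite mul0r !linear0 mul0r.
- by move=> a x x' hx hx'; rewrite mulrDl -scalerAl !linearP mulrDl -scalerAl hx hx'.
move=> i j a b ai bj; move: y; apply: gtensor_ind.
- by rewrite mulr0 !linear0 mulr0.
- by move=> c x x' hx hx'; rewrite mulrDr -scalerAr !linearP mulrDr -scalerAr hx hx'.
move=> i' j' a' b' ai' bj'.
rewrite (mul_pure _ _ bj ai') linearZ /= !copair_pure !rmorphM -!mulrA.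
rewrite [g b * (f a' * _)]mulrA (gca_comm (gcamor_homog g bj) (gcamor_homog f ai')).
by rewrite -!scalerAl -!scalerAr !mulrA.
Qed.
Fact copair_homog i x : x \in homog i -> copair_fun x \in homog i.
Proof.
move=> xi; apply: (homog_gtensor (P := fun x => copair_fun x \in homog i)) xi.
  by rewrite linear0 homog0.
  by move=> a u v hu hv; rewrite linearP; apply: homogL.
by move=> p q a b ap bq <-; rewrite copair_pure homogM // gcamor_homog.
Qed.
Definition copair : gcamor T X :=
  @GcaMor k T X (HB.pack (copair_fun : T -> X)
    (GRing.isLinear.Build k T X _ copair_fun (linearP copair_fun))
    (GRing.isMonoidMorphism.Build T X copair_fun copair_monoid)) copair_homog.
Arguments copair : simpl never.
Lemma copairE a b : copair (pure a b) = f a * g b. Proof. exact: copair_pure. Qed.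
Lemma copair_l a : copair (in_l a) = f a.
Proof. by rewrite in_lE copairE rmorph1 mulr1. Qed.
Lemma copair_r b : copair (in_r b) = g b.
Proof. by rewrite in_rE copairE rmorph1 mul1r. Qed.
End Copair.

Lemma copair_eq (X : gcaType k) (h h' : gcamor T X) :
  (forall a, h (in_l a) = h' (in_l a)) -> (forall b, h (in_r b) = h' (in_r b)) -> h =1 h'.
Proof.
move=> e1 e2; apply: (tensor_eq tT (g := h) (g' := h')) => a b.
by rewrite -in_lrE [LHS]rmorphM [RHS]rmorphM; congr (_ * _); [apply: e1|apply: e2].
Qed.

Section CoprodFree.
Context {U V : gradedType k} {gA : grmor U A} {gB : grmor V B}.
Hypothesis fA : free_on gA.
Hypothesis fB : free_on gB.
Definition cgen_fun (p : U * V) : T := in_l (gA p.1) + in_r (gB p.2).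
Fact cgen_linear : linear cgen_fun.
Proof.
move=> a x y; rewrite /cgen_fun.
have -> : gA (a *: x + y).1 = a *: gA x.1 + gA y.1 by rewrite -linearP.
have -> : gB (a *: x + y).2 = a *: gB x.2 + gB y.2 by rewrite -linearP.
by rewrite (linearP in_l) (linearP in_r) scalerDr addrACA.
Qed.
Fact cgen_homog i p : p \in homog i -> linear_of cgen_linear p \in homog i.
Proof.
move=> /homogP e; rewrite -e /=; apply: homogD; apply: gcamor_homog; apply: grmor_homog; apply: homog_pr.
Qed.
Definition cgen : grmor (U * V)%type T := GrMor cgen_homog.
Lemma cgenE u v : cgen (u, v) = in_l (gA u) + in_r (gB v). Proof. by []. Qed.
Lemma cgen_l u : cgen (u, 0) = in_l (gA u). Proof. by rewrite cgenE linear0 (linear0 in_r) addr0. Qed.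
Lemma cgen_r v : cgen (0, v) = in_r (gB v). Proof. by rewrite cgenE linear0 (linear0 in_l) add0r. Qed.
Lemma cgen_free : free_on cgen.
Proof.
move=> X f.
have l1 : linear (fun u : U => f (u, 0 : V)).
  by move=> a x y; rewrite -linearP; congr (f _); rewrite -[RHS]/(_, _) /= scaler0 addr0.
have l2 : linear (fun v : V => f (0 : U, v)).
  by move=> a x y; rewrite -linearP; congr (f _); rewrite -[RHS]/(_, _) /= scaler0 addr0.
have h1 i u : u \in homog i -> linear_of l1 u \in homog i.
  move=> /homogP e; apply: grmor_homog; apply/homogP; rewrite /pr /= /prod_pr /= e.
  by rewrite linear0.
have h2 i u : u \in homog i -> linear_of l2 u \in homog i.
  move=> /homogP e; apply: grmor_homog; apply/homogP; rewrite /pr /= /prod_pr /= e.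
  by rewrite linear0.
have [g1 [g1E g1U]] := fA (GrMor h1).
have [g2 [g2E g2U]] := fB (GrMor h2).
exists (copair g1 g2); split=> [[u v]|g gE].
  rewrite cgenE gmorD copair_l copair_r g1E g2E -[RHS]/(f (u, v)) /= -linearD.
  by congr (f _); rewrite -[LHS]/(_, _) /= addr0 add0r.
apply: (copair_eq (h := g) (h' := copair g1 g2)) => [a|b].
  rewrite [RHS]copair_l; apply: (g1U (gca_comp g in_l)) => u.
  by rewrite -[LHS]/(g (in_l (gA u))) -cgen_l gE.
rewrite [RHS]copair_r; apply: (g2U (gca_comp g in_r)) => u.
by rewrite -[LHS]/(g (in_r (gB u))) -cgen_r gE.
Qed.
End CoprodFree.
End Coproduct.

(** * Eigenspaces and words *)

Section Eigen.
Context {k : fieldType} (char0 : [pchar k] =i pred0) {V : lmodType k} (L : {linear V -> V}).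
Definition eig (l : nat) (x : V) : Prop := L x = l%:R *: x.

Lemma eig_lin l a x y : eig l x -> eig l y -> eig l (a *: x + y).
Proof. by rewrite /eig linearP => -> ->; rewrite scalerDr !scalerA mulrC. Qed.
Lemma eig0 l : eig l 0. Proof. by rewrite /eig linear0 scaler0. Qed.
Lemma eigZ l a x : eig l x -> eig l (a *: x).
Proof. by move=> h; have := eig_lin a h (eig0 l); rewrite addr0. Qed.

Lemma natk_eq0 n : (n%:R == 0 :> k) = (n == 0%N).
Proof. exact: ((pcharf0P k).1 char0 n). Qed.

Lemma natkB l n : (l < n)%N -> (l%:R - n%:R : k) != 0.
Proof.
move=> ln; rewrite -opprB oppr_eq0 -natrB; last exact: ltnW.
by rewrite natk_eq0 subn_eq0 -ltnNge.
Qed.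

(** Subtracting n times the relation from its image under L removes the last term; the
    eigenvalues are distinct in characteristic 0. *)
Lemma eig_indep n (x : nat -> V) : (forall l, (l < n)%N -> eig l (x l)) ->
  \sum_(l < n) x l = 0 -> forall l, (l < n)%N -> x l = 0.
Proof.
elim: n x => [//|n IH] x xe s0.
have h l : (l < n)%N -> x l = 0.
  move=> ln; have e : (l%:R - n%:R) *: x l = 0.
    apply: (IH (fun l => (l%:R - n%:R) *: x l) _ _ l ln).
      by move=> m mn; apply/eigZ/xe/ltnW.
    have := congr1 (fun y => L y - n%:R *: y) s0; rewrite /= linear0 scaler0 subr0 big_ord_recr /=.
    rewrite linearD scalerDr opprD addrACA (xe n (ltnSn n)) subrr addr0 linear_sum scaler_sumr.
    rewrite -sumrB => h; rewrite -[RHS]h; apply: eq_bigr => i _.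
    by rewrite (xe i (ltnW (ltn_ord i))) -scalerBl.
  by apply/eqP; rewrite -[_ == 0]orFb -(negbTE (natkB ln)) -scaler_eq0 e.
move=> l; rewrite ltnS leq_eqVlt => /orP[/eqP ->|/h //].
by move: s0; rewrite big_ord_recr /= big1 ?add0r // => i _; apply: h.
Qed.

(** Since the eigenspaces are independent, linear maps given on each of them fit together. *)
Lemma eig_lift (X : lmodType k) (c : nat -> {linear V -> X}) :
  exists H : {linear V -> X}, forall l x, eig l x -> H x = c l x.
Proof.
pose R x y := exists n (z : nat -> V), [/\ forall l, eig l (z l),
  x = \sum_(l < n) z l & y = \sum_(l < n) c l (z l)].
have pad n m (z : nat -> V) (X' : lmodType k) (g : nat -> {linear V -> X'}) : (n <= m)%N ->
    \sum_(l < m) g l (if (l < n)%N then z l else 0) = \sum_(l < n) g l (z l).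
  move=> nm; rewrite (big_ord_widen m (fun l => g l (z l)) nm) [RHS]big_mkcond.
  by apply: eq_bigr => i _; case: ifP => // _; rewrite linear0.
have [|H HE] := @linear_choice k V X R.
  split; first by exists 0%N, (fun=> 0); rewrite !big_ord0; split=> // l; apply: eig0.
  move=> a u v u' v' [n [z [ze -> ->]]] [m [z' [ze' -> ->]]].
  pose p (N : nat) (f : nat -> V) l := if (l < N)%N then f l else 0.
  have pe N f : (forall l, eig l (f l)) -> forall l, eig l (p N f l).
    by move=> fe l; rewrite /p; case: ifP => // _; apply: eig0.
  exists (maxn n m), (fun l => a *: p n z l + p m z' l); split.
  - by move=> l; apply: eig_lin; apply: pe.
  - rewrite big_split -scaler_sumr /=; congr (_ *: _ + _).
      by rewrite (pad n _ z V (fun=> idfun)) // leq_maxl.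
    by rewrite (pad m _ z' V (fun=> idfun)) // leq_maxr.
  - rewrite (eq_bigr (fun l : 'I_(maxn n m) => a *: c l (p n z l) + c l (p m z' l))); last first.
      by move=> i _; rewrite linearP.
    rewrite big_split -scaler_sumr /=; congr (_ *: _ + _).
      by rewrite (pad n _ z X c) // leq_maxl.
    by rewrite (pad m _ z' X c) // leq_maxr.
exists H => l x xl.
have Rx : R x (c l x).
  exists l.+1, (fun i => if i == l then x else 0); split.
  - by move=> i; case: eqP => [->|_] //; apply: eig0.
  - rewrite big_ord_recr /= eqxx big1 ?add0r // => i _.
    by rewrite (ltn_eqF (ltn_ord i)).
  - rewrite big_ord_recr /= eqxx big1 ?add0r // => i _.
    by rewrite (ltn_eqF (ltn_ord i)) linear0.
have [n [z [ze xE HxE]]] := HE _ _ Rx.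
pose z' i := (if (i < n)%N then z i else 0) - (if i == l then x else 0).
have z'0 : forall i, (i < maxn n l.+1)%N -> z' i = 0.
  apply: eig_indep => [i _|].
    rewrite /z' addrC -scaleN1r; apply: eig_lin; first by case: eqP => [->|_] //; apply: eig0.
    by case: ifP => // _; apply: eig0.
  rewrite sumrB (pad n _ z V (fun=> idfun)) ?leq_maxl //= -xE.
  have lm : (l < maxn n l.+1)%N by rewrite leq_maxr.
  by rewrite (bigD1 (Ordinal lm)) //= eqxx big1 ?addr0 ?subrr // => i; rewrite -val_eqE /= => /negbTE ->.
rewrite HxE -(pad n (maxn n l.+1) z X c) ?leq_maxl //.
have lm : (l < maxn n l.+1)%N by rewrite leq_maxr.
rewrite (bigD1 (Ordinal lm)) //= big1 ?addr0 => [|i].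
  by have /eqP := z'0 l lm; rewrite /z' eqxx subr_eq0 => /eqP ->.
rewrite -val_eqE /= => il.
have /eqP := z'0 i (ltn_ord i); rewrite /z' (negbTE il) subr0 => /eqP ->.
by rewrite linear0.
Qed.
End Eigen.

Section WordsInd.
Context {k : fieldType} {W : gradedType k} (L : freeCDGA W).

Lemma words_ind (E : {pred W}) (P : L -> Prop) : P 0 -> (forall a x y, P x -> P y -> P (a *: x + y)) ->
  P 1 -> (forall v x, v \in E -> P x -> P (gen v * x)) ->
  forall x, x \in words_ge L E 0 -> P x.
Proof.
move=> P0 Pl P1 PM; apply: span_ind => // _ [s [sE _ ->]].
elim: s sE => [|v s IH] sE; first by rewrite big_nil.
rewrite big_cons; apply: PM; first by apply: sE; rewrite mem_head.
by apply: IH => w ws; apply: sE; rewrite inE ws orbT.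
Qed.

Lemma free_ind (P : L -> Prop) : P 0 -> (forall a x y, P x -> P y -> P (a *: x + y)) ->
  P 1 -> (forall v x, P x -> P (gen v * x)) -> forall x, P x.
Proof.
move=> P0 Pl P1 PM x; apply: (words_ind P0 Pl P1 _ (words_full x)) => v y _.
exact: PM.
Qed.

Lemma words_sub (E E' : {pred W}) q : {subset E <= E'} -> {subset words_ge L E q <= words_ge L E' q}.
Proof.
move=> EE; apply: span_min => _ [s [sE sq ->]]; apply: sub_span; exists s.
by split=> // v /sE /EE.
Qed.

Lemma words_geS_ind (E : {pred W}) q (P : L -> Prop) : P 0 ->
  (forall a x y, P x -> P y -> P (a *: x + y)) ->
  (forall v x, v \in E -> x \in words_ge L E q -> P (gen v * x)) ->
  forall x, x \in words_ge L E q.+1 -> P x.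
Proof.
move=> P0 Pl PM; apply: span_ind => // _ [[|v s] [sE sq ->]] //.
rewrite big_cons; apply: PM; first by apply: sE; rewrite mem_head.
apply: sub_span; exists s; split=> // w ws; apply: sE; by rewrite inE ws orbT.
Qed.

Lemma words_decomp (E : grsub W) x : x \in words_ge L (E : submodClosed W) 0 ->
  exists (c : k) v u, [/\ v \in (E : submodClosed W), u \in words_ge L (E : submodClosed W) 2 &
    x = c *: 1 + gen v + u].
Proof.
move: x; apply: span_ind.
- by exists 0, 0, 0; rewrite !rpred0 scale0r linear0 !addr0.
- move=> a x y [c [v [u [vE uE ->]]]] [c' [v' [u' [vE' uE' ->]]]].
  exists (a * c + c'), (a *: v + v'), (a *: u + u'); rewrite !rpredD ?rpredZ //; split=> //.
  have g (p q r p' q' r' : L) : p + p' + (q + q') + (r + r') = p + q + r + (p' + q' + r').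
    by rewrite [RHS]addrACA [in RHS](addrACA p).
  by rewrite (linearP gen) scalerDl !scalerDr scalerA; exact: esym (g _ _ _ _ _ _).
- move=> _ [[|v [|w s]] [sE _ ->]].
  + by exists 1, 0, 0; rewrite !rpred0 big_nil scale1r linear0 !addr0.
  + exists 0, v, 0; rewrite !rpred0 big_seq1 scale0r add0r addr0; split=> //.
    by apply: sE; rewrite mem_head.
  + exists 0, 0, (\prod_(i <- v :: w :: s) gen i); rewrite !rpred0 scale0r linear0 !add0r; split=> //.
    by apply: sub_span; exists [:: v, w & s].
Qed.

(** The differential of a letter splits into its linear part d0 and a part d1 of word
    length at least 2. *)
Definition d0 : {linear W -> W} := lpart L \o diff \o gen.
Definition d1 : {linear W -> L} := (diff \o gen) \- (gen \o d0).
Lemma d0_homog i w : w \in homog i -> d0 w \in homog (i + 1).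
Proof. by move=> wi; apply/lpart_homog/homog_diff/grmor_homog. Qed.
Lemma d1_homog i w : w \in homog i -> d1 w \in homog (i + 1).
Proof.
move=> wi; apply: homogB; first by apply/homog_diff/grmor_homog.
exact/grmor_homog/d0_homog.
Qed.
Lemma diff_genE w : diff (gen w : L) = gen (d0 w) + d1 w.
Proof. by rewrite /d1 /= addrC subrK. Qed.

Lemma d01_words (E : grsub W) w : diff (gen w) \in words_ge L (E : submodClosed W) 0 ->
  d0 w \in (E : submodClosed W) /\ d1 w \in words_ge L (E : submodClosed W) 2.
Proof.
move=> /words_decomp [c [v [u [vE uE e]]]].
have ae : aug L (diff (gen w)) = 0 := aug_words (ltnSn 0) (diff_gen L w).
have au : aug L u = 0 by apply: (@aug_words _ _ L 2) => //; apply: words_sub uE.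
have c0 : c = 0.
  move: ae; rewrite e !gmorD gmorZ gmor1 aug_gen au !addr0 => h.
  by rewrite -[c]mulr1.
have v0 : d0 w = v.
  rewrite /d0 /= e !linearD /= linearZ /= lpart1 scaler0 add0r lpart_gen.
  by rewrite (lpart_words _ uE) ?addr0.
split; first by rewrite v0.
rewrite -[d1 w]/(diff (gen w) - gen (d0 w)) v0 e c0 scale0r add0r addrAC subrr.
by rewrite add0r.
Qed.

Lemma d1_words w : d1 w \in words_ge L (full_pred W) 2.
Proof. exact: (d01_words (E := full W) (words_full _)).2. Qed.

Lemma d0d0 w : d0 (d0 w) = 0.
Proof.
have e : diff (gen (d0 w) : L) = - diff (d1 w).
  by apply/eqP; rewrite -addr_eq0 -linearD -diff_genE diffK.
rewrite -[LHS]/(lpart L (diff (gen (d0 w)))) e linearN.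
have h : diff (d1 w) \in words_ge L (full_pred W) 2 := @word_ideal_diff _ _ L 2 _ (d1_words w).
by rewrite (lpart_words _ h) ?oppr0.
Qed.

Lemma diff_d1 w : diff (d1 w) = - d1 (d0 w).
Proof.
apply/eqP; rewrite -addr_eq0; apply/eqP.
have e : diff (gen (d0 w) : L) = d1 (d0 w) by rewrite diff_genE d0d0 linear0 add0r.
by rewrite -e addrC -linearD -diff_genE diffK.
Qed.
End WordsInd.

(** * The path algebra of a Sullivan algebra *)

Section Ext.
Context {k : fieldType} {W : gradedType k} (L : freeCDGA W) {C : gcaType k}.
Definition ext (f : grmor W C) : gcamor L C := sval (cid (gen_free L f)).
Lemma ext_gen f w : ext f (gen w) = f w.
Proof. by rewrite /ext; case: (cid _) => g []. Qed.
Lemma ext_agree (E : {pred W}) (f g : gcamor L C) : (forall w, w \in E -> f (gen w) = g (gen w)) ->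
  forall x, x \in words_ge L E 0 -> f x = g x.
Proof.
move=> fg; apply: words_ind.
- by rewrite !gmor0.
- by move=> a x y hx hy; rewrite !gmorL hx hy.
- by rewrite !gmor1.
- by move=> v x vE hx; rewrite !gmorM hx fg.
Qed.
Lemma free_eq (f g : gcamor L C) : (forall w, f (gen w) = g (gen w)) -> f =1 g.
Proof. by move=> fg x; apply: (@ext_agree predT) (words_full x) => w _. Qed.
End Ext.

Lemma filtration_mono (k : fieldType) (W : gradedType k) (F : nat -> grsub W) : filtration F ->
  forall i j, (i <= j)%N -> {subset (F i : submodClosed W) <= (F j : submodClosed W)}.
Proof.
case=> _ FS _ i j ij; elim: j ij => [|j IH]; first by rewrite leqn0 => /eqP ->.
by rewrite leq_eqVlt => /orP[/eqP ->//|/IH h] x /h /FS.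
Qed.

(** Recursion along a filtration, without bases: the iterates of Psi become stationary on
    each stage. *)
Lemma grmor_fixpoint (k : fieldType) (W C : gradedType k) (F : nat -> grsub W) (Psi : grmor W C ->
  grmor W C) :
  filtration F ->
  (forall n (f g : grmor W C), (forall w, w \in (F n : submodClosed W) -> f w = g w) ->
     forall w, w \in (F n.+1 : submodClosed W) -> Psi f w = Psi g w) ->
  exists f : grmor W C, forall w, f w = Psi f w.
Proof.
move=> Ff con; have [F0 FS Fex] := Ff.
have zh i (x : W) : x \in homog i -> (\0 : {linear W -> C}) x \in homog i.
  by move=> _; apply: homog0.
pose X n := iter n Psi (GrMor zh).
have Xst n m w : (n <= m)%N -> w \in (F n : submodClosed W) -> X m w = X n w.
  elim: n m w => [|n IH] [|m] w // nm wn; first by rewrite (F0 w wn) !linear0.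
  by rewrite -[X m.+1]/(Psi (X m)) -[X n.+1]/(Psi (X n)); apply: (con n) => // v vn; apply: IH.
pose N w := sval (cid (Fex w)).
have NP w : w \in (F (N w) : submodClosed W) by rewrite /N; case: (cid _).
pose f w := X (N w) w.
have fE n w : w \in (F n : submodClosed W) -> f w = X n w.
  move=> wn; rewrite /f; have [h|/ltnW h] := leqP (N w) n.
    by rewrite (Xst _ _ _ h) ?NP.
  by rewrite (Xst _ _ _ h).
have fL : linear f.
  move=> a x y; pose n := maxn (N x) (N y).
  have xn : x \in (F n : submodClosed W) by apply: filtration_mono (NP x) => //; apply: leq_maxl.
  have yn : y \in (F n : submodClosed W) by apply: filtration_mono (NP y) => //; apply: leq_maxr.
  by rewrite !(fE n) ?linearP ?rpredD ?rpredZ.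
have fH i w : w \in homog i -> linear_of fL w \in homog i by move=> wi; apply: (grmor_homog (X (N w)) wi).
exists (GrMor fH) => w.
have wn : w \in (F (N w).+1 : submodClosed W) by apply: FS.
rewrite -[LHS]/(f w) (fE _ _ wn) -[X _.+1]/(Psi (X (N w))).
by apply: (con (N w)) => // v vn; rewrite -[RHS]/(f v) (fE _ _ vn).
Qed.

Section Path.
Context {k : fieldType} (char0 : [pchar k] =i pred0) {W : gradedType k} (L : freeCDGA W).
Hypothesis W1 : concentrated_ge1 W.

Let sW : gradedType k := shift 1 W.
Let V := (W * sW)%type : gradedType k.

Fact Yletter_nneg (i : int) (v : V) : i < 0 -> pr i v = 0.
Proof.
move=> i0; apply: injective_projections; first by apply: W1; apply: lt_trans i0 _.
by apply: (W1 (i := i + 1)); rewrite -ltrBrDr subrr.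
Qed.
(** The words in the letters lam w, a second copy of W, and sus w, of degree |w| - 1. *)
Definition Yalg : freeCDGA V := FreeCDGA Yletter_nneg (@fgen_free k V).

(** The letters hat w and sus w form contractible pairs, so that the path algebra is the
    copy of the algebra on the letters lam w, times a contractible factor. *)
Definition path : Type := gtensor L Yalg.
HB.instance Definition _ := GCA.on path.

Definition letter := (W * V)%type : gradedType k.
Fact letter_nneg (i : int) (v : letter) : i < 0 -> pr i v = 0.
Proof.
move=> i0; apply: injective_projections; last exact: Yletter_nneg.
by apply: W1; apply: lt_trans i0 _.
Qed.

Definition pgen : grmor letter path := @cgen k L Yalg W V (@gen k W L) (@gen k V Yalg).
Lemma pgen_free : free_on pgen.
Proof. exact: (cgen_free (gen_free L) (gen_free Yalg)). Qed.

Definition hat : gcamor L path := in_l L Yalg.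
Definition inY : gcamor Yalg path := in_r L Yalg.
Fact w_in_Y_linear : linear (fun w : W => (w, 0) : V).
Proof. by move=> a x y; apply: injective_projections; rewrite //= scaler0 addr0. Qed.
Fact w_in_Y_homog i w : w \in homog i -> (gen ((w, 0) : V) : Yalg) \in homog i.
Proof.
by move=> /homogP e; apply: grmor_homog; apply/homogP; apply: injective_projections; rewrite /= ?e ?linear0.
Qed.
Fact s_in_Y_linear : linear (fun w : W => (0, w) : V).
Proof. by move=> a x y; apply: injective_projections; rewrite //= scaler0 addr0. Qed.
Definition lamY : gcamor L Yalg :=
  ext L (@GrMor k W Yalg (gen \o linear_of w_in_Y_linear) w_in_Y_homog).
Lemma lamY_gen w : lamY (gen w) = gen ((w, 0) : V).
Proof. exact: ext_gen. Qed.
Definition lam : gcamor L path := gca_comp inY lamY.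
Definition susY : {linear W -> Yalg} := gen \o linear_of s_in_Y_linear.
Definition sus : {linear W -> path} := inY \o susY.
Lemma inY_lamY x : inY (lamY x) = lam x. Proof. by []. Qed.
Lemma inY_susY w : inY (susY w) = sus w. Proof. by []. Qed.
Lemma susY_homog i w : w \in homog i -> susY w \in homog (i - 1).
Proof.
move=> /homogP wi; apply: grmor_homog; apply/homogP; apply: injective_projections;
  first by rewrite /= linear0.
by rewrite -[LHS]/(pr (i - 1 + 1) w) subrK.
Qed.
Lemma sus_homog i w : w \in homog i -> sus w \in homog (i - 1).
Proof. by move=> wi; apply: gcamor_homog; apply: susY_homog. Qed.
Lemma genY (v : V) : (gen v : Yalg) = lamY (gen v.1) + susY v.2.
Proof.
rewrite lamY_gen -[susY _]/(gen ((0, v.2) : V)) -linearD; congr (gen _).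
by apply: injective_projections; rewrite /= ?addr0 ?add0r.
Qed.
Lemma pgenE u : pgen u = hat (gen u.1) + lam (gen u.2.1) + sus u.2.2.
Proof.
by rewrite -addrA -[RHS]/(hat (gen u.1) + (inY (lamY (gen u.2.1)) + inY (susY u.2.2))) -gmorD -genY.
Qed.

Lemma Y_ind (P : Yalg -> Prop) : P 0 -> (forall a x y, P x -> P y -> P (a *: x + y)) ->
  P 1 -> (forall x y, P x -> P y -> P (x * y)) -> (forall w, P (lamY (gen w))) ->
  (forall w, P (susY w)) -> forall x, P x.
Proof.
move=> P0 Pl P1 PM Pw Ps; apply: free_ind => // v x Px; apply: PM => //.
by rewrite genY -[lamY _]scale1r; apply: Pl.
Qed.

Lemma path_ind (P : path -> Prop) : P 0 -> (forall a x y, P x -> P y -> P (a *: x + y)) ->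
  P 1 -> (forall x y, P x -> P y -> P (x * y)) -> (forall w, P (hat (gen w))) ->
  (forall w, P (lam (gen w))) -> (forall w, P (sus w)) -> forall x, P x.
Proof.
move=> P0 Pl P1 PM Ph Pw Ps.
have Pa a : P (hat a).
  move: a; apply: free_ind; rewrite ?gmor0 ?gmor1 //.
    by move=> c x x' hx hx'; rewrite gmorL; apply: Pl.
  by move=> v x hx; rewrite gmorM; apply: PM => //; apply: Ph.
have Py y : P (inY y).
  move: y; apply: Y_ind; rewrite ?gmor0 ?gmor1 //.
    by move=> c x x' hx hx'; rewrite gmorL; apply: Pl.
  by move=> v x hx; rewrite gmorM; apply: PM.
apply: (@tensor_ind _ _ _ P) => // a y.
have <- : hat a * inY y = pure a y by apply: in_lrE.
exact: PM.
Qed.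

Fact U1_linear : linear (fun u : letter => u.1 : W). Proof. by []. Qed.
Fact U2_linear : linear (fun u : letter => u.2.1 : W). Proof. by []. Qed.
Fact U3_linear : linear (fun u : letter => u.2.2 : W). Proof. by []. Qed.
Let u1 : {linear letter -> W} := linear_of U1_linear.
Let u2 : {linear letter -> W} := linear_of U2_linear.
Let u3 : {linear letter -> W} := linear_of U3_linear.
Let u1H i u : u \in homog i -> u1 u \in homog i.
Proof. by move=> /homogP e; apply/homogP; rewrite -[in RHS]e. Qed.
Let u2H i u : u \in homog i -> u2 u \in homog i.
Proof. by move=> /homogP e; apply/homogP; rewrite -[in RHS]e. Qed.
Let u3H i u : u \in homog i -> u3 u \in homog (i + 1).
Proof. by move=> /homogP e; apply/homogP; rewrite -[in RHS]e. Qed.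

Definition path_diff_letter : {linear letter -> path} :=
  (((hat \o gen \o d0 L \o u1) \+ (lam \o diff \o gen \o u2)) \+ (hat \o gen \o u3)) \- (sus \o d0 L \o u3).
Fact path_diff_letter_homog i u : u \in homog i -> path_diff_letter u \in homog (i + 1).
Proof.
move=> ui; apply: homogB; last first.
  by have := sus_homog (d0_homog L (u3H ui)); rewrite addrK.
apply: homogD; last exact: (gcamor_homog hat (grmor_homog gen (u3H ui))).
apply: homogD.
  exact: (gcamor_homog hat (grmor_homog gen (d0_homog L (u1H ui)))).
exact: (gcamor_homog lam (homog_diff _ _ (grmor_homog gen (u2H ui)))).
Qed.
Definition hat_to_sus_letter : {linear letter -> path} := sus \o u1.
Fact hat_to_sus_letter_homog i u : u \in homog i -> hat_to_sus_letter u \in homog (i - 1).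
Proof. by move=> ui; apply/sus_homog/u1H. Qed.

Definition path_diff_ex := free_derivation pgen_free sg1 letter_nneg path_diff_letter_homog.
Lemma sgN1 : sg (- 1) = - 1 :> k. Proof. by rewrite sgN. Qed.
Definition hat_to_sus_ex := free_derivation pgen_free sgN1 letter_nneg hat_to_sus_letter_homog.

Definition path_diff : {linear path -> path} := sval (cid path_diff_ex).
Definition hat_to_sus : {linear path -> path} := sval (cid hat_to_sus_ex).
Lemma path_diff_gen u : path_diff (pgen u) = path_diff_letter u.
Proof. by rewrite /path_diff; case: (cid _) => ? []. Qed.
Lemma path_diff_homog i x : x \in homog i -> path_diff x \in homog (i + 1).
Proof. by rewrite /path_diff; case: (cid _) => ? [] /= _ h _; apply: h. Qed.
Lemma path_diffM x y : path_diff (x * y) = path_diff x * y + sgn x * path_diff y.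
Proof. by rewrite /path_diff; case: (cid _) => ? []. Qed.
Lemma hat_to_sus_gen u : hat_to_sus (pgen u) = hat_to_sus_letter u.
Proof. by rewrite /hat_to_sus; case: (cid _) => ? []. Qed.
Lemma hat_to_sus_homog i x : x \in homog i -> hat_to_sus x \in homog (i - 1).
Proof. by rewrite /hat_to_sus; case: (cid _) => ? [] /= _ h _; apply: h. Qed.
Lemma hat_to_susM x y : hat_to_sus (x * y) = hat_to_sus x * y + sgn x * hat_to_sus y.
Proof. by rewrite /hat_to_sus; case: (cid _) => ? []. Qed.
Lemma path_diff_sgn x : path_diff (sgn x) = - sgn (path_diff x).
Proof. by apply: (sgn_odd (e := 1) sg1) => i y; apply: path_diff_homog. Qed.
Lemma hat_to_sus_sgn x : hat_to_sus (sgn x) = - sgn (hat_to_sus x).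
Proof. by apply: (sgn_odd (e := -1) sgN1) => i y; apply: hat_to_sus_homog. Qed.
Lemma path_diff1 : path_diff 1 = 0.
Proof.
have := path_diffM 1 1; rewrite sgn1 !mul1r mulr1 => /eqP.
by rewrite -subr_eq subrr eq_sym => /eqP.
Qed.
Lemma hat_to_sus1 : hat_to_sus 1 = 0.
Proof.
have := hat_to_susM 1 1; rewrite sgn1 !mul1r mulr1 => /eqP.
by rewrite -subr_eq subrr eq_sym => /eqP.
Qed.

Let sus0 : sus 0 = 0. Proof. exact: linear0. Qed.
Let gen0 : (gen 0 : L) = 0. Proof. exact: linear0. Qed.
Let d00 : d0 L 0 = 0. Proof. exact: linear0. Qed.
Let diff0 : diff (0 : L) = 0. Proof. exact: linear0. Qed.
Let mk (a b c : W) : letter := (a, ((b, c) : V)).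
Let pgen_hat w : pgen (mk w 0 0) = hat (gen w).
Proof. by rewrite pgenE -[LHS]/(hat (gen w) + lam (gen 0) + sus 0) gen0 gmor0 sus0 !addr0. Qed.
Let pgen_lam w : pgen (mk 0 w 0) = lam (gen w).
Proof. by rewrite pgenE -[LHS]/(hat (gen 0) + lam (gen w) + sus 0) gen0 gmor0 sus0 add0r addr0. Qed.
Let pgen_sus w : pgen (mk 0 0 w) = sus w.
Proof. by rewrite pgenE -[LHS]/(hat (gen 0) + lam (gen 0) + sus w) gen0 !gmor0 !add0r. Qed.

Lemma path_diff_hat w : path_diff (hat (gen w)) = hat (gen (d0 L w)).
Proof.
rewrite -pgen_hat path_diff_gen -[LHS]/(hat (gen (d0 L w)) + lam (diff (gen 0)) + hat (gen 0) - sus (d0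
  L 0)).
by rewrite d00 gen0 diff0 sus0 !gmor0 !addr0 subr0.
Qed.
Lemma path_diff_lam_gen w : path_diff (lam (gen w)) = lam (diff (gen w)).
Proof.
rewrite -pgen_lam path_diff_gen -[LHS]/(hat (gen (d0 L 0)) + lam (diff (gen w)) + hat (gen 0) - sus (d0
  L 0)).
by rewrite d00 gen0 sus0 !gmor0 add0r addr0 subr0.
Qed.
Lemma path_diff_sus w : path_diff (sus w) = hat (gen w) - sus (d0 L w).
Proof.
rewrite -pgen_sus path_diff_gen -[LHS]/(hat (gen (d0 L 0)) + lam (diff (gen 0)) + hat (gen w) - sus (d0
  L w)).
by rewrite d00 gen0 diff0 !gmor0 !add0r.
Qed.
Lemma hat_to_sus_hat w : hat_to_sus (hat (gen w)) = sus w.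
Proof. by rewrite -pgen_hat hat_to_sus_gen. Qed.
Lemma hat_to_sus_lam w : hat_to_sus (lam (gen w)) = 0.
Proof. by rewrite -pgen_lam hat_to_sus_gen -[LHS]/(sus 0) sus0. Qed.
Lemma hat_to_sus_sus w : hat_to_sus (sus w) = 0.
Proof. by rewrite -pgen_sus hat_to_sus_gen -[LHS]/(sus 0) sus0. Qed.

Lemma path_diff_lam x : path_diff (lam x) = lam (diff x).
Proof.
move: x; apply: free_ind.
- by rewrite !linear0.
- by move=> a x y hx hy; rewrite !linearP /= hx hy.
- by rewrite diff1 gmor1 path_diff1 gmor0.
- by move=> v x hx; rewrite diffMs gmorM path_diffM gmorD !gmorM hx path_diff_lam_gen gmor_sgn.
Qed.
Lemma hat_to_sus_inY y : hat_to_sus (inY y) = 0.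
Proof.
move: y; apply: Y_ind.
- by rewrite !linear0.
- by move=> a x y hx hy; rewrite !linearP /= hx hy scaler0 addr0.
- by rewrite gmor1 hat_to_sus1.
- by move=> x y hx hy; rewrite gmorM hat_to_susM hx hy mul0r mulr0 addr0.
- exact: hat_to_sus_lam.
- exact: hat_to_sus_sus.
Qed.

Lemma path_diffK x : path_diff (path_diff x) = 0.
Proof.
move: x; apply: path_ind.
- by rewrite !linear0.
- by move=> a x y hx hy; rewrite !linearP /= hx hy scaler0 addr0.
- by rewrite path_diff1 linear0.
- move=> x y hx hy; rewrite path_diffM linearD /= !path_diffM hx hy path_diff_sgn mul0r mulr0 mulNr.
  by rewrite add0r addr0 addrN.
- by move=> w; rewrite !path_diff_hat d0d0 linear0 gmor0.
- by move=> w; rewrite !path_diff_lam diffK gmor0.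
- by move=> w; rewrite path_diff_sus linearB /= path_diff_hat path_diff_sus d0d0 linear0 subr0 subrr.
Qed.
Lemma hat_to_susK x : hat_to_sus (hat_to_sus x) = 0.
Proof.
move: x; apply: path_ind.
- by rewrite !linear0.
- by move=> a x y hx hy; rewrite !linearP /= hx hy scaler0 addr0.
- by rewrite hat_to_sus1 linear0.
- move=> x y hx hy; rewrite hat_to_susM linearD /= !hat_to_susM hx hy hat_to_sus_sgn mul0r mulr0 mulNr.
  by rewrite add0r addr0 addrN.
- by move=> w; rewrite hat_to_sus_hat hat_to_sus_sus.
- by move=> w; rewrite hat_to_sus_lam linear0.
- by move=> w; rewrite hat_to_sus_sus linear0.
Qed.

(** It counts the letters hat and sus.  As it is a commutator with the differential,
    dividing [hat_to_sus] by it gives a contraction in positive weight. *)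
Definition path_weight : {linear path -> path} := (path_diff \o hat_to_sus) \+ (hat_to_sus \o path_diff).
Lemma path_weightE x : path_weight x = path_diff (hat_to_sus x) + hat_to_sus (path_diff x).
Proof. by []. Qed.
Let add_cancel (A : zmodType) (a p q e b f : A) :
  a + p - q + e + (b + q - p + f) = a + b + (e + f).
Proof. by rewrite addrACA; congr (_ + _); rewrite addrACA [a + p + _]addrACA -opprD [q + p]addrC addrK. Qed.
Lemma path_weightM x y : path_weight (x * y) = path_weight x * y + x * path_weight y.
Proof.
have e1 : path_diff (hat_to_sus (x * y)) = path_diff (hat_to_sus x) * y + sgn (hat_to_sus x) *
  path_diff y - sgn (path_diff x) * hat_to_sus y + x * path_diff (hat_to_sus y).
  by rewrite hat_to_susM linearD path_diffM [X in _ + X]path_diffM path_diff_sgn sgnK mulNr addrA.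
have e2 : hat_to_sus (path_diff (x * y)) = hat_to_sus (path_diff x) * y + sgn (path_diff x) *
  hat_to_sus y - sgn (hat_to_sus x) * path_diff y + x * hat_to_sus (path_diff y).
  by rewrite path_diffM linearD hat_to_susM [X in _ + X]hat_to_susM hat_to_sus_sgn sgnK mulNr addrA.
by rewrite !path_weightE e1 e2 add_cancel mulrDl mulrDr.
Qed.
Lemma path_weight_hat w : path_weight (hat (gen w)) = hat (gen w).
Proof. by rewrite path_weightE hat_to_sus_hat path_diff_hat hat_to_sus_hat path_diff_sus subrK. Qed.
Lemma path_weight_lam x : path_weight (lam x) = 0.
Proof. by rewrite path_weightE path_diff_lam -!inY_lamY !hat_to_sus_inY linear0 addr0. Qed.
Lemma path_weight_sus w : path_weight (sus w) = sus w.
Proof. by rewrite path_weightE hat_to_sus_sus path_diff_sus linearB /= hat_to_sus_hat hat_to_sus_sus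
  linear0 subr0 add0r. Qed.
Lemma path_weight_diff x : path_weight (path_diff x) = path_diff (path_weight x).
Proof. by rewrite !path_weightE path_diffK linear0 addr0 linearD /= path_diffK add0r. Qed.
Lemma path_weight_hat_to_sus x : path_weight (hat_to_sus x) = hat_to_sus (path_weight x).
Proof. by rewrite !path_weightE hat_to_susK linear0 add0r linearD /= hat_to_susK addr0. Qed.
Lemma path_weight_homog i x : x \in homog i -> path_weight x \in homog i.
Proof.
move=> xi; apply: homogD; first by rewrite -[i](subrK 1); apply/path_diff_homog/hat_to_sus_homog.
by rewrite -[i](addrK 1); apply/hat_to_sus_homog/path_diff_homog.
Qed.

Local Notation eg := (eig path_weight).
Lemma eigM l m x y : eg l x -> eg m y -> eg (l + m)%N (x * y).
Proof. by rewrite /eig path_weightM natrD scalerDl => -> ->; rewrite scalerAl scalerAr. Qed.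
Lemma eig_1 : eg 0 1.
Proof. by rewrite /eig scale0r path_weightE hat_to_sus1 path_diff1 !linear0 addr0. Qed.
Lemma eig_hat w : eg 1 (hat (gen w)).
Proof. by rewrite /eig path_weight_hat scale1r. Qed.
Lemma eig_lam x : eg 0 (lam x).
Proof. by rewrite /eig path_weight_lam scale0r. Qed.
Lemma eig_sus w : eg 1 (sus w).
Proof. by rewrite /eig path_weight_sus scale1r. Qed.
Lemma eig_diff l x : eg l x -> eg l (path_diff x).
Proof. by rewrite /eig path_weight_diff => ->; rewrite linearZ. Qed.
Lemma eig_hat_to_sus l x : eg l x -> eg l (hat_to_sus x).
Proof. by rewrite /eig path_weight_hat_to_sus => ->; rewrite linearZ. Qed.

(** The predicate restricts the eigenvectors, so that subspaces spanned by monomials can be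
    shown to be stable under functions of the weight. *)
Definition eigS (P : nat -> path -> Prop) : submodClosed path :=
  span [set x | exists l, eg l x /\ P l x]%classic.
Lemma eigSM (P P' Q : nat -> path -> Prop) x y :
  (forall l m x y, P l x -> P' m y -> eg l x -> eg m y -> Q (l + m)%N (x * y)) ->
  x \in eigS P -> y \in eigS P' -> x * y \in eigS Q.
Proof.
move=> PQ + yP; move: x; apply: span_ind.
- by rewrite mul0r rpred0.
- by move=> a x x' hx hx'; rewrite mulrDl -scalerAl rpredD ?rpredZ.
move=> x [l [xl Px]]; move: y yP; apply: span_ind.
- by rewrite mulr0 rpred0.
- by move=> a y y' hy hy'; rewrite mulrDr -scalerAr rpredD ?rpredZ.
move=> y [m [ym Py]]; apply: sub_span; exists (l + m)%N; split; first exact: eigM.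
exact: PQ.
Qed.
Lemma eig_all x : x \in eigS (fun _ _ => True).
Proof.
move: x; apply: path_ind.
- exact: rpred0.
- by move=> a x y hx hy; rewrite rpredD ?rpredZ.
- by apply: sub_span; exists 0%N; split=> //; apply: eig_1.
- by move=> x y; apply: eigSM.
- by move=> w; apply: sub_span; exists 1%N; split=> //; apply: eig_hat.
- by move=> w; apply: sub_span; exists 0%N; split=> //; apply: eig_lam.
- by move=> w; apply: sub_span; exists 1%N; split=> //; apply: eig_sus.
Qed.

Lemma path_homotopy_ex : exists h : {linear path -> path}, forall l x, eg l x ->
  h x = l%:R^-1 *: hat_to_sus x.
Proof.
have [H HE] := @eig_lift k char0 path path_weight path (fun l => l%:R^-1 \*: hat_to_sus).
by exists H => l x /HE.
Qed.
(** In weight 0 this is 0, as the inverse of 0 is 0; in positive weight it is a contracting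
    homotopy because positive integers are invertible in characteristic 0. *)
Definition path_homotopy : {linear path -> path} := sval (cid path_homotopy_ex).
Lemma path_homotopy_eig l x : eg l x -> path_homotopy x = l%:R^-1 *: hat_to_sus x.
Proof. by rewrite /path_homotopy; case: (cid _) => h /= hE; apply: hE. Qed.

Lemma eig_eq (A : lmodType k) (f g : {linear path -> A}) :
  (forall l x, eg l x -> f x = g x) -> f =1 g.
Proof.
move=> fg x; move: (eig_all x); move: x; apply: span_ind; first by rewrite !linear0.
  by move=> a x y hx hy; rewrite !linearP hx hy.
by move=> x [l [xl _]]; apply: fg xl.
Qed.

Lemma path_homotopy_homog i x : x \in homog i -> path_homotopy x \in homog (i - 1).
Proof.
move=> xi; suff e : forall y, pr (i - 1) (path_homotopy y) = path_homotopy (pr i y).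
  by apply/homogP; rewrite e; move/homogP: xi => ->.
have pL l y : eg l y -> eg l (pr i y).
  rewrite /eig => e; rewrite -[path_weight _](grmor_pr (f := path_weight)) ?e ?linearZ //.
  exact: path_weight_homog.
apply: (eig_eq (f := pr (i - 1) \o path_homotopy) (g := path_homotopy \o pr i)) => l y yl /=.
rewrite (path_homotopy_eig yl) (path_homotopy_eig (pL _ _ yl)) linearZ /=; congr (_ *: _).
by rewrite -[RHS](linear_pr_shift (f := hat_to_sus) (e := -1)) //; apply: hat_to_sus_homog.
Qed.

Definition posweight : submodClosed path := eigS (fun l _ => (0 < l)%N).
Lemma posweight_homotopy x : x \in posweight ->
  path_diff (path_homotopy x) + path_homotopy (path_diff x) = x.
Proof.
move: x; apply: span_ind; first by rewrite !linear0 addr0.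
  by move=> a x y hx hy; rewrite !linearP /= addrACA -scalerDr hx hy.
move=> x [l [xl l0]]; rewrite (path_homotopy_eig xl) (path_homotopy_eig (eig_diff xl)) linearZ /= -scalerDr.
rewrite -path_weightE; have -> : path_weight x = l%:R *: x by [].
by rewrite scalerA mulVf ?scale1r // natk_eq0 // -lt0n.
Qed.
Lemma posweight_mull x y : y \in posweight -> x * y \in posweight.
Proof.
move=> yN; apply: (@eigSM (fun _ _ => True) (fun l _ => (0 < l)%N)) (eig_all x) yN.
by move=> l m _ _ _ m0 _ _; rewrite addn_gt0 m0 orbT.
Qed.
Lemma posweight_mulr x y : x \in posweight -> x * y \in posweight.
Proof.
move=> xN; apply: (@eigSM (fun l _ => (0 < l)%N) (fun _ _ => True)) xN (eig_all y).
by move=> l m _ _ l0 _ _ _; rewrite addn_gt0 l0.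
Qed.
Lemma posweight_hat w : hat (gen w) \in posweight.
Proof. by apply: sub_span; exists 1%N; split=> //; apply: eig_hat. Qed.
Lemma posweight_homotopy_image x : path_homotopy x \in posweight.
Proof.
move: (eig_all x); move: x; apply: span_ind; first by rewrite linear0 rpred0.
  by move=> a x y hx hy; rewrite linearP rpredD ?rpredZ.
move=> x [[|l] [xl _]]; rewrite (path_homotopy_eig xl); first by rewrite invr0 scale0r rpred0.
by rewrite rpredZ //; apply: sub_span; exists l.+1; split=> //; apply: eig_hat_to_sus.
Qed.
End Path.

Opaque path_diff hat_to_sus path_homotopy path_weight sgn.

(** * Products of graded subspaces *)

Section ProdSpan.
Context {k : fieldType} {A B C : gcaType k} (f : gcamor A C) (g : gcamor B C).

(** By graded commutativity the order of the two factors does not matter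
    ([prodspan_comm]), so such spans multiply ([prodspanM]). *)
Definition prodspan (S : grsub A) (T : grsub B) : submodClosed C :=
  span [set z | exists a b, [/\ a \in (S : submodClosed A), b \in (T :
    submodClosed B) & z = f a * g b]]%classic.

Lemma prodspan_gen (S : grsub A) (T : grsub B) a b : a \in (S : submodClosed A) -> b \in (T :
  submodClosed B) ->
  f a * g b \in prodspan S T.
Proof. by move=> aS bT; apply: sub_span; exists a, b. Qed.

Lemma prodspan_pr (S : grsub A) (T : grsub B) i x : x \in prodspan S T -> pr i x \in prodspan S T.
Proof.
move: x; apply: span_ind; first by rewrite linear0 rpred0.
  by move=> c x y hx hy; rewrite linearP rpredD ?rpredZ.
move=> _ [a [b [aS bT ->]]]; rewrite (supp_sum a) (supp_sum b) !linear_sum mulr_suml linear_sum.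
apply: rpred_sum => p _; rewrite mulr_sumr linear_sum; apply: rpred_sum => q _.
have h := homogM _ _ _ _ (gcamor_homog f (homog_pr p a)) (gcamor_homog g (homog_pr q b)).
rewrite (pr_homog _ h); case: eqP => _; last exact: rpred0.
by apply: prodspan_gen; apply: grsub_pr.
Qed.
Definition prodsub S T : grsub C := GrSub (@prodspan_pr S T).

Lemma prodspan_comm (S : grsub A) (T : grsub B) a b : a \in (S : submodClosed A) -> b \in (T :
  submodClosed B) ->
  g b * f a \in prodspan S T.
Proof.
move=> aS bT; rewrite (supp_sum a) (supp_sum b) !linear_sum mulr_suml.
apply: rpred_sum => p _; rewrite mulr_sumr; apply: rpred_sum => q _.
rewrite (gca_comm (gcamor_homog g (homog_pr p b)) (gcamor_homog f (homog_pr q a))) rpredZ //.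
by apply: prodspan_gen; apply: grsub_pr.
Qed.

Lemma prodspan_sub (S S' : grsub A) (T T' : grsub B) :
  {subset (S : submodClosed A) <= (S' : submodClosed A)} ->
  {subset (T : submodClosed B) <= (T' : submodClosed B)} ->
  {subset prodspan S T <= prodspan S' T'}.
Proof. by move=> SS TT; apply: span_min => _ [a [b [/SS aS /TT bT ->]]]; apply: prodspan_gen. Qed.

Lemma prodspanM (S S' S'' : grsub A) (T T' T'' : grsub B) :
  (forall a a', a \in (S : submodClosed A) -> a' \in (S' : submodClosed A) -> a * a' \in (S'' :
    submodClosed A)) ->
  (forall b b', b \in (T : submodClosed B) -> b' \in (T' : submodClosed B) -> b * b' \in (T'' :
    submodClosed B)) ->
  forall x y, x \in prodspan S T -> y \in prodspan S' T' -> x * y \in prodspan S'' T''.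
Proof.
move=> SS TT x y + yP; move: x; apply: span_ind.
- by rewrite mul0r rpred0.
- by move=> c x x' hx hx'; rewrite mulrDl -scalerAl rpredD ?rpredZ.
move=> _ [a [b [aS bT ->]]]; move: y yP; apply: span_ind.
- by rewrite mulr0 rpred0.
- by move=> c y y' hy hy'; rewrite mulrDr -scalerAr rpredD ?rpredZ.
move=> _ [a' [b' [aS' bT' ->]]]; rewrite -mulrA [g b * _]mulrA.
have := prodspan_comm aS' bT; move: (g b * f a'); apply: span_ind.
- by rewrite mul0r mulr0 rpred0.
- by move=> c y y' hy hy'; rewrite mulrDl mulrDr -scalerAl -scalerAr rpredD ?rpredZ.
move=> _ [a2 [b2 [a2S b2T ->]]]; have -> : f a * (f a2 * g b2 * g b') = f (a * a2) * g (b2 * b').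
  by rewrite !gmorM !mulrA.
by apply: prodspan_gen; [apply: SS|apply: TT].
Qed.
Lemma prodspan_agree (X : gcaType k) (h h' : gcamor C X) (S : grsub A) (T : grsub B) :
  (forall a, a \in (S : submodClosed A) -> h (f a) = h' (f a)) -> (forall b, h (g b) = h' (g b)) ->
  forall x, x \in prodspan S T -> h x = h' x.
Proof.
move=> hS hT; apply: span_ind; first by rewrite !gmor0.
  by move=> c x y hx hy; rewrite !gmorL hx hy.
by move=> _ [a [b [aS _ ->]]]; rewrite !gmorM hS ?hT.
Qed.
End ProdSpan.

Section WSub.
Context {k : fieldType} {W : gradedType k} (L : freeCDGA W).
Definition wsub (E : grsub W) (q : nat) : grsub L :=
  @GrSub _ L (words_ge L (E : submodClosed W) q) (fun i x => @words_ge_pr _ _ L E q i x).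
End WSub.

(** * The chain map into the path algebra *)

Section Phi.
Context {k : fieldType} (char0 : [pchar k] =i pred0) {W : gradedType k} (L : freeCDGA W).
Hypothesis W1 : concentrated_ge1 W.
Local Notation C := (path L W1).
Local Notation hat := (hat L W1).
Local Notation lam := (lam L W1).
Local Notation sus := (sus L W1).
Local Notation inY := (inY L W1).
Local Notation D := (path_diff L W1).
Local Notation th := (hat_to_sus L W1).
Local Notation H := (path_homotopy char0 L W1).
Local Notation Lop := (path_weight L W1).

Section PathMor.
Context {X : gcaType k} (f1 f2 : grmor W X) (f3 : {linear W -> X}).
Hypothesis f3H : forall i w, w \in homog i -> f3 w \in homog (i - 1).
Fact path_mor_linear : linear (fun u : @letter k W => f1 u.1 + f2 u.2.1 + f3 u.2.2).
Proof.
move=> a u v; rewrite /= !linearP !scalerDr.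
by rewrite [in LHS](addrACA (a *: f1 _)) [in LHS](addrACA (a *: f1 _ + _)).
Qed.
Fact path_mor_homog i u : u \in homog i -> linear_of path_mor_linear u \in homog i.
Proof.
move=> /homogP e; apply: homogD; first apply: homogD.
- by apply: (grmor_homog f1); apply/homogP; rewrite -[in RHS]e.
- by apply: (grmor_homog f2); apply/homogP; rewrite -[in RHS]e.
have h : (u.2.2 : W) \in homog (i + 1).
  by apply/homogP; rewrite -[in RHS]e.
by rewrite -[i](addrK 1); apply: (f3H h).
Qed.
Lemma path_mor_ex : exists g : gcamor C X,
  [/\ forall w, g (hat (gen w)) = f1 w, forall w, g (lam (gen w)) = f2 w & forall w, g (sus w) = f3 w].
Proof.
have [g [gE _]] := pgen_free L W1 (GrMor path_mor_homog).
have gE' a b c : g (hat (gen a) + lam (gen b) + sus c) = f1 a + f2 b + f3 c.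
  by have := gE (a, ((b, c) : _ * shift 1 W)%type); rewrite pgenE.
have g0 : (gen 0 : L) = 0 by exact: linear0.
have s0 : sus 0 = 0 by exact: linear0.
have f10 : f1 0 = 0 by exact: linear0.
have f20 : f2 0 = 0 by exact: linear0.
have f30 : f3 0 = 0 by exact: linear0.
exists g; split=> w.
- by have := gE' w 0 0; rewrite g0 s0 f20 f30 !gmor0 !addr0.
- by have := gE' 0 w 0; rewrite g0 s0 f10 f30 !gmor0 !addr0 !add0r.
- by have := gE' 0 0 w; rewrite g0 f10 f20 !gmor0 !add0r.
Qed.
End PathMor.

Fact zero_grmor_homog (X : gcaType k) i (w : W) : w \in homog i -> (\0 : {linear W -> X}) w \in homog i.
Proof. by move=> _; apply: homog0. Qed.
Definition zero_grmor (X : gcaType k) : grmor W X := GrMor (@zero_grmor_homog X).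
Definition hat_gen : grmor W C := GrMor (grmor_fun := hat \o gen) (fun i w wi =>
  gcamor_homog hat (grmor_homog gen wi)).

Definition kill_lam_ex := path_mor_ex (X := C) hat_gen (zero_grmor C) (f3 := sus) (@sus_homog _ _ L W1).
Definition kill_lam : gcamor C C := sval (cid kill_lam_ex).
Lemma kill_lam_hat_gen w : kill_lam (hat (gen w)) = hat (gen w).
Proof. by rewrite /kill_lam; case: (cid _) => g []. Qed.
Lemma kill_lam_lam_gen w : kill_lam (lam (gen w)) = 0.
Proof. by rewrite /kill_lam; case: (cid _) => g []. Qed.
Lemma kill_lam_sus w : kill_lam (sus w) = sus w.
Proof. by rewrite /kill_lam; case: (cid _) => g []. Qed.
Lemma kill_lam_hat x : kill_lam (hat x) = hat x.
Proof. by apply: (free_eq (f := gca_comp kill_lam hat) (g := hat)) => w; apply: kill_lam_hat_gen. Qed.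
Lemma kill_lam_lam x : x \in words_ge L (full_pred W) 1 -> kill_lam (lam x) = 0.
Proof.
move: x; apply: words_geS_ind; first by rewrite !gmor0.
  by move=> a x y hx hy; rewrite !gmorL hx hy scaler0 addr0.
by move=> v x _ _; rewrite !gmorM kill_lam_lam_gen mul0r.
Qed.

Definition path_proj_ex := path_mor_ex (X := L) (zero_grmor L) (@gen _ _ L) (f3 := \0) (fun i w wi =>
  homog0 _).
Definition path_proj : gcamor C L := sval (cid path_proj_ex).
Lemma path_proj_hat_gen w : path_proj (hat (gen w)) = 0.
Proof. by rewrite /path_proj; case: (cid _) => g []. Qed.
Lemma path_proj_lam_gen w : path_proj (lam (gen w)) = gen w.
Proof. by rewrite /path_proj; case: (cid _) => g []. Qed.
Lemma path_proj_sus w : path_proj (sus w) = 0.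
Proof. by rewrite /path_proj; case: (cid _) => g []. Qed.
Lemma path_proj_lam x : path_proj (lam x) = x.
Proof. by apply: (free_eq (f := gca_comp path_proj lam) (g := gca_id L)) => w;
  apply: path_proj_lam_gen. Qed.
Lemma path_eq (X : gcaType k) (f g : gcamor C X) : (forall w, f (hat (gen w)) = g (hat (gen w))) ->
  (forall w, f (lam (gen w)) = g (lam (gen w))) -> (forall w, f (sus w) = g (sus w)) -> f =1 g.
Proof.
move=> h l s; apply: path_ind => //.
- by rewrite !gmor0.
- by move=> a x y hx hy; rewrite !gmorL hx hy.
- by rewrite !gmor1.
- by move=> x y hx hy; rewrite !gmorM hx hy.
Qed.

Lemma kill_lam_diff x : kill_lam (D x) = D (kill_lam x).
Proof.
move: x; apply: path_ind.
- by rewrite !(linear0, gmor0).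
- by move=> a x y hx hy; rewrite linearP !gmorL hx hy linearP.
- by rewrite gmor1 path_diff1 gmor0.
- move=> x y hx hy; rewrite (gmorM kill_lam x) (path_diffM x) (path_diffM (kill_lam x)) gmorD (gmorM
  kill_lam (D x)).
  by rewrite (gmorM kill_lam (sgn x)) hx hy gmor_sgn.
- by move=> w; rewrite kill_lam_hat path_diff_hat kill_lam_hat.
- by move=> w; rewrite path_diff_lam kill_lam_lam_gen linear0 kill_lam_lam // diff_gen.
- by move=> w; rewrite kill_lam_sus path_diff_sus gmorB kill_lam_hat kill_lam_sus.
Qed.
Lemma kill_lam_hat_to_sus x : kill_lam (th x) = th (kill_lam x).
Proof.
move: x; apply: path_ind.
- by rewrite !(linear0, gmor0).
- by move=> a x y hx hy; rewrite linearP !gmorL hx hy linearP.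
- by rewrite gmor1 hat_to_sus1 gmor0.
- move=> x y hx hy; rewrite (gmorM kill_lam x) (hat_to_susM x) (hat_to_susM (kill_lam x)) gmorD (gmorM
  kill_lam (th x)).
  by rewrite (gmorM kill_lam (sgn x)) hx hy gmor_sgn.
- by move=> w; rewrite kill_lam_hat hat_to_sus_hat kill_lam_sus.
- by move=> w; rewrite hat_to_sus_lam kill_lam_lam_gen !linear0.
- by move=> w; rewrite kill_lam_sus hat_to_sus_sus gmor0.
Qed.
Lemma kill_lam_homotopy x : kill_lam (H x) = H (kill_lam x).
Proof.
apply: (eig_eq (f := kill_lam \o H) (g := H \o kill_lam)) => l y yl.
rewrite -[LHS]/(kill_lam (H y)) -[RHS]/(H (kill_lam y)) (path_homotopy_eig char0 yl).
have e : eig Lop l (kill_lam y) by rewrite /eig path_weightE -kill_lam_hat_to_sus -!kill_lam_diff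
  -kill_lam_hat_to_sus -gmorD -path_weightE yl gmorZ.
by rewrite (path_homotopy_eig char0 e) gmorZ kill_lam_hat_to_sus.
Qed.
Lemma kill_lam_idem x : kill_lam (kill_lam x) = kill_lam x.
Proof.
apply: (path_eq (f := gca_comp kill_lam kill_lam) (g := kill_lam)) => w;
  rewrite -[LHS]/(kill_lam (kill_lam _)).
- by rewrite !kill_lam_hat.
- by rewrite kill_lam_lam_gen gmor0.
- by rewrite !kill_lam_sus.
Qed.

Lemma path_proj_diff x : path_proj (D x) = diff (path_proj x).
Proof.
move: x; apply: path_ind.
- by rewrite !(linear0, gmor0).
- by move=> a x y hx hy; rewrite linearP !gmorL hx hy linearP.
- by rewrite gmor1 path_diff1 gmor0 diff1.
- move=> x y hx hy; rewrite (gmorM path_proj x) (path_diffM x) diffMs gmorD (gmorM path_proj (D x)).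
  by rewrite (gmorM path_proj (sgn x)) hx hy gmor_sgn.
- by move=> w; rewrite path_diff_hat !path_proj_hat_gen linear0.
- by move=> w; rewrite path_diff_lam !path_proj_lam.
- by move=> w; rewrite path_diff_sus gmorB path_proj_hat_gen !path_proj_sus subr0 linear0.
Qed.
Lemma path_proj_hat_to_sus x : path_proj (th x) = 0.
Proof.
move: x; apply: path_ind.
- by rewrite !(linear0, gmor0).
- by move=> a x y hx hy; rewrite linearP !gmorL hx hy scaler0 addr0.
- by rewrite hat_to_sus1 gmor0.
- move=> x y hx hy; rewrite (hat_to_susM x) gmorD (gmorM path_proj (th x)) (gmorM path_proj (sgn x)) hx hy.
  by rewrite mul0r mulr0 addr0.
- by move=> w; rewrite hat_to_sus_hat path_proj_sus.
- by move=> w; rewrite hat_to_sus_lam gmor0.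
- by move=> w; rewrite hat_to_sus_sus gmor0.
Qed.
Lemma path_proj_homotopy x : path_proj (H x) = 0.
Proof.
apply: (eig_eq (f := path_proj \o H) (g := \0)) => l y yl.
by rewrite -[LHS]/(path_proj (H y)) (path_homotopy_eig char0 yl) gmorZ path_proj_hat_to_sus scaler0.
Qed.

Context (F : nat -> grsub W).
Hypothesis Ff : filtration F.
Hypothesis Fd : forall n w, w \in (F n.+1 : submodClosed W) -> diff (gen w) \in words_ge L (F n :
  submodClosed W) 0.

Lemma d0_stage n w : w \in (F n.+1 : submodClosed W) -> d0 L w \in (F n : submodClosed W).
Proof. by move=> /Fd h; have [] := d01_words h. Qed.
Lemma d1_stage n w : w \in (F n.+1 : submodClosed W) -> d1 L w \in words_ge L (F n : submodClosed W) 2.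
Proof. by move=> /Fd h; have [] := d01_words h. Qed.

Definition pathmap_step (f : gcamor L C) : {linear W -> C} :=
  ((lam \o gen) \+ (hat \o gen)) \+ (H \o (f \- lam) \o d1 L).
Lemma pathmap_step_homog f i w : w \in homog i -> pathmap_step f w \in homog i.
Proof.
move=> wi; apply: homogD; first apply: homogD.
- exact: (gcamor_homog lam (grmor_homog gen wi)).
- exact: (gcamor_homog hat (grmor_homog gen wi)).
rewrite -[i](addrK 1); apply: path_homotopy_homog.
by apply: homogB; apply: gcamor_homog; apply: d1_homog.
Qed.
(** A chain map f sending w to lam w + hat w + e must satisfy D e = f(d1 w) - lam(d1 w)
    - e', where e' is the correction of d0 w.  The right side is a cocycle of
    positive weight, so e = H(f(d1 w) - lam(d1 w)) solves the equation.  The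
    letters of d1 w come from an earlier stage, which makes this a recursion. *)
Lemma pathmap_ex : exists f : gcamor L C, forall w, f (gen w) = lam (gen w) + hat (gen w) + H (f (d1 L
  w) - lam (d1 L w)).
Proof.
have [|f fE] := @grmor_fixpoint k W C F (fun f => GrMor (@pathmap_step_homog (ext L f))) Ff.
  move=> n f g fg w wn; rewrite -[LHS]/(_ + H (ext L f (d1 L w) - _)) -[RHS]/(_ + H (ext L g (d1 L w) - _)).
  congr (_ + H (_ - _)); apply: (@ext_agree _ _ L _ (F n : submodClosed W)) => [v vn|].
    by rewrite !ext_gen fg.
  exact: words_geS (d1_stage wn).
by exists (ext L f) => w; rewrite ext_gen {1}fE.
Qed.
Definition pathmap : gcamor L C := sval (cid pathmap_ex).
Lemma pathmap_gen w : pathmap (gen w) = lam (gen w) + hat (gen w) + H (pathmap (d1 L w) - lam (d1 L w)).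
Proof. by rewrite /pathmap; case: (cid _) => ? /=. Qed.

Lemma pathmap_lam_posweight x : pathmap x - lam x \in posweight L W1.
Proof.
move: x; apply: free_ind.
- by rewrite !gmor0 subrr rpred0.
- move=> a x y hx hy; rewrite !gmorL opprD addrACA -scalerBr.
  by rewrite rpredD ?rpredZ.
- by rewrite !gmor1 subrr rpred0.
move=> v x hx; rewrite !gmorM.
have -> : pathmap (gen v) * pathmap x - lam (gen v) * lam x =
  (pathmap (gen v) - lam (gen v)) * pathmap x + lam (gen v) * (pathmap x - lam x).
  by rewrite mulrBl mulrBr addrA subrK.
apply: rpredD; last exact: posweight_mull.
apply: posweight_mulr; rewrite pathmap_gen addrAC [lam _ + _]addrC addrK.
by rewrite rpredD ?posweight_hat ?posweight_homotopy_image.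
Qed.

Lemma pathmap_diff_aux (A : zmodType) (p q b c a : A) : p + q + b + (c - q + a) = p + b + a + c.
Proof. by rewrite [p + q + b]addrAC -[c - q + a]addrA [c + _]addrC -!addrA addNKr. Qed.
(** The contraction identity on pathmap(d1 w) - lam(d1 w), whose differential is known from
    the earlier stages. *)
Lemma pathmap_diff x : D (pathmap x) = pathmap (diff x).
Proof.
suff gw n w : w \in (F n : submodClosed W) -> D (pathmap (gen w)) = pathmap (diff (gen w)).
  have Pw w : D (pathmap (gen w)) = pathmap (diff (gen w)).
    by case: Ff => _ _ Fex; have [n wn] := Fex w; apply: gw wn.
  move: x; apply: free_ind.
  - by rewrite !(linear0, gmor0).
  - by move=> a x y hx hy; rewrite gmorL !linearP hx hy.
  - by rewrite gmor1 path_diff1 diff1 gmor0.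
  - by move=> v x hx; rewrite gmorM path_diffM diffMs gmorD !gmorM hx Pw gmor_sgn.
elim: n w => [|n IH] w wn.
  by case: Ff => F0 _ _; rewrite (F0 _ wn) !linear0.
have IHw x0 : x0 \in words_ge L (F n : submodClosed W) 0 -> D (pathmap x0) = pathmap (diff x0).
  move: x0; apply: words_ind.
  - by rewrite !(linear0, gmor0).
  - by move=> a y z hy hz; rewrite gmorL !linearP hy hz.
  - by rewrite gmor1 path_diff1 diff1 gmor0.
  - by move=> v y vn hy; rewrite gmorM path_diffM diffMs gmorD !gmorM hy IH // gmor_sgn.
have d1w := words_geS (leq0n 2) (d1_stage wn).
have e : D (pathmap (d1 L w) - lam (d1 L w)) = - (pathmap (d1 L (d0 L w)) - lam (d1 L (d0 L w))).
  by rewrite linearB (IHw _ d1w) -[D (lam _)]/(path_diff L W1 (lam _)) path_diff_lam diff_d1 !gmorN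
    opprB opprK addrC.
have h := posweight_homotopy char0 (pathmap_lam_posweight (d1 L w)).
rewrite e linearN in h.
have eD y : D (lam (gen w) + hat (gen w) + y) =
  lam (gen (d0 L w)) + lam (d1 L w) + hat (gen (d0 L w)) + D y.
  by rewrite !(linearD (path_diff L W1)) path_diff_lam path_diff_hat diff_genE gmorD.
rewrite diff_genE gmorD !pathmap_gen eD.
have {h} -> : D (H (pathmap (d1 L w) - lam (d1 L w))) =
  pathmap (d1 L w) - lam (d1 L w) + H (pathmap (d1 L (d0 L w)) - lam (d1 L (d0 L w))).
  by rewrite -[in RHS]h subrK.
exact: (pathmap_diff_aux (A := C)).
Qed.

Lemma path_proj_pathmap x : path_proj (pathmap x) = x.
Proof.
apply: (free_eq (f := gca_comp path_proj pathmap) (g := gca_id L)) => w.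
by rewrite -[LHS]/(path_proj (pathmap (gen w))) pathmap_gen !gmorD path_proj_lam path_proj_hat_gen
  path_proj_homotopy !addr0.
Qed.

(** Setting the letters lam to zero makes the map respect word length: a word of length i
    goes to a sum of words with at least i letters hat ([pathmap0_bideal]). *)
Definition pathmap0 : gcamor L C := gca_comp kill_lam pathmap.
Lemma pathmap0_gen w : pathmap0 (gen w) = hat (gen w) + H (pathmap0 (d1 L w)).
Proof.
rewrite -[LHS]/(kill_lam (pathmap (gen w))) pathmap_gen (gmorD kill_lam (_ + _)) (gmorD kill_lam (lam
  _)) kill_lam_lam_gen add0r kill_lam_hat kill_lam_homotopy.
have e : kill_lam (lam (d1 L w)) = 0 by apply/kill_lam_lam/(words_geS _ (d1_words L w)).
by rewrite (gmorB kill_lam) e subr0.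
Qed.
Lemma pathmap0_diff x : D (pathmap0 x) = pathmap0 (diff x).
Proof. by rewrite -[pathmap0 x]/(kill_lam (pathmap x)) -kill_lam_diff pathmap_diff. Qed.
End Phi.

Opaque kill_lam.

(** * Word length in the path algebra *)

Section Ideals.
Context {k : fieldType} (char0 : [pchar k] =i pred0) {W : gradedType k} (L : freeCDGA W).
Hypothesis W1 : concentrated_ge1 W.
Local Notation C := (path L W1).
Local Notation hat := (hat L W1).
Local Notation lam := (lam L W1).
Local Notation lamY := (lamY L W1).
Local Notation sus := (sus L W1).
Local Notation inY := (inY L W1).
Local Notation D := (path_diff L W1).
Local Notation th := (hat_to_sus L W1).
Local Notation H := (path_homotopy char0 L W1).
Local Notation Lop := (path_weight L W1).
Local Notation eg := (eig Lop).
Local Notation Y := (Yalg W1).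

Definition Yideal (j : nat) : grsub Y := prodsub lamY (gca_id Y) (wsub L (full W) j) (full Y).
(** Two lengths are recorded, i for the factors from f and j for the letters lam.  For
    f = hat the contraction uses up at most one factor ([bideal_homotopy]); for
    f = pathmap these are submodules for the action of the algebra through
    pathmap. *)
Definition bideal (f : gcamor L C) (E : grsub W) (i j : nat) : submodClosed C :=
  prodspan f inY (wsub L E i) (Yideal j).

Lemma Yideal_mul x u j : x \in words_ge L (full_pred W) j -> lamY x * u \in (Yideal j : submodClosed Y).
Proof. by move=> xj; apply: (prodspan_gen lamY (gca_id Y)). Qed.
Lemma Yideal_all u : u \in (Yideal 0 : submodClosed Y).
Proof. by rewrite -[u]mul1r -(gmor1 lamY); apply/Yideal_mul/words_ge1. Qed.
Lemma Yideal_mono i j : (i <= j)%N -> {subset (Yideal j : submodClosed Y) <= (Yideal i : submodClosed Y)}.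
Proof. by move=> ij; apply: prodspan_sub => // x; apply: words_geS. Qed.
Lemma YidealM i j y y' : y \in (Yideal i : submodClosed Y) -> y' \in (Yideal j : submodClosed Y) ->
  y * y' \in (Yideal (i + j) : submodClosed Y).
Proof. by apply: prodspanM => // a a'; apply: words_geM. Qed.

Lemma bidealM (f : gcamor L C) E i j i' j' x y : x \in bideal f E i j -> y \in bideal f E i' j' ->
  x * y \in bideal f E (i + i') (j + j').
Proof. by apply: prodspanM => a a'; [apply: words_geM|apply: YidealM]. Qed.
Lemma bideal_mono (f : gcamor L C) (E E' : grsub W) i j i' j' : {subset (E : submodClosed W) <= (E' :
  submodClosed W)} ->
  (i <= i')%N -> (j <= j')%N -> {subset bideal f E i' j' <= bideal f E' i j}.
Proof.
move=> EE ii jj; apply: prodspan_sub; last exact: Yideal_mono.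
by move=> x /(words_geS ii); apply: words_sub.
Qed.
Lemma bideal_gen (f : gcamor L C) (E : grsub W) i j a y : a \in words_ge L (E : submodClosed W) i ->
  y \in (Yideal j : submodClosed Y) ->
  f a * inY y \in bideal f E i j.
Proof. exact: (@prodspan_gen _ _ _ _ f inY (wsub L E i) (Yideal j)). Qed.
Lemma bideal_f (f : gcamor L C) (E : grsub W) i a : a \in words_ge L (E : submodClosed W) i ->
  f a \in bideal f E i 0.
Proof. by move=> aE; rewrite -[f a]mulr1 -(gmor1 inY); apply/bideal_gen/Yideal_all. Qed.
Lemma bideal_inY (f : gcamor L C) (E : grsub W) j y : y \in (Yideal j : submodClosed Y) ->
  inY y \in bideal f E 0 j.
Proof. by move=> yj; rewrite -[inY y]mul1r -(gmor1 f); apply/bideal_gen => //; apply: words_ge1. Qed.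
Lemma bideal_1 (f : gcamor L C) (E : grsub W) : 1 \in bideal f E 0 0.
Proof. by rewrite -(gmor1 inY); apply/bideal_inY/Yideal_all. Qed.
Lemma bideal_words (f g : gcamor L C) (E E' : grsub W) e i a :
  (forall v, v \in (E : submodClosed W) -> f (gen v) \in bideal g E' e 0) ->
  a \in words_ge L (E : submodClosed W) i -> f a \in bideal g E' (e * i) 0.
Proof.
move=> fE; move: a; apply: span_ind; first by rewrite gmor0 rpred0.
  by move=> c x y hx hy; rewrite gmorL rpredD ?rpredZ.
move=> _ [s [sE si ->]].
have: f (\prod_(v <- s) gen v) \in bideal g E' (e * size s) 0.
  elim: s sE {si} => [|v s IH] sE; first by rewrite big_nil gmor1 muln0 bideal_1.
  rewrite big_cons gmorM mulnS; apply: (bidealM (j := 0) (j' := 0)); first by apply/fE/sE/mem_head.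
  by apply: IH => w ws; apply: sE; rewrite inE ws orbT.
by apply: bideal_mono => //; rewrite leq_mul2l si orbT.
Qed.

(** For f = pathmap, the bijectivity of this substitution says that the path algebra is
    L (x) Y as a module over L through pathmap. *)
Definition hat_subst (f : gcamor L C) : gcamor C C := copair f inY.
Lemma hat_subst_hat (f : gcamor L C) a : hat_subst f (hat a) = f a. Proof. exact: copair_l. Qed.
Lemma hat_subst_inY (f : gcamor L C) y : hat_subst f (inY y) = inY y. Proof. exact: copair_r. Qed.
Lemma hat_subst_pure (f : gcamor L C) a y : hat_subst f (pure a y) = f a * inY y.
Proof. exact: copairE. Qed.
Opaque hat_subst.
Lemma hat_subst_bideal (f g : gcamor L C) (E E' : grsub W) i i' j x :
  (forall a, a \in words_ge L (E : submodClosed W) i -> f a \in bideal g E' i' 0) ->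
  x \in bideal hat E i j -> hat_subst f x \in bideal g E' i' j.
Proof.
move=> fE; move: x; apply: span_ind; first by rewrite gmor0 rpred0.
  by move=> c x y hx hy; rewrite gmorL rpredD ?rpredZ.
move=> _ [a [y [aE yj ->]]]; rewrite gmorM hat_subst_hat hat_subst_inY -[i']addn0 -[j]add0n.
apply: bidealM; [exact: fE|exact: bideal_inY].
Qed.
Lemma bideal_all x : x \in bideal hat (full W) 0 0.
Proof.
move: x; apply: (@tensor_ind _ _ _ (fun x : C => x \in bideal hat (full W) 0 0)).
- exact: rpred0.
- by move=> a x y hx hy; rewrite rpredD ?rpredZ.
move=> a y; have <- : hat a * inY y = pure a y by apply: in_lrE.
by apply: bideal_gen; [apply: words_full|apply: Yideal_all].
Qed.
Lemma bideal_mulr (f : gcamor L C) (E : grsub W) i j x y : x \in bideal f E i j ->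
  y \in bideal f E 0 0 -> x * y \in bideal f E i j.
Proof. by move=> hx hy; have := bidealM hx hy; rewrite !addn0. Qed.
Lemma bideal_mull (f : gcamor L C) (E : grsub W) i j x y : x \in bideal f E 0 0 ->
  y \in bideal f E i j -> x * y \in bideal f E i j.
Proof. by move=> hx hy; have := bidealM hx hy. Qed.

Lemma hat_to_sus_words (E : grsub W) i a : a \in words_ge L (E : submodClosed W) i ->
  th (hat a) \in bideal hat E i.-1 0.
Proof.
move: a; apply: span_ind; first by rewrite gmor0 linear0 rpred0.
  by move=> c x y hx hy; rewrite gmorL linearP rpredD ?rpredZ.
move=> _ [s [sE si ->]].
suff: th (hat (\prod_(v <- s) gen v)) \in bideal hat E (size s).-1 0.
  by apply: bideal_mono => //; case: (i) (size s) si => [|i'] [|m].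
elim: s sE {si} => [|v s IH] sE; first by rewrite big_nil gmor1 hat_to_sus1 rpred0.
have vE : v \in (E : submodClosed W) by apply/sE/mem_head.
have sE' : {subset s <= (E : submodClosed W)} by move=> w ws; apply: sE; rewrite inE ws orbT.
rewrite big_cons gmorM hat_to_susM hat_to_sus_hat -gmor_sgn; apply: rpredD.
  apply: (@bidealM _ _ 0 0 (size s) 0); first by rewrite -inY_susY; apply/bideal_inY/Yideal_all.
  by apply: bideal_f; apply: sub_span; exists s.
apply: (@bideal_mono hat E E (size s) 0 (1 + (size s).-1)%N (0 + 0)%N) => //; first exact: leqSpred.
apply: bidealM (IH sE'); apply: bideal_f.
have -> : sgn (gen v : L) = gen (sgn v) by rewrite (sgn_mor (f := gen)) // => j w; apply: grmor_homog.
by apply/words_gen/grsub_sgn.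
Qed.

Lemma bideal_hat_to_sus (E : grsub W) i j x : x \in bideal hat E i j -> th x \in bideal hat E i.-1 j.
Proof.
move: x; apply: span_ind; first by rewrite linear0 rpred0.
  by move=> c x y hx hy; rewrite linearP rpredD ?rpredZ.
move=> _ [a [y [aE yj ->]]]; rewrite hat_to_susM hat_to_sus_inY mulr0 addr0 -[i.-1]addn0 -[j]add0n.
by apply: bidealM; [apply: hat_to_sus_words|apply: bideal_inY].
Qed.

Lemma bideal_eig (E : grsub W) i j x : x \in bideal hat E i j -> x \in eigS (fun _ z =>
  z \in bideal hat E i j).
Proof.
move: x; apply: span_min => _ [a [y [aE yj ->]]].
have ha : hat a \in eigS (fun _ z => z \in bideal hat E i 0).
  move: a aE; apply: span_ind; first by rewrite gmor0 rpred0.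
    by move=> c x x' hx hx'; rewrite gmorL rpredD ?rpredZ.
  move=> _ [s [sE si ->]]; apply: sub_span; exists (size s); split; last first.
    by apply: bideal_f; apply: sub_span; exists s.
  elim: s {sE si} => [|v s IH]; first by rewrite big_nil gmor1; apply: eig_1.
  by rewrite big_cons gmorM; apply: (eigM (l := 1)) => //; apply: eig_hat.
have hu u : inY u \in eigS (fun _ z => z \in bideal hat E 0 0).
  move: u; apply: Y_ind.
  - by rewrite gmor0 rpred0.
  - by move=> c x x' hx hx'; rewrite gmorL rpredD ?rpredZ.
  - by rewrite gmor1; apply: sub_span; exists 0%N; split; [apply: eig_1|apply: bideal_1].
  - move=> x x'; rewrite gmorM; apply: eigSM => l m z z' zG zG' _ _; exact: (bidealM (i := 0) (j := 0)).
  - move=> w; apply: sub_span; exists 0%N; split; [exact: eig_lam|exact/bideal_inY/Yideal_all].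
  - move=> w; apply: sub_span; exists 1%N; split; [exact: eig_sus|exact/bideal_inY/Yideal_all].
have hy : inY y \in eigS (fun _ z => z \in bideal hat E 0 j).
  move: y yj; apply: span_ind; first by rewrite gmor0 rpred0.
    by move=> c x x' hx hx'; rewrite gmorL rpredD ?rpredZ.
  move=> _ [x [u [xj _ ->]]]; rewrite gmorM.
  apply: (eigSM (P := fun _ z => z \in bideal hat E 0 j) (P' := fun _ z =>
    z \in bideal hat E 0 0) _ _ (hu u)).
    by move=> l m z z' zG zG' _ _; apply: bideal_mulr.
  apply: sub_span; exists 0%N; split; first exact: eig_lam.
  by rewrite -[lamY x]mulr1; apply/bideal_inY/Yideal_mul.
apply: eigSM ha hy => l m z z' zG zG' _ _.
by rewrite -[i]addn0 -[j]add0n; apply: bidealM.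
Qed.

(** On an eigenvector the contraction is a multiple of [hat_to_sus], a derivation that
    replaces one letter hat. *)
Lemma bideal_homotopy (E : grsub W) i j x : x \in bideal hat E i j -> H x \in bideal hat E i.-1 j.
Proof.
move/bideal_eig; move: x; apply: span_ind; first by rewrite linear0 rpred0.
  by move=> c x y hx hy; rewrite linearP rpredD ?rpredZ.
by move=> x [l [xl xG]]; rewrite (path_homotopy_eig char0 xl) rpredZ //; apply: bideal_hat_to_sus.
Qed.

Lemma bideal_posweight (E : grsub W) i j x : x \in bideal hat E i.+1 j -> x \in posweight L W1.
Proof.
move: x; apply: span_min => _ [a [y [aE _ ->]]]; apply: posweight_mulr.
move: a aE; apply: words_geS_ind; first by rewrite gmor0 rpred0.
  by move=> c x x' hx hx'; rewrite gmorL rpredD ?rpredZ.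
by move=> v x _ _; rewrite gmorM; apply: posweight_mulr; apply: posweight_hat.
Qed.

Lemma hat_subst_agree (f g : gcamor L C) (E : grsub W) i j x :
  (forall v, v \in (E : submodClosed W) -> f (gen v) = g (gen v)) ->
  x \in bideal hat E i j -> hat_subst f x = hat_subst g x.
Proof.
move=> fg; apply: prodspan_agree => [a aE|b]; last by rewrite !hat_subst_inY.
rewrite !hat_subst_hat; apply: (@ext_agree _ _ L _ (E : submodClosed W)) => //.
exact: words_geS aE.
Qed.
Lemma hat_substK (f g : gcamor L C) : (forall w, hat_subst f (g (gen w)) = hat (gen w)) ->
  forall x, hat_subst f (hat_subst g x) = x.
Proof.
move=> fg; apply: (copair_eq (h := gca_comp (hat_subst f) (hat_subst g)) (h' := gca_id C)).
  move=> a; rewrite -[LHS]/(hat_subst f (hat_subst g (hat a))) hat_subst_hat.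
  exact: (free_eq (f := gca_comp (hat_subst f) g) (g := hat)).
by move=> b; rewrite -[LHS]/(hat_subst f (hat_subst g (inY b))) !hat_subst_inY.
Qed.

Context (F : nat -> grsub W).
Hypothesis Ff : filtration F.

(** If f w = hat w + r w, where r w involves only letters hat of earlier stages, then the
    inverse substitution is the recursive solution of g w = hat w - g(r w). *)
Lemma triangular_inverse (f : gcamor L C) :
  (forall n w, w \in (F n.+1 : submodClosed W) -> f (gen w) - hat (gen w) \in bideal hat (F n) 0 0) ->
  exists g : gcamor L C, [/\ forall x, hat_subst g (hat_subst f x) = x, forall x, hat_subst f
    (hat_subst g x) = x &
    (forall n w, w \in (F n.+1 : submodClosed W) -> f (gen w) - hat (gen w) \in bideal hat (F n) 1 0) ->
    forall w, g (gen w) \in bideal hat (full W) 1 0].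
Proof.
move=> fF; have [F0 FS Fex] := Ff.
pose r : {linear W -> C} := (f \o gen) \- (hat \o gen).
have rF n w : w \in (F n.+1 : submodClosed W) -> r w \in bideal hat (F n) 0 0 by apply: fF.
have psiH (g : gcamor L C) i w : w \in homog i -> ((hat \o gen) \- (hat_subst g \o r) : {linear W ->
  C}) w \in homog i.
  move=> wi; apply: homogB; first exact: (gcamor_homog hat (grmor_homog gen wi)).
  by apply: (gcamor_homog (hat_subst g)); apply: homogB; apply: gcamor_homog; apply: grmor_homog.
have [|g0 g0E] := @grmor_fixpoint k W C F (fun g => GrMor (psiH (ext L g))) Ff.
  move=> n g g' gg' w wn; rewrite -[LHS]/(hat (gen w) - hat_subst (ext L g) (r w)) -[RHS]/(hat (gen w)
    - hat_subst (ext L g') (r w)).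
  by congr (_ - _); apply: (hat_subst_agree _ (rF _ _ wn)) => v vn; rewrite !ext_gen gg'.
pose g := ext L g0; exists g.
have gE w : g (gen w) = hat (gen w) - hat_subst g (r w) by rewrite ext_gen g0E.
have fE w : f (gen w) = hat (gen w) + r w by rewrite addrC subrK.
have indF (P : W -> Prop) : P 0 -> (forall n, (forall w, w \in (F n : submodClosed W) -> P w) ->
    forall w, w \in (F n.+1 : submodClosed W) -> P w) -> forall w, P w.
  move=> P0 PS w; have [n] := Fex w; elim: n w => [|n IH] w wn; first by rewrite (F0 _ wn).
  exact: PS wn.
split.
- by apply: hat_substK => w; rewrite fE gmorD hat_subst_hat gE subrK.
- apply: hat_substK; apply: indF => [|n IH w wn]; first by rewrite !(linear0, gmor0).
  have e : hat_subst f (hat_subst g (r w)) = r w.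
    apply: (prodspan_agree (h := gca_comp (hat_subst f) (hat_subst g)) (h' := gca_id C)) (rF _ _ wn) =>
      [a aE|b];
      last by rewrite -[LHS]/(hat_subst f (hat_subst g (inY b))) !hat_subst_inY.
    rewrite -[LHS]/(hat_subst f (hat_subst g (hat a))) hat_subst_hat.
    exact: (@ext_agree _ _ L _ (F n : submodClosed W) (gca_comp (hat_subst f) g) hat IH _ aE).
  by rewrite gE gmorB e hat_subst_hat fE addrK.
move=> f1; apply: indF => [|n IH w wn]; first by rewrite !(linear0, gmor0) rpred0.
rewrite gE rpredB //; first by apply/bideal_f/words_gen.
apply: hat_subst_bideal (f1 _ _ wn) => a aE; rewrite -[1%N]mul1n.
exact: bideal_words aE.
Qed.
End Ideals.

(** * Trading hat letters for lam letters *)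

Lemma conj_derivation (k : fieldType) (A : gcaType k) (d : {linear A -> A}) (s s' : gcamor A A) :
  (forall x y, d (x * y) = d x * y + sgn x * d y) -> (forall x, s (s' x) = x) ->
  forall x y, d (x * y) - s (d (s' (x * y))) =
    (d x - s (d (s' x))) * y + sgn x * (d y - s (d (s' y))).
Proof.
move=> dM sK x y; rewrite gmorM !dM gmorD !gmorM -gmor_sgn !sK mulrBl mulrBr opprD.
by rewrite addrACA.
Qed.

Lemma conj_defectE (k : fieldType) (A : gcaType k) (d : {linear A -> A}) (s s' : gcamor A A) x y :
  s' x = y -> d x - s (d (s' x)) = d x - s (d y).
Proof. by move=> ->. Qed.

(** The homotopy h contracts s' x; transported back along s, the homotopy formula fails only
    by values of d - s d s'. *)
Lemma conj_trade (k : fieldType) (A : gcaType k) (d h : {linear A -> A}) (s s' : gcamor A A) x :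
  (forall x, s (s' x) = x) -> (forall x, s' (s x) = x) ->
  d x = 0 -> d (h (s' x)) + h (d (s' x)) = s' x ->
  x - d (s (h (s' x))) = - ((d (s (h (s' x))) - s (d (s' (s (h (s' x)))))) + s (h (s' (d x - s (d (s'
    x)))))).
Proof.
move=> sK s'K dx hx; rewrite dx sub0r gmorN !s'K linearN gmorN -{1}[x]sK -{1}hx gmorD.
rewrite opprD opprB opprK; move: (s (d _)) (d (s _)) (s (h _)) => p q r.
by rewrite addrAC.
Qed.

Section Sigma.
Context {k : fieldType} (char0 : [pchar k] =i pred0) {W : gradedType k} (L : freeCDGA W).
Hypothesis W1 : concentrated_ge1 W.
Local Notation C := (path L W1).
Local Notation hat := (hat L W1).
Local Notation lam := (lam L W1).
Local Notation lamY := (lamY L W1).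
Local Notation sus := (sus L W1).
Local Notation inY := (inY L W1).
Local Notation D := (path_diff L W1).
Local Notation H := (path_homotopy char0 L W1).
Local Notation Y := (Yalg W1).
Local Notation kill_lam := (kill_lam L W1).
Local Notation path_proj := (path_proj L W1).
Local Notation Yideal := (Yideal L W1).
Context (F : nat -> grsub W).
Hypothesis Ff : filtration F.
Hypothesis Fd : forall n w, w \in (F n.+1 : submodClosed W) -> diff (gen w) \in words_ge L (F n :
  submodClosed W) 0.
Local Notation pathmap := (pathmap char0 W1 Ff Fd).
Local Notation pathmap0 := (pathmap0 char0 W1 Ff Fd).

Lemma filtration_ind (P : W -> Prop) : P 0 -> (forall n, (forall w, w \in (F n : submodClosed W) -> P w) ->
    forall w, w \in (F n.+1 : submodClosed W) -> P w) -> forall w, P w.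
Proof.
move=> P0 PS w; have [F0 FS Fex] := Ff.
have [n] := Fex w; elim: n w => [|n IH] w wn; first by rewrite (F0 _ wn).
exact: PS wn.
Qed.

Lemma pathmap0_gen_bideal n w : w \in (F n : submodClosed W) -> pathmap0 (gen w) \in bideal hat (F n) 1 0.
Proof.
have [F0 FS Fex] := Ff; elim: n w => [|n IH] w wn; first by rewrite (F0 _ wn) !(linear0, gmor0) rpred0.
rewrite pathmap0_gen rpredD //; first by apply/bideal_f/words_gen.
have h := bideal_words IH (d1_stage Fd wn); have h' := bideal_homotopy char0 h.
exact: bideal_mono (FS n) _ _ _ h'.
Qed.
Lemma pathmap0_tri n w : w \in (F n.+1 : submodClosed W) ->
  pathmap0 (gen w) - hat (gen w) \in bideal hat (F n) 1 0.
Proof.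
move=> wn; rewrite pathmap0_gen addrAC subrr add0r.
exact (bideal_homotopy char0 (bideal_words (@pathmap0_gen_bideal n) (d1_stage Fd wn))).
Qed.
Lemma pathmap0_bideal i a : a \in words_ge L (full_pred W) i -> pathmap0 a \in bideal hat (full W) i 0.
Proof.
move=> ai; rewrite -[i]mul1n; apply: (bideal_words (E := full W) _ ai) => v _.
by have [_ _ Fex] := Ff; have [n vn] := Fex v; apply: bideal_mono (pathmap0_gen_bideal vn).
Qed.

Lemma pathmap_gen_bideal n w : w \in (F n : submodClosed W) -> pathmap (gen w) \in bideal hat (F n) 0 0.
Proof.
have [F0 FS Fex] := Ff; elim: n w => [|n IH] w wn; first by rewrite (F0 _ wn) !(linear0, gmor0) rpred0.
rewrite pathmap_gen; apply: rpredD; first apply: rpredD.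
- by rewrite -inY_lamY; apply/bideal_inY/Yideal_all.
- by apply/bideal_f/(words_geS (leq0n 1))/words_gen.
have h := bideal_words IH (d1_stage Fd wn).
have h' : pathmap (d1 L w) - lam (d1 L w) \in bideal hat (F n) 0 0.
  by apply: rpredB => //; rewrite -inY_lamY; apply/bideal_inY/Yideal_all.
exact: bideal_mono (FS n) _ _ _ (bideal_homotopy char0 h').
Qed.
Lemma pathmap_tri n w : w \in (F n.+1 : submodClosed W) ->
  pathmap (gen w) - hat (gen w) \in bideal hat (F n) 0 0.
Proof.
move=> wn; rewrite pathmap_gen addrAC -[lam _ + _ - _]addrA subrr addr0.
apply: rpredD; first by rewrite -inY_lamY; apply/bideal_inY/Yideal_all.
have h : pathmap (d1 L w) - lam (d1 L w) \in bideal hat (F n) 0 0.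
  apply: rpredB; first exact (bideal_words (@pathmap_gen_bideal n) (d1_stage Fd wn)).
  by rewrite -inY_lamY; apply/bideal_inY/Yideal_all.
exact (bideal_homotopy char0 h).
Qed.

Definition pathmap_inv_ex := triangular_inverse Ff pathmap_tri.
Definition pathmap_inv : gcamor L C := sval (cid pathmap_inv_ex).
Lemma pathmapK x : hat_subst pathmap_inv (hat_subst pathmap x) = x.
Proof. by rewrite /pathmap_inv; case: (cid _) => g []. Qed.
Lemma pathmap_invK x : hat_subst pathmap (hat_subst pathmap_inv x) = x.
Proof. by rewrite /pathmap_inv; case: (cid _) => g []. Qed.
Lemma pathmap0_tri0 n w : w \in (F n.+1 : submodClosed W) ->
  pathmap0 (gen w) - hat (gen w) \in bideal hat (F n) 0 0.
Proof. by move=> /pathmap0_tri; apply: bideal_mono. Qed.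
Definition pathmap0_inv_ex := triangular_inverse Ff pathmap0_tri0.
Definition pathmap0_inv : gcamor L C := sval (cid pathmap0_inv_ex).
Lemma pathmap0K x : hat_subst pathmap0_inv (hat_subst pathmap0 x) = x.
Proof. by rewrite /pathmap0_inv; case: (cid _) => g []. Qed.
Lemma pathmap0_invK x : hat_subst pathmap0 (hat_subst pathmap0_inv x) = x.
Proof. by rewrite /pathmap0_inv; case: (cid _) => g []. Qed.
Lemma pathmap0_inv_bideal i a : a \in words_ge L (full_pred W) i ->
  pathmap0_inv a \in bideal hat (full W) i 0.
Proof.
move=> ai; rewrite -[i]mul1n; apply: (bideal_words (E := full W) _ ai) => v _.
have [_ _ h] := svalP (cid pathmap0_inv_ex); exact: h pathmap0_tri v.
Qed.

(** The automorphism that fixes lam and sus and carries pathmap0, which respects lengths, to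
    the chain map pathmap. *)
Definition twist : gcamor C C := gca_comp (hat_subst pathmap) (hat_subst pathmap0_inv).
Definition untwist : gcamor C C := gca_comp (hat_subst pathmap0) (hat_subst pathmap_inv).
Lemma twistK x : untwist (twist x) = x.
Proof. exact: etrans (congr1 (hat_subst pathmap0) (pathmapK (hat_subst pathmap0_inv x))) (pathmap0_invK
  x). Qed.
Lemma untwistK x : twist (untwist x) = x.
Proof. exact: etrans (congr1 (hat_subst pathmap) (pathmap0K (hat_subst pathmap_inv x))) (pathmap_invK
  x). Qed.
Lemma untwist_pathmap a : untwist (pathmap a) = pathmap0 a.
Proof. by rewrite -[LHS]/(hat_subst pathmap0 (hat_subst pathmap_inv (pathmap a))) -(hat_subst_hat
  pathmap) pathmapK hat_subst_hat. Qed.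
Lemma twist_pathmap0 a : twist (pathmap0 a) = pathmap a.
Proof. by rewrite -untwist_pathmap untwistK. Qed.
Lemma twist_inY y : twist (inY y) = inY y.
Proof. by rewrite -[LHS]/(hat_subst pathmap (hat_subst pathmap0_inv (inY y))) !hat_subst_inY. Qed.
Lemma untwist_inY y : untwist (inY y) = inY y.
Proof. by rewrite -{1}[inY y]twist_inY twistK. Qed.

Local Notation GG := (bideal pathmap (full W)).
Local Notation GL := (bideal hat (full W)).
Lemma hat_subst_pathmap_bideal i j x : x \in GL i j -> hat_subst pathmap x \in GG i j.
Proof. by apply: hat_subst_bideal => a ai; apply: (bideal_f pathmap (E := full W)). Qed.
Lemma hat_subst_inv_bideal i j x : x \in GG i j -> hat_subst pathmap_inv x \in GL i j.
Proof.
move: x; apply: span_ind; first by rewrite gmor0 rpred0.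
  by move=> c x y hx hy; rewrite gmorL rpredD ?rpredZ.
move=> _ [a [y [aE yj ->]]]; rewrite gmorM hat_subst_inY -(hat_subst_hat pathmap) pathmapK.
exact: bideal_gen.
Qed.
Lemma twist_bideal i j x : x \in GL i j -> twist x \in GG i j.
Proof. by move=> xG; apply/hat_subst_pathmap_bideal/(hat_subst_bideal (i' := i) _
  xG)/pathmap0_inv_bideal. Qed.
Lemma untwist_bideal i j x : x \in GG i j -> untwist x \in GL i j.
Proof. by move=> /hat_subst_inv_bideal xG; apply/(hat_subst_bideal (i' := i) _ xG)/pathmap0_bideal. Qed.
Lemma pathmap_bideal_all x : x \in GG 0 0.
Proof. by rewrite -[x]pathmap_invK; apply/hat_subst_pathmap_bideal/bideal_all. Qed.

Lemma kill_lam_hat_subst (f : gcamor L C) : (forall a, kill_lam (f a) = pathmap0 a) ->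
  forall x, kill_lam (hat_subst f x) = hat_subst pathmap0 (kill_lam x).
Proof.
move=> fp; apply: (path_eq (f := gca_comp kill_lam (hat_subst f)) (g := gca_comp (hat_subst pathmap0)
  kill_lam)) => w;
  rewrite -[LHS]/(kill_lam (hat_subst f _)) -[RHS]/(hat_subst pathmap0 (kill_lam _)).
- by rewrite kill_lam_hat !hat_subst_hat fp.
- by rewrite kill_lam_lam_gen gmor0 -inY_lamY hat_subst_inY inY_lamY kill_lam_lam_gen.
- by rewrite -!inY_susY hat_subst_inY inY_susY kill_lam_sus -inY_susY hat_subst_inY.
Qed.
Lemma kill_lam_twist x : kill_lam (twist x) = kill_lam x.
Proof.
rewrite -[twist x]/(hat_subst pathmap (hat_subst pathmap0_inv x)) kill_lam_hat_subst //.
by rewrite -(kill_lam_hat_subst (f := pathmap0)) ?pathmap0_invK // => a; rewrite kill_lam_idem.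
Qed.

Lemma kill_lam_ideal x : x - kill_lam x \in GG 0 1.
Proof.
move: x; apply: path_ind.
- by rewrite gmor0 subrr rpred0.
- by move=> a x y hx hy; rewrite gmorL opprD addrACA -scalerBr rpredD ?rpredZ.
- by rewrite gmor1 subrr rpred0.
- move=> x y hx hy; rewrite gmorM.
  have -> : x * y - kill_lam x * kill_lam y = (x - kill_lam x) * y + kill_lam x * (y - kill_lam y).
    by rewrite mulrBl mulrBr addrA subrK.
  apply: rpredD; first exact: (bideal_mulr hx (pathmap_bideal_all _)).
  exact: (bideal_mull (pathmap_bideal_all _) hy).
- by move=> w; rewrite kill_lam_hat subrr rpred0.
- move=> w; rewrite kill_lam_lam_gen subr0 -inY_lamY -[lamY _]mulr1; apply/bideal_inY/Yideal_mul.
  exact: words_gen.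
- by move=> w; rewrite kill_lam_sus subrr rpred0.
Qed.

Opaque twist untwist.
(** The failure of [twist] to be a chain map.  It vanishes on the images of pathmap and lam,
    and on sus w it is hat w - twist (hat w), which lies in the ideal of the letters
    lam because twist is the identity modulo them ([kill_lam_twist]).  So the
    defect always creates a letter lam. *)
Definition defect : {linear C -> C} := D \- (twist \o D \o untwist).
Lemma defectM x y : defect (x * y) = defect x * y + sgn x * defect y.
Proof. exact: (conj_derivation (@path_diffM _ _ L W1) untwistK). Qed.
Lemma defect_pathmap a : defect (pathmap a) = 0.
Proof.
have e : twist (D (pathmap0 a)) = D (pathmap a) by rewrite pathmap0_diff twist_pathmap0 pathmap_diff.
by rewrite [defect _](conj_defectE D twist (untwist_pathmap a)) e subrr.
Qed.
Lemma defect_lam x : defect (lam x) = 0.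
Proof.
have e : twist (D (lam x)) = D (lam x) by rewrite path_diff_lam; exact: twist_inY (lamY (diff x)).
by rewrite [defect _](conj_defectE D twist (untwist_inY (lamY x))) e subrr.
Qed.
Lemma defect_sus w : defect (sus w) \in GG 0 1.
Proof.
have -> : defect (sus w) = D (sus w) - twist (D (sus w)) by exact: conj_defectE (untwist_inY (susY W1 w)).
rewrite path_diff_sus gmorB; have -> : twist (sus (d0 L w)) = sus (d0 L w) by exact: twist_inY (susY W1 _).
have e (p q r : C) : p - q - (r - q) = p - r by rewrite opprB addrA subrK.
rewrite e; have e2 : kill_lam (hat (gen w) - twist (hat (gen w))) = 0 by rewrite (gmorB kill_lam)
  kill_lam_twist subrr.
by rewrite -[_ - _]subr0 -e2; apply: kill_lam_ideal.
Qed.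
Lemma defect_inY y : defect (inY y) \in GG 0 1.
Proof.
move: y; apply: (Y_ind (L := L)).
- by rewrite gmor0 linear0 rpred0.
- by move=> c x y hx hy; rewrite gmorL linearP rpredD ?rpredZ.
- by rewrite gmor1 -(gmor1 pathmap) defect_pathmap rpred0.
- move=> x y hx hy; rewrite gmorM defectM rpredD //; first exact: (bideal_mulr hx (pathmap_bideal_all _)).
  exact: (bideal_mull (pathmap_bideal_all _) hy).
- by move=> w; rewrite [defect _](defect_lam (gen w)) rpred0.
- exact: defect_sus.
Qed.
Lemma defect_bideal i j x : x \in GG i j -> defect x \in GG i j.+1.
Proof.
move: x; apply: span_ind; first by rewrite linear0 rpred0.
  by move=> c x y hx hy; rewrite linearP rpredD ?rpredZ.
move=> _ [a [y [aE yj ->]]]; rewrite defectM defect_pathmap mul0r add0r -gmor_sgn.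
rewrite -[i]addn0 -[j.+1]add0n; apply: bidealM.
  by apply: (bideal_f pathmap (E := full W)); apply: (grsub_sgn (S := wsub L (full W) i)).
move: y yj; apply: span_ind; first by rewrite gmor0 linear0 rpred0.
  by move=> c x y hx hy; rewrite gmorL linearP rpredD ?rpredZ.
move=> _ [x [u [xj _ ->]]]; rewrite gmorM inY_lamY defectM defect_lam mul0r add0r -gmor_sgn -addn1.
apply: (@bidealM _ _ _ _ _ _ 0 j 0 1); last exact: defect_inY.
rewrite -inY_lamY -[lamY _]mulr1; apply/bideal_inY/Yideal_mul.
exact: (grsub_sgn (S := wsub L (full W) j)).
Qed.

Lemma path_proj_bideal i j x : x \in GG i j -> path_proj x \in words_ge L (full_pred W) (i + j).
Proof.
move: x; apply: span_ind; first by rewrite gmor0 rpred0.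
  by move=> c x y hx hy; rewrite gmorL rpredD ?rpredZ.
move=> _ [a [y [aE yj ->]]]; rewrite gmorM path_proj_pathmap; apply: words_geM => //.
move: y yj; apply: span_ind; first by rewrite !gmor0 rpred0.
  by move=> c x y hx hy; rewrite !gmorL rpredD ?rpredZ.
move=> _ [x [u [xj _ ->]]]; rewrite !gmorM inY_lamY path_proj_lam -[j]addn0.
by apply: words_geM => //; apply: words_full.
Qed.

(** Since untwist x has positive weight, it can be contracted, and b is the contraction
    transported back.  What remains consists of values of the defect, so it has a
    letter lam in place of a factor pathmap w. *)
Lemma trade i j x : x \in GG i.+1 j -> D x = 0 ->
  exists b, b \in GG i j /\ x - D b \in GG i j.+1.
Proof.
move=> xG Dx; have yG := untwist_bideal xG; exists (twist (H (untwist x))).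
have bG := bideal_homotopy char0 yG.
split; first exact: twist_bideal.
have -> := conj_trade (h := H) untwistK twistK Dx (posweight_homotopy char0 (bideal_posweight yG)).
rewrite rpredN; refine (rpredD (defect_bideal (twist_bideal bG)) (twist_bideal _)).
exact (bideal_homotopy char0 (untwist_bideal (defect_bideal xG))).
Qed.

(** Along the q trades the two lengths of the primitives add up to i + j + q - 1, and their
    sum is the word length after projection. *)
Lemma trade_iter i q j x : x \in GG (i + q) j -> D x = 0 ->
  exists c, [/\ c \in GG i (j + q), D c = 0 &
    exists b, path_proj c = path_proj x - diff b /\ b \in words_ge L (full_pred W) (i + j + q).-1].
Proof.
elim: q j x => [|q IH] j x; first rewrite addn0 => xG Dx.
  by exists x; rewrite addn0; split=> //; exists 0; rewrite linear0 subr0 rpred0.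
rewrite addnS => xG Dx; have [b [bG xbG]] := trade xG Dx.
have Dxb : D (x - D b) = 0 by rewrite linearB Dx path_diffK subrr.
have [c [cG Dc [b' [e b'L]]]] := IH _ _ xbG Dxb.
exists c; rewrite addnS -addSn; split=> //; exists (path_proj b + b').
rewrite linearD opprD addrA e gmorB path_proj_diff; split=> //; rewrite addnS /=.
apply: rpredD; first by have := path_proj_bideal bG; rewrite addnAC.
by move: b'L; rewrite addnS addSn.
Qed.
End Sigma.

(** * Stages of a tensor decomposition *)

Section Stages.
Context {k : fieldType} {A Y T : gcaType k} (f : gcamor A T) (t : gcamor Y T) (D : {linear T -> T}).
Hypothesis DM : forall x y, D (x * y) = D x * y + sgn x * D y.
Hypothesis Dh : forall i x, x \in homog i -> D x \in homog (i + 1).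
Local Notation AS E := (prodspan f t (full A) E).

Lemma stage_span_t (E : grsub Y) y : y \in (E : submodClosed Y) -> t y \in AS E.
Proof. by move=> yE; rewrite -[t y]mul1r -(gmor1 f); apply: prodspan_gen. Qed.
Lemma stage_span_sub (E E' : grsub Y) : {subset (E : submodClosed Y) <= (E' : submodClosed Y)} ->
  {subset AS E <= AS E'}.
Proof. by move=> EE; apply: prodspan_sub. Qed.
Lemma stage_spanM (E E' E'' : grsub Y) :
  (forall y y', y \in (E : submodClosed Y) -> y' \in (E' : submodClosed Y) -> y * y' \in (E'' :
    submodClosed Y)) ->
  forall x x', x \in AS E -> x' \in AS E' -> x * x' \in AS E''.
Proof. by move=> EE; apply: prodspanM. Qed.

Section Stage.
Context (S E : grsub Y).
Definition stage_pred : {pred Y} := fun y => (y \in (S : submodClosed Y)) && (D (t y) \in AS E).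
Let stageE y : (y \in stage_pred) = (y \in (S : submodClosed Y)) && (D (t y) \in AS E).
Proof. by []. Qed.
Fact stage_closed : submod_closed stage_pred.
Proof.
split=> [|a x y]; rewrite !stageE; first by rewrite gmor0 linear0 !rpred0.
by move=> /andP[hx hx'] /andP[hy hy']; rewrite gmorL linearP !rpredD ?rpredZ.
Qed.
HB.instance Definition _ := GRing.isSubmodClosed.Build k Y stage_pred stage_closed.
Fact stage_pr i y : y \in stage_pred -> pr i y \in stage_pred.
Proof.
rewrite !stageE => /andP[yS DyE]; rewrite grsub_pr // andTb.
rewrite -[t (pr i y)](linear_pr_shift (f := t) (e := 0)) => [|j x xj]; last first.
  by rewrite addr0; apply: gcamor_homog.
by rewrite addr0 -(linear_pr_shift Dh); apply: prodspan_pr.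
Qed.
Definition stage : grsub Y := GrSub (grsub_sub := stage_pred) stage_pr.
End Stage.

(** The largest filtration with F_0 = 0 and D F_{n+1} in the span of the f(a) F_n.  Being
    the largest, it is compatible with products ([stagesM]), so that it suffices to
    find the generators in it. *)
Fixpoint stages (S : grsub Y) (n : nat) : grsub Y :=
  if n is m.+1 then stage S (stages S m) else zero_grsub Y.

Lemma stagesS S n y : (y \in (stages S n.+1 : submodClosed Y)) =
  (y \in (S : submodClosed Y)) && (D (t y) \in AS (stages S n)).
Proof. by []. Qed.
Lemma stages_sub S n : {subset (stages S n : submodClosed Y) <= (S : submodClosed Y)}.
Proof.
case: n => [|n] y; first by move/zero_grsubP => ->; apply: rpred0.
by rewrite stagesS => /andP[].
Qed.
Lemma stages_succ S n : {subset (stages S n : submodClosed Y) <= (stages S n.+1 : submodClosed Y)}.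
Proof.
elim: n => [|n IH] y; first by move/zero_grsubP => ->; apply: rpred0.
rewrite stagesS => /andP[yS yD]; rewrite stagesS yS andTb.
exact: stage_span_sub yD.
Qed.
Lemma stages_mono S n m : (n <= m)%N -> {subset (stages S n : submodClosed Y) <= (stages S m :
  submodClosed Y)}.
Proof.
move=> nm; elim: m nm => [|m IH]; first by rewrite leqn0 => /eqP ->.
by rewrite leq_eqVlt => /orP[/eqP ->//|/IH h] y /h /stages_succ.
Qed.
Lemma stages_subS (S S' : grsub Y) n : {subset (S : submodClosed Y) <= (S' : submodClosed Y)} ->
  {subset (stages S n : submodClosed Y) <= (stages S' n : submodClosed Y)}.
Proof.
move=> SS; elim: n => [//|n IH] y; rewrite !stagesS => /andP[/SS ->]; rewrite andTb.
exact: stage_span_sub.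
Qed.
Lemma stages1 (S : grsub Y) : 1 \in (S : submodClosed Y) -> D 1 = 0 -> 1 \in (stages S 1 : submodClosed Y).
Proof. by move=> S1 D1; rewrite stagesS S1 gmor1 D1 rpred0. Qed.
Lemma stagesM (S S' S'' : grsub Y) n n' :
  (forall y y', y \in (S : submodClosed Y) -> y' \in (S' : submodClosed Y) -> y * y' \in (S'' :
    submodClosed Y)) ->
  forall y y', y \in (stages S n : submodClosed Y) -> y' \in (stages S' n' : submodClosed Y) ->
    y * y' \in (stages S'' (n + n') : submodClosed Y).
Proof.
move=> SS; elim: n n' => [|n IHn] n' y y'; first by move/zero_grsubP => ->; rewrite mul0r rpred0.
elim: n' y y' => [|n' IHn'] y y' yn; first by move/zero_grsubP => ->; rewrite mulr0 rpred0.
move=> yn'; rewrite addSn stagesS SS ?(stages_sub yn) ?(stages_sub yn') // andTb gmorM DM.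
move: (yn) (yn'); rewrite !stagesS => /andP[_ Dy] /andP[_ Dy'].
apply: rpredD; first exact: (stage_spanM (E' := stages S' n'.+1) (IHn n'.+1) Dy (stage_span_t yn')).
rewrite -gmor_sgn addnS -addSn.
by apply: (stage_spanM (E := stages S n.+1) IHn' _ Dy'); apply/stage_span_t/grsub_sgn.
Qed.
End Stages.

(** * The path algebra is semifree *)

Lemma stage_cocycle_exact (k : fieldType) (A : cdgaType k) (Y T : gcaType k) (f : gcamor A T)
    (t : gcamor Y T) (D : {linear T -> T}) (S : grsub Y) (P M : dgmod A) (g : dgmor P M)
    (eps : {linear T -> M}) (I : dgsub (regular A)) (c : T)
    (Dh : forall i x, x \in homog i -> D x \in homog (i + 1)) :
  (forall x y, D (x * y) = D x * y + sgn x * D y) ->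
  (forall x, D (D x) = 0) -> (forall a, D (f a) = f (diff a)) ->
  is_tensor (fun a y => f a * t y) -> quasi_iso g ->
  (forall a y, eps (f a * t y) = act a (eps (t y))) ->
  (forall n y, y \in (stages f t Dh S n : submodClosed Y) -> mdiff (eps (t y)) = eps (D (t y))) ->
  (forall y, y \in (S : submodClosed Y) -> exists n, y \in (stages f t Dh S n : submodClosed Y)) ->
  cohomology_inj (quo_pi _ : P -> quo_dgmod (ideal_act I P)) ->
  c \in span [set x | exists a y, [/\ a \in (I : submodClosed (regular A)), y \in (S :
    submodClosed Y) & x = f a * t y]]%classic ->
  D c = 0 -> exists m, eps c = mdiff m.
Proof.
move=> DM DD Df tens gq eps_act epsD Sex inj cI Dc.
have alR a : linear (fun x : T => f a * x) by move=> b x y; rewrite mulrDr scalerAr.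
have [N cN] : exists N, c \in span [set x | exists a y, [/\ a \in (I : submodClosed (regular A)),
    y \in (stages f t Dh S N : submodClosed Y) & x = f a * t y]]%classic.
  move: cI; move: (c); apply: span_ind.
  - by exists 0%N; apply: rpred0.
  - move=> a x y [N xN] [N' yN]; exists (maxn N N'); rewrite rpredD ?rpredZ //.
      move: xN; apply: span_min => _ [b [z [bI zN ->]]]; apply: sub_span; exists b, z; split=> //.
      exact: (stages_mono (leq_maxl N N')).
    move: yN; apply: span_min => _ [b [z [bI zN ->]]]; apply: sub_span; exists b, z; split=> //.
    exact: (stages_mono (leq_maxr N N')).
  move=> _ [a [y [aI /Sex[N yN] ->]]]; exists N; apply: sub_span; by exists a, y.
apply: (@ideal_cocycle_exact k A P M g gq T Y (fun a x => f a * x) D t alR _ _ DD tens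
  (fun n => stages f t Dh S n : submodClosed Y) _ _ _ eps eps_act epsD I N c inj cN Dc).
- by move=> a b x; rewrite gmorM mulrA.
- by move=> a x; rewrite DM Df gmor_sgn.
- exact: stages_succ.
- exact: zero_grsubP.
- move=> n y; rewrite stagesS => /andP[_]; apply: span_min => _ [a [z [_ zn ->]]].
  by apply: sub_span; exists a, z.
Qed.

Lemma is_tensor_bij (k : fieldType) (U V T T' : lmodType k) (b : U -> V -> T) (s : {linear T ->
  T'}) (s' : {linear T' -> T}) :
  (forall x, s (s' x) = x) -> (forall x, s' (s x) = x) -> is_tensor b -> is_tensor (fun u v => s (b u v)).
Proof.
move=> sK s'K [[bl br] bU]; split.
  split=> [u a x y|v a x y]; first by rewrite bl linearP.
  by rewrite br linearP.
move=> X c bc; have [g [gE gU]] := bU X c bc; exists (g \o s'); split=> [u v|g' g'E x].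
  by rewrite /= s'K gE.
by rewrite -[x in LHS]sK /=; apply: (gU (g' \o s)).
Qed.

Section ClaimA.
Context {k : fieldType} (char0 : [pchar k] =i pred0) {W : gradedType k} (L : freeCDGA W).
Hypothesis W1 : concentrated_ge1 W.
Local Notation C := (path L W1).
Local Notation hat := (hat L W1).
Local Notation lam := (lam L W1).
Local Notation lamY := (lamY L W1).
Local Notation susY := (susY W1).
Local Notation sus := (sus L W1).
Local Notation inY := (inY L W1).
Local Notation D := (path_diff L W1).
Local Notation th := (hat_to_sus L W1).
Local Notation H := (path_homotopy char0 L W1).
Local Notation Y := (Yalg W1).
Local Notation path_proj := (path_proj L W1).
Local Notation Yideal := (Yideal L W1).
Context (F : nat -> grsub W).
Hypothesis Ff : filtration F.
Hypothesis Fd : forall n w, w \in (F n.+1 : submodClosed W) -> diff (gen w) \in words_ge L (F n :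
  submodClosed W) 0.
Local Notation pathmap := (pathmap char0 W1 Ff Fd).

(** The letters of one stage generate a subalgebra that is stable under the contraction,
    hence contains the corrections in the values of pathmap on the next stage. *)
Inductive gen_by (E : grsub W) : C -> Prop :=
| gen_by0 : gen_by E 0
| gen_byL a x y : gen_by E x -> gen_by E y -> gen_by E (a *: x + y)
| gen_by1 : gen_by E 1
| gen_byM x y : gen_by E x -> gen_by E y -> gen_by E (x * y)
| gen_by_hat w : w \in (E : submodClosed W) -> gen_by E (hat (gen w))
| gen_by_lam w : w \in (E : submodClosed W) -> gen_by E (lam (gen w))
| gen_by_sus w : w \in (E : submodClosed W) -> gen_by E (sus w).

Lemma gen_by_mono (E E' : grsub W) x : {subset (E : submodClosed W) <= (E' : submodClosed W)} ->
  gen_by E x -> gen_by E' x.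
Proof.
move=> EE; elim=> *; [exact: gen_by0|exact: gen_byL|exact: gen_by1|exact: gen_byM|
  exact/gen_by_hat/EE|exact/gen_by_lam/EE|exact/gen_by_sus/EE].
Qed.
Lemma gen_by_words (f : gcamor L C) (E : {pred W}) (E' : grsub W) a :
  (forall v, v \in E -> gen_by E' (f (gen v))) ->
  a \in words_ge L E 0 -> gen_by E' (f a).
Proof.
move=> fE; move: a; apply: words_ind.
- by rewrite gmor0; apply: gen_by0.
- by move=> a x y hx hy; rewrite gmorL; apply: gen_byL.
- by rewrite gmor1; apply: gen_by1.
- by move=> v x vE hx; rewrite gmorM; apply: gen_byM => //; apply: fE.
Qed.
Lemma gen_by_sgn (E : grsub W) x : gen_by E x -> gen_by E (sgn x).
Proof.
have sg v : sgn (gen v : L) = gen (sgn v) by rewrite (sgn_mor (f := gen)) // => j w; apply: grmor_homog.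
elim=> [|a y z _ hy _ hz||y z _ hy _ hz|w wE|w wE|w wE].
- by rewrite linear0; apply: gen_by0.
- by rewrite linearP; apply: gen_byL.
- by rewrite sgn1; apply: gen_by1.
- by rewrite sgnM; apply: gen_byM.
- by rewrite -gmor_sgn sg; apply/gen_by_hat/grsub_sgn.
- by rewrite -gmor_sgn sg; apply/gen_by_lam/grsub_sgn.
have -> : sgn (sus w) = sus (- sgn w).
  by rewrite linearN (sgn_odd (e := -1) sgN1) ?opprK // => j v; apply: sus_homog.
by apply: gen_by_sus; rewrite -scaleN1r rpredZ //; apply: grsub_sgn.
Qed.
Lemma gen_by_hat_to_sus (E : grsub W) x : gen_by E x -> gen_by E (th x).
Proof.
elim=> [|a y z _ hy _ hz||y z gy hy gz hz|w wE|w wE|w wE].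
- by rewrite linear0; apply: gen_by0.
- by rewrite linearP; apply: gen_byL.
- by rewrite hat_to_sus1; apply: gen_by0.
- rewrite hat_to_susM -[X in X + _]scale1r; apply: gen_byL; first exact: gen_byM.
  by apply: gen_byM => //; apply: gen_by_sgn.
- by rewrite hat_to_sus_hat; apply: gen_by_sus.
- by rewrite hat_to_sus_lam; apply: gen_by0.
- by rewrite hat_to_sus_sus; apply: gen_by0.
Qed.
Lemma gen_by_eig (E : grsub W) x : gen_by E x -> x \in eigS (fun _ z => gen_by E z).
Proof.
elim=> [|a y z _ hy _ hz||y z gy hy gz hz|w wE|w wE|w wE].
- exact: rpred0.
- by rewrite rpredD ?rpredZ.
- by apply: sub_span; exists 0%N; split; [apply: eig_1|apply: gen_by1].
- apply: eigSM hy hz => l m u v hu hv _ _; exact: gen_byM.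
- by apply: sub_span; exists 1%N; split; [apply: eig_hat|apply: gen_by_hat].
- by apply: sub_span; exists 0%N; split; [apply: eig_lam|apply: gen_by_lam].
- by apply: sub_span; exists 1%N; split; [apply: eig_sus|apply: gen_by_sus].
Qed.
Lemma gen_by_homotopy (E : grsub W) x : gen_by E x -> gen_by E (H x).
Proof.
move/gen_by_eig; move: x; apply: span_ind; first by rewrite linear0; apply: gen_by0.
  by move=> a x y hx hy; rewrite linearP; apply: gen_byL.
move=> x [l [xl gx]]; rewrite (path_homotopy_eig char0 xl) -[_ *: _]addr0; apply: gen_byL;
  last exact: gen_by0.
exact: gen_by_hat_to_sus.
Qed.
Lemma gen_byD (E : grsub W) x y : gen_by E x -> gen_by E y -> gen_by E (x + y).
Proof. by rewrite -[x in _ -> _ -> gen_by E (x + _)]scale1r; apply: gen_byL. Qed.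
Lemma gen_byB (E : grsub W) x y : gen_by E x -> gen_by E y -> gen_by E (x - y).
Proof. by move=> hx hy; rewrite addrC -scaleN1r; apply: gen_byL. Qed.

Lemma gen_by_pathmap n w : w \in (F n : submodClosed W) -> gen_by (F n) (pathmap (gen w)).
Proof.
have [F0 FS Fex] := Ff; elim: n w => [|n IH] w wn.
  by rewrite (F0 _ wn) !(linear0, gmor0); apply: gen_by0.
rewrite pathmap_gen; apply: gen_byD.
  by apply: gen_byD; [apply: gen_by_lam|apply: gen_by_hat].
have d1w := words_geS (leq0n 2) (d1_stage Fd wn).
apply: gen_by_mono (FS n) _; apply/gen_by_homotopy/gen_byB; first exact: gen_by_words d1w.
by apply: gen_by_words d1w => v vn; apply: gen_by_lam.
Qed.
Lemma gen_by_correction n w : w \in (F n.+1 : submodClosed W) ->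
  gen_by (F n) (H (pathmap (d1 L w) - lam (d1 L w))).
Proof.
move=> wn; have d1w := words_geS (leq0n 2) (d1_stage Fd wn).
apply/gen_by_homotopy/gen_byB; first by apply: gen_by_words d1w; apply: gen_by_pathmap.
by apply: gen_by_words d1w => v vn; apply: gen_by_lam.
Qed.

Local Notation YY := (fun q n => stages pathmap inY (@path_diff_homog _ _ L W1) (Yideal q) n).
Definition in_stage q (y : Y) : Prop := exists n, y \in (YY q n : submodClosed Y).
Definition in_span (x : C) : Prop := exists n, x \in prodspan pathmap inY (full L) (YY 0%N n).

Lemma in_stageL q a x y : in_stage q x -> in_stage q y -> in_stage q (a *: x + y).
Proof.
move=> [n xn] [m ym]; exists (maxn n m); rewrite rpredD ?rpredZ //.
  exact: stages_mono (leq_maxl n m) _ xn.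
exact: stages_mono (leq_maxr n m) _ ym.
Qed.
Lemma in_stage0 q : in_stage q 0. Proof. by exists 0%N; apply: rpred0. Qed.
Lemma in_stage1 : in_stage 0 1.
Proof. by exists 1%N; apply: stages1; [apply: Yideal_all|apply: path_diff1]. Qed.
Lemma in_stageM p q x y : in_stage p x -> in_stage q y -> in_stage (p + q) (x * y).
Proof.
move=> [n xn] [m ym]; exists (n + m)%N; apply: stagesM xn ym; first exact: path_diffM.
by move=> u v; apply: YidealM.
Qed.
Lemma in_stage_mono p q x : (p <= q)%N -> in_stage q x -> in_stage p x.
Proof. by move=> pq [n xn]; exists n; apply: stages_subS xn; apply: Yideal_mono. Qed.

Lemma in_spanL a x y : in_span x -> in_span y -> in_span (a *: x + y).
Proof.
move=> [n xn] [m ym]; exists (maxn n m); rewrite rpredD ?rpredZ //.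
  by apply: stage_span_sub xn; apply: stages_mono (leq_maxl n m).
by apply: stage_span_sub ym; apply: stages_mono (leq_maxr n m).
Qed.
Lemma in_span0 : in_span 0. Proof. by exists 0%N; apply: rpred0. Qed.
Lemma in_spanM x y : in_span x -> in_span y -> in_span (x * y).
Proof.
move=> [n xn] [m ym]; exists (n + m)%N; apply: stage_spanM xn ym => u v un vm.
by apply: (stagesM (@path_diffM _ _ L W1) _ un vm) => a b _ _; apply: Yideal_all.
Qed.
Lemma in_span_inY y : in_stage 0 y -> in_span (inY y).
Proof. by move=> [n yn]; exists n; apply: stage_span_t. Qed.
Lemma in_span_pathmap a : in_span (pathmap a).
Proof.
have [n h] := in_stage1; exists n; rewrite -[pathmap a]mulr1 -(gmor1 inY).
exact: prodspan_gen.
Qed.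
Lemma in_stage_D q y : y \in (Yideal q : submodClosed Y) ->
  (exists n, D (inY y) \in prodspan pathmap inY (full L) (YY q n)) -> in_stage q y.
Proof. by move=> yq [n h]; exists n.+1; rewrite stagesS yq. Qed.

Lemma in_stage_words (E : {pred W}) q a :
  (forall v, v \in E -> in_stage 1 (lamY (gen v))) -> a \in words_ge L E q -> in_stage q (lamY a).
Proof.
move=> hE; move: a; apply: span_ind; first by rewrite gmor0; apply: in_stage0.
  by move=> c x y hx hy; rewrite gmorL; apply: in_stageL.
move=> _ [s [sE sq ->]]; apply: in_stage_mono sq _.
elim: s sE => [|v s IH] sE; first by rewrite big_nil gmor1; apply: in_stage1.
rewrite big_cons gmorM; apply: (in_stageM (p := 1)); first by apply/hE/sE/mem_head.
by apply: IH => w ws; apply: sE; rewrite inE ws orbT.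
Qed.

Lemma in_stage_lam w : in_stage 1 (lamY (gen w)).
Proof.
move: w; apply: (filtration_ind Ff) => [|n IH w wn]; first by rewrite linear0 gmor0; apply: in_stage0.
apply: in_stage_D; first by rewrite -[lamY _]mulr1; apply/Yideal_mul/words_gen.
have [m h] : in_stage 1 (lamY (diff (gen w))).
  rewrite diff_genE gmorD -[X in X + _]scale1r; apply: in_stageL.
    exact/IH/(d0_stage Fd wn).
  by apply: (in_stage_mono (q := 2)) => //; apply: in_stage_words (d1_stage Fd wn).
exists m; rewrite -[D _]/(D (lam (gen w))) path_diff_lam; exact: stage_span_t.
Qed.

(** By induction on the stage: hat w is pathmap w - lam w minus a correction in letters of
    earlier stages, hence lies in the span over pathmap of the stages; then so does
    D (sus w), which puts sus w into the next one. *)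
Lemma in_stage_sus w : in_stage 0 (susY w) /\ in_span (hat (gen w)).
Proof.
move: w; apply: (filtration_ind Ff) => [|n IH w wn].
  by rewrite !linear0; split; [apply: in_stage0|apply: in_span0].
have lamw v : in_span (lam (gen v)).
  by apply: (@in_span_inY (lamY (gen v))); apply: in_stage_mono (in_stage_lam v).
have gs x : gen_by (F n) x -> in_span x.
  elim=> [|a y z _ hy _ hz||y z _ hy _ hz|v vn|v vn|v vn].
  - exact: in_span0.
  - exact: in_spanL.
  - by rewrite -(gmor1 pathmap); apply: in_span_pathmap.
  - exact: in_spanM.
  - by have [] := IH _ vn.
  - exact: lamw.
  - by apply: (@in_span_inY (susY v)); have [] := IH _ vn.
have hw : in_span (hat (gen w)).
  have -> : hat (gen w) = -1 *: lam (gen w) + (-1 *: H (pathmap (d1 L w) - lam (d1 L w)) + pathmap (gen w)).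
    rewrite pathmap_gen !scaleN1r; move: (H _) => h; rewrite [_ + _ + h]addrC addKr addrA addNr add0r.
    by [].
  by apply: in_spanL (lamw w) _; apply: in_spanL (gs _ (gen_by_correction wn)) (in_span_pathmap _).
split=> //; apply: in_stage_D; first exact: Yideal_all.
have -> : D (inY (susY w)) = -1 *: inY (susY (d0 L w)) + hat (gen w).
  by rewrite -[D _]/(D (sus w)) path_diff_sus addrC scaleN1r.
apply: in_spanL => //; apply: in_span_inY.
by have [] := IH _ (d0_stage Fd wn).
Qed.

Lemma Yideal_in_stage q y : y \in (Yideal q : submodClosed Y) -> in_stage q y.
Proof.
have all u : in_stage 0 u.
  move: u; apply: (Y_ind (L := L)).
  - exact: in_stage0.
  - by move=> a x z; apply: in_stageL.
  - exact: in_stage1.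
  - by move=> x z; apply: (in_stageM (p := 0) (q := 0)).
  - by move=> w; apply: in_stage_mono (in_stage_lam w).
  - by move=> w; have [] := in_stage_sus w.
move: y; apply: span_ind; first exact: in_stage0.
  by move=> a x z; apply: in_stageL.
move=> _ [x [u [xq _ ->]]]; rewrite -[q]addn0; apply: in_stageM (all u).
by apply: in_stage_words xq => v _; apply: in_stage_lam.
Qed.
End ClaimA.

(** * Long cocycles of the fibre *)

Section ClaimA.
Context {k : fieldType} (char0 : [pchar k] =i pred0) {W : gradedType k} (L : freeCDGA W).
Hypothesis W1 : concentrated_ge1 W.
Local Notation C := (path L W1).
Local Notation hat := (hat L W1).
Local Notation inY := (inY L W1).
Local Notation D := (path_diff L W1).
Local Notation Y := (Yalg W1).
Local Notation path_proj := (path_proj L W1).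
Local Notation Yideal := (Yideal L W1).

(** The cocycle pathmap z has at least n + 1 + q factors pathmap w.  After q trades it lies in
    Lambda^{>n} . P, where P consists of the elements with at least q letters lam and is
    mapped to Lambda^{>=q} by the projection. *)
Lemma toomer_ideal_exact q n (z : L) : KS_complex L ->
  toomer (sub_dgmod (word_ideal L q)) = Some n ->
  z \in words_ge L (full_pred W) (n + q).+1 -> diff z = 0 ->
  exists2 y, y \in words_ge L (full_pred W) q & z = diff y.
Proof.
move=> [F [Ff Fd]] /toomer_someE [P [g [gq inj]]] zq dz.
pose pathmap := pathmap char0 W1 Ff Fd.
have zG : pathmap z \in bideal pathmap (full W) (n.+1 + q) 0 by apply: bideal_f; rewrite addSn.
have Dz : D (pathmap z) = 0 by rewrite pathmap_diff dz gmor0.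
have [c [cG Dc [b [e bq]]]] := trade_iter zG Dz.
rewrite add0n in cG; rewrite path_proj_pathmap in e.
have tens : is_tensor (fun (a : L) (y : Y) => pathmap a * inY y).
  have -> : (fun (a : L) (y : Y) => pathmap a * inY y) = (fun a y => hat_subst pathmap (pure a y)).
    by apply/funext => a; apply/funext => y; rewrite hat_subst_pure.
  apply: (is_tensor_bij (s' := hat_subst (pathmap_inv char0 W1 Ff Fd)) _ _ (gtensor_is_tensor L Y)).
    exact: pathmap_invK.
  exact: pathmapK.
(* the comparison map has to be defined on all of C, although it is a chain map only on P *)
have [p pE] : exists p : {linear L -> sub_dgmod (word_ideal L q)},
    forall x (xq : x \in words_ge L (full_pred W) q), \val (p x : sub_carrier _) = x.
  have [|p pE] := @linear_choice k L (sub_dgmod (word_ideal L q))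
      (fun x y => x = \val (y : sub_carrier (word_ideal L q))).
    by split=> // a x y x' y' -> ->.
  exists p => x xq; rewrite -(pE x (Sub x xq : sub_carrier (word_ideal L q))) //.
have bil : bilinear_map (fun (a : L) (y : Y) => act a (p (path_proj (inY y)))).
  split=> [a c' x y|y c' a a'].
    by rewrite !gmorL !linearP.
  by rewrite actLl.
pose eps := tensor_lift tens bil.
have epsE a y : eps (pathmap a * inY y) = act a (p (path_proj (inY y))) by exact: (tensor_liftE tens bil).
have eps1 y : eps (inY y) = p (path_proj (inY y)).
  by rewrite -[X in eps X]mul1r -(gmor1 pathmap) epsE act1.
have ppiYq y : y \in (Yideal q : submodClosed Y) -> path_proj (inY y) \in words_ge L (full_pred W) q.
  move=> yq; apply: (@path_proj_bideal k char0 W L W1 F Ff Fd 0 q); exact: bideal_inY.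
have epsval x : x \in prodspan pathmap inY (full L) (Yideal q) -> \val (eps x :
  sub_carrier _) = path_proj x.
  move: x; apply: span_ind.
  - by rewrite gmor0 linear0.
  - by move=> a x y hx hy; rewrite gmorL linearP -hx -hy.
  move=> _ [a [y [_ yq ->]]]; rewrite epsE gmorM path_proj_pathmap -[LHS]/(a * \val (p (path_proj (inY
    y)) : sub_carrier _)).
  by rewrite pE // ppiYq.
have [||n0 y yn|y yq||m mE] := @stage_cocycle_exact k L Y C pathmap inY D (Yideal q) P
  (sub_dgmod (word_ideal L q)) g eps (word_ideal L n.+1) c (@path_diff_homog _ _ L W1)
  (@path_diffM _ _ L W1) (@path_diffK _ _ L W1) _ tens gq _ _ _ inj _ Dc.
- by move=> a; rewrite pathmap_diff.
- by move=> a y; rewrite epsE eps1.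
- have yq := stages_sub yn.
  apply: val_inj; rewrite -[LHS]/(diff (\val (eps (inY y) : sub_carrier _))) eps1 pE ?ppiYq //.
  rewrite epsval ?path_proj_diff //; case: n0 yn => [/zero_grsubP ->|n0];
    first by rewrite !(linear0, gmor0) rpred0.
  rewrite stagesS => /andP[_]; apply: stage_span_sub; exact: stages_sub.
- exact: (Yideal_in_stage char0 Ff Fd yq).
- move: cG; apply: span_min => _ [a [y [aI yq ->]]]; apply: sub_span; by exists a, y.
have cq : c \in prodspan pathmap inY (full L) (Yideal q).
  by move: cG; apply: prodspan_sub.
exists (b + \val (m : sub_carrier _)).
  apply: rpredD; last exact: valP (m : sub_carrier _).
  by apply: words_geS bq; rewrite addn0 /= leq_addl.
have := congr1 (fun x : sub_dgmod _ => \val (x : sub_carrier _)) mE.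
rewrite epsval // e -[X in _ = X]/(diff (\val (m : sub_carrier _))) linearD => <-.
by rewrite addrC subrK.
Qed.
End ClaimA.

(** * Pushing cocycles into the ideal of the base *)

Lemma linear_projection (k : fieldType) (V : gradedType k) (S : grsub V) :
  exists p : {linear V -> V}, (forall x, p x \in (S : submodClosed V)) /\
    forall x, x \in (S : submodClosed V) -> p x = x.
Proof.
have [|p pE] := @linear_choice k V (sub_carrier S) (fun x y => x = \val y).
  by split=> // a x y x' y' -> ->.
exists (grsub_val S \o p); split=> [x|x xS]; first exact: valP (p x).
exact: esym (pE x (Sub x xS) erefl).
Qed.

(** A section ka of d on the boundaries of X, with values in X, and a section kb of d on the
    cocycles of X, with values in Y, combine to a homotopy.  The first is needed
    because h has to be ka on boundaries for the formula to hold. *)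
Lemma null_homotopy (k : fieldType) (V : gradedType k) (d : {linear V -> V}) (X Y : grsub V) :
  (forall x, d (d x) = 0) -> {subset (X : submodClosed V) <= (Y : submodClosed V)} ->
  (forall x, x \in (X : submodClosed V) -> d x \in (X : submodClosed V)) ->
  (forall x, x \in (X : submodClosed V) -> d x = 0 -> exists2 y, y \in (Y : submodClosed V) & x = d y) ->
  exists h : {linear V -> V}, forall x, x \in (X : submodClosed V) ->
    d (h x) + h (d x) = x /\ h x \in (Y : submodClosed V).
Proof.
move=> dd XY dX Xex.
have [|k0 k0E] := @linear_choice k V (sub_carrier X) (fun u y => u = d (\val y)).
  by split=> [|a u v y z -> ->]; [exact: esym (linear0 d)|exact: esym (linearP d _ _ _)].
pose ka : {linear V -> V} := grsub_val X \o k0.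
have kaX u : ka u \in (X : submodClosed V) by exact: valP (k0 u).
have kaE x : x \in (X : submodClosed V) -> d (ka (d x)) = d x.
  by move=> xX; have := k0E (d x) (Sub x xX) erefl.
have [|kb kbE] := @linear_choice k V V (fun u y => y \in (Y : submodClosed V) /\ u = d y).
  split=> [|a u v y z [yY ->] [zY ->]]; first by rewrite rpred0 linear0.
  by rewrite linearP rpredD ?rpredZ.
pose u : {linear V -> V} := idfun \- (ka \o d).
pose h : {linear V -> V} := (ka \o u) \+ (kb \o (idfun \- (d \o ka)) \o u).
have hE x : h x = ka (u x) + kb (u x - d (ka (u x))) by [].
have uE x : u x = x - ka (d x) by [].
exists h => x xX.
have uX : u x \in (X : submodClosed V) by rewrite uE submodB.
have du : d (u x) = 0 by rewrite uE linearB kaE // subrr.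
have vX : u x - d (ka (u x)) \in (X : submodClosed V) by rewrite submodB // dX.
have [y yY ye] : exists2 y, y \in (Y : submodClosed V) & u x - d (ka (u x)) = d y.
  by apply: Xex => //; rewrite linearB du dd subrr.
have [kY kd] := kbE _ y (conj yY ye).
have udx : u (d x) = d x by rewrite uE dd linear0 subr0.
split; last by rewrite hE rpredD // XY.
rewrite (hE (d x)) udx kaE // subrr linear0 addr0 hE linearD -kd addrC.
by rewrite [d _ + _]addrC subrK uE addrC subrK.
Qed.

Lemma words_diff_incr (k : fieldType) (V : gradedType k) (L : freeCDGA V) :
  (forall v, diff (gen v : L) \in words_ge L (full_pred V) 2) ->
  forall r x, x \in words_ge L (full_pred V) r -> diff x \in words_ge L (full_pred V) r.+1.
Proof.
move=> d2 r x; move: x; apply: span_ind; first by rewrite linear0 rpred0.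
  by move=> a x y hx hy; rewrite linearP rpredD ?rpredZ.
move=> _ [s [_ sr ->]]; have /words_geS : (r < (size s).+1)%N by []; apply.
elim: s {sr} => [|v s IH]; first by rewrite big_nil diff1 rpred0.
rewrite big_cons diffMs rpredD //.
  by apply: (words_geM (p := 2)) => //; apply: sub_span; exists s.
apply: (words_geM (p := 1)) => //.
by apply: (grsub_sgn (S := wsub L (full V) 1)); apply: words_gen.
Qed.

Lemma cancel_aux (A : zmodType) (p q x t : A) : p + q - (- x + (t + p)) - (x + q) = - t.
Proof.
rewrite opprD opprK (opprD t) (opprD x) [p + q + _]addrAC [- x - q]addrC addrA addrK.
by rewrite [p + _]addrCA [x + _]addrC addrK addrC subrK.
Qed.
Section Main.
Context {k : fieldType} (char0 : [pchar k] =i pred0) {Z W : gradedType k}.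
Context {LZ : freeCDGA Z} {LW : freeCDGA W} {LV : freeCDGA (Z * W)%type}.
Context {incl : cdgamor LZ LV} {j : gcamor LW LV}.
Hypothesis RS : relative_sullivan incl j.
Hypothesis inclE : forall z : Z, incl (gen z) = gen (z, 0).
Hypothesis jE : forall w : W, j (gen w) = gen (0, w).
Local Notation LamZ := (wsub LZ (full Z)).
Local Notation LamW := (wsub LW (full W)).
Local Notation LamV := (words_ge LV (full_pred (Z * W)%type)).
Let im : gcamor LZ LV := incl.

Lemma genV v : (gen v : LV) = im (gen v.1) + j (gen v.2).
Proof.
rewrite jE -[im _]/(incl _) inclE -linearD; congr (gen _).
by apply: injective_projections; rewrite /= ?addr0 ?add0r.
Qed.

Fact snd_linear : linear (fun v : (Z * W)%type => v.2). Proof. by []. Qed.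
Fact snd_homog i v : v \in homog i -> (gen \o linear_of snd_linear : {linear (Z * W)%type ->
  LW}) v \in homog i.
Proof. by move=> /homogP e; apply: grmor_homog; apply/homogP; rewrite -[in RHS]e. Qed.
Definition fibre_proj : gcamor LV LW := ext LV (GrMor snd_homog).
Lemma fibre_proj_gen v : fibre_proj (gen v) = gen v.2. Proof. exact: ext_gen. Qed.
Lemma fibre_proj_j x : fibre_proj (j x) = x.
Proof. by apply: (free_eq (f := gca_comp fibre_proj j) (g := gca_id LW)) => w;
  rewrite -[LHS]/(fibre_proj (j _)) jE fibre_proj_gen. Qed.
Lemma fibre_proj_incl a : a \in words_ge LZ (full_pred Z) 1 -> fibre_proj (im a) = 0.
Proof.
move: a; apply: words_geS_ind; first by rewrite !gmor0.
  by move=> c x y hx hy; rewrite !gmorL hx hy scaler0 addr0.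
move=> v x _ _; rewrite !gmorM -[im (gen v)]/(incl _) inclE fibre_proj_gen.
by rewrite -[(v, 0).2]/(0 : W) linear0 mul0r.
Qed.

Lemma posdeg_word (B : gradedType k) (L : freeCDGA B) (b : L) : posdeg b ->
  b \in words_ge L (full_pred B) 1.
Proof.
move=> bp; have [s _ ->] := pr_sum b; apply: rpred_sum => i _.
have [i1|i1] := ltP i 1; first by rewrite bp // rpred0.
apply: (@posdeg_words _ _ L i); last exact: homog_pr.
exact: lt_le_trans i1.
Qed.

(** The letters of Z are sent to 0, so the differential of the total algebra induces that
    of the fibre. *)
Lemma fibre_proj_diff x : fibre_proj (diff (j x)) = diff x.
Proof.
rewrite -[diff (j x)](subrK (j (diff x))) gmorD fibre_proj_j -[RHS]add0r; congr (_ + _).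
have := rs_fiber RS x; move: (_ - _); apply: span_ind; first by rewrite gmor0.
  by move=> c u v hu hv; rewrite gmorL hu hv scaler0 addr0.
move=> _ [b [y [bp ->]]]; rewrite gmorM (fibre_proj_incl (posdeg_word bp)).
exact: mul0r.
Qed.

Lemma fibre_KS : KS_complex LW.
Proof.
have [F [Ff Fd]] := rs_filtration RS; exists F; split=> // n w /Fd.
rewrite -fibre_proj_diff; move: (diff _); apply: span_ind; first by rewrite gmor0 rpred0.
  by move=> c u v hu hv; rewrite gmorL rpredD ?rpredZ.
move=> _ [b [y [[a bp] yF ->]]]; rewrite gmorM fibre_proj_j.
have -> : fibre_proj (incl b) = a%:A.
  have := fibre_proj_incl (posdeg_word bp); rewrite gmorB gmorZ gmor1 gmorB gmorZ gmor1 => /eqP.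
  by rewrite subr_eq0 => /eqP.
by rewrite -scalerAl mul1r rpredZ.
Qed.

(** The differential may turn letters of W into letters of Z, but it lowers neither the
    base length p nor the total length r. *)
Definition bilength p r : submodClosed LV :=
  span [set x | exists s t a b, [/\ (p <= s)%N, (r <= s + t)%N, a \in (LamZ s : submodClosed LZ),
    b \in (LamW t : submodClosed LW) & x = im a * j b]]%classic.
Lemma bilength_gen p r s t a b : (p <= s)%N -> (r <= s + t)%N -> a \in (LamZ s : submodClosed LZ) ->
  b \in (LamW t : submodClosed LW) -> im a * j b \in bilength p r.
Proof. by move=> ps rst aZ bW; apply: sub_span; exists s, t, a, b. Qed.
Lemma bilength_mono p r p' r' : (p <= p')%N -> (r <= r')%N -> {subset bilength p' r' <= bilength p r}.
Proof.
move=> pp rr; apply: span_min => _ [s [t [a [b [ps rst aZ bW ->]]]]].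
by apply: bilength_gen aZ bW; [apply: leq_trans ps|apply: leq_trans rst].
Qed.
Lemma bilength_incl p r s a x : a \in (LamZ s : submodClosed LZ) -> x \in bilength p r ->
  im a * x \in bilength (p + s) (r + s).
Proof.
move=> aZ; move: x; apply: span_ind; first by rewrite mulr0 rpred0.
  by move=> c x y hx hy; rewrite mulrDr -scalerAr rpredD ?rpredZ.
move=> _ [s' [t [a' [b [ps rst aZ' bW ->]]]]]; rewrite mulrA -gmorM.
apply: (@bilength_gen _ _ (s + s') t) => //; [lia|lia|exact: words_geM].
Qed.
Lemma bilength_j p r t b x : b \in (LamW t : submodClosed LW) -> x \in bilength p r ->
  j b * x \in bilength p (r + t).
Proof.
move=> bW; move: x; apply: span_ind; first by rewrite mulr0 rpred0.
  by move=> c x y hx hy; rewrite mulrDr -scalerAr rpredD ?rpredZ.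
move=> _ [s [t' [a [b' [ps rst aZ bW' ->]]]]]; rewrite mulrA.
have := prodspan_comm im j aZ bW; move: (j b * _); apply: span_ind; first by rewrite mul0r rpred0.
  by move=> c x y hx hy; rewrite mulrDl -scalerAl rpredD ?rpredZ.
move=> _ [a2 [b2 [aZ2 bW2 ->]]]; rewrite -mulrA -gmorM.
apply: (@bilength_gen _ _ s (t + t')) => //; [lia|exact: words_geM].
Qed.
Lemma words_bilength r x : x \in LamV r -> x \in bilength 0 r.
Proof.
move: x; apply: span_min => _ [s [_ sr ->]]; apply: (bilength_mono (leqnn 0) sr).
elim: s {sr} => [|v s IH].
  have e1 : (1 : LV) = im 1 * j 1 by rewrite !gmor1 mulr1.
  by rewrite big_nil e1; apply: (@bilength_gen _ _ 0 0) => //; apply: words_ge1.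
rewrite big_cons genV mulrDl -[size _]/(size s).+1 -addn1; apply: rpredD.
  by apply: bilength_mono (bilength_incl _ IH) => //; apply: words_gen.
by apply: bilength_j => //; apply: words_gen.
Qed.
Lemma j_words t b : b \in (LamW t : submodClosed LW) -> j b \in LamV t.
Proof.
move: b; apply: span_ind; first by rewrite gmor0 rpred0.
  by move=> c x y hx hy; rewrite gmorL rpredD ?rpredZ.
move=> _ [s [_ st ->]]; apply: (words_geS st); elim: s {st} => [|v s IH].
  by rewrite big_nil gmor1 words_ge1.
rewrite big_cons gmorM jE; apply: (words_geM (p := 1)) => //; exact: words_gen.
Qed.
Lemma bilength_all x : x \in bilength 0 0. Proof. exact/words_bilength/words_full. Qed.

Lemma aug_split (B : gradedType k) (L : freeCDGA B) (a : L) : exists c :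
  k, a - c%:A \in words_ge L (full_pred B) 1.
Proof.
have [c [v [u [_ uE ->]]]] := words_decomp (E := full B) (words_full a).
exists c; rewrite addrAC [_ + _ - _]addrAC subrr add0r rpredD ?words_gen //.
exact: words_geS uE.
Qed.

Lemma bilength_fibre_proj r x : x \in bilength 0 r -> fibre_proj x \in (LamW r :
  submodClosed LW) /\ x - j (fibre_proj x) \in bilength 1 r.
Proof.
move: x; apply: span_ind; first by rewrite !gmor0 subrr !rpred0.
  move=> c x y [hx hx'] [hy hy']; rewrite !gmorL rpredD ?rpredZ //; split=> //.
  by rewrite opprD addrACA -scalerBr rpredD ?rpredZ.
move=> _ [[|s] [t [a [b [_ rst aZ bW ->]]]]]; last first.
  rewrite gmorM (fibre_proj_incl (words_geS _ aZ)) // mul0r gmor0 subr0 rpred0; split=> //.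
  exact: bilength_gen aZ bW.
have [c aZ1] := aug_split a.
have rb : b \in (LamW r : submodClosed LW) by apply: words_geS bW.
have ra : fibre_proj (im a) = c%:A.
  by rewrite -[a](subrK c%:A) (gmorD im) (gmorD fibre_proj) (fibre_proj_incl aZ1) add0r !gmorZ !gmor1.
rewrite gmorM ra fibre_proj_j -scalerAl mul1r; split; first by rewrite rpredZ.
have -> : im a * j b - j (c *: b) = im (a - c%:A) * j b.
  by rewrite gmorB !gmorZ gmor1 mulrBl -scalerAl mul1r.
by apply: (@bilength_gen _ _ 1 t) => //; lia.
Qed.

Definition j_defect x := diff (j x) - j (diff x).
(** The part of d(j b) without letters of Z is j(dbar b); the rest has base length at least 1
    and keeps the total length. *)
Lemma j_defect_words e : (forall r x, x \in LamV r -> diff x \in LamV (r + e)) ->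
  forall t b, b \in (LamW t : submodClosed LW) -> j_defect b \in bilength 1 (t + e).
Proof.
move=> de t b bW; have [_] := bilength_fibre_proj (words_bilength (de _ _ (j_words bW))).
by rewrite fibre_proj_diff.
Qed.
Lemma j_defect_bilength b : j_defect b \in bilength 1 0.
Proof.
apply: (j_defect_words (e := 0) _ (t := 0)); last exact: words_full.
by move=> r x xr; rewrite addn0; apply: word_ideal_diff.
Qed.

Lemma bilength_diff p x : x \in bilength p 0 -> diff x \in bilength p 0.
Proof.
move: x; apply: span_ind; first by rewrite linear0 rpred0.
  by move=> c x y hx hy; rewrite linearP rpredD ?rpredZ.
move=> _ [s [t [a [b [ps _ aZ bW ->]]]]]; rewrite diffMs -gmor_sgn; apply: rpredD.
  rewrite -[im a]/(incl a) -cdgamor_diff; apply: (@bilength_gen _ _ s t) => //.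
  exact: word_ideal_diff.
apply: bilength_mono (bilength_incl (grsub_sgn aZ) (bilength_all _)) => //; lia.
Qed.

Lemma bilength_lead p l x : x \in bilength p (p + l) -> exists x1 x2,
  [/\ x1 \in prodspan im j (LamZ p) (LamW l), x2 \in bilength p.+1 (p + l) & x = x1 + x2].
Proof.
move: x; apply: span_ind; first by exists 0, 0; rewrite !rpred0 addr0.
  move=> c x y [x1 [x2 [h1 h2 ->]]] [y1 [y2 [h3 h4 ->]]].
  by exists (c *: x1 + y1), (c *: x2 + y2); rewrite !rpredD ?rpredZ // scalerDr addrACA.
move=> _ [s [t [a [b [ps rst aZ bW ->]]]]]; have [sp|ps'] := leqP s p; last first.
  by exists 0, (im a * j b); rewrite rpred0 add0r; split=> //; apply: bilength_gen aZ bW.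
exists (im a * j b), 0; rewrite rpred0 addr0; split=> //; apply: prodspan_gen.
  exact: words_geS aZ.
by apply: words_geS bW; lia.
Qed.

(** A projection of Lambda Z onto Lambda^{>=p}Z, extended over Lambda W, fixes x by the second
    condition and is compatible with the first. *)
Lemma bilength_cap p l x : x \in prodspan im j (full LZ) (LamW l) -> x \in bilength p 0 ->
  x \in prodspan im j (LamZ p) (LamW l).
Proof.
have [P [PZ PE]] := linear_projection (LamZ p).
have bil : bilinear_map (fun a b => im (P a) * j b).
  split=> [a c u v|b c u v]; first by rewrite gmorL mulrDr scalerAr.
  by rewrite linearP gmorL mulrDl scalerAl.
pose Pi := tensor_lift (rs_tensor RS) bil.
have PiE a b : Pi (im a * j b) = im (P a) * j b by exact: (tensor_liftE (rs_tensor RS) bil).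
move=> xl xp; have <- : Pi x = x.
  move: x xp {xl}; apply: span_ind; first by rewrite linear0.
    by move=> c x y hx hy; rewrite linearP hx hy.
  move=> _ [s [t [a [b [ps _ aZ _ ->]]]]]; rewrite PiE PE //.
  exact: words_geS aZ.
move: x xl {xp}; apply: span_ind; first by rewrite linear0 rpred0.
  by move=> c x y hx hy; rewrite linearP rpredD ?rpredZ.
by move=> _ [a [b [_ bW ->]]]; rewrite PiE; apply: prodspan_gen.
Qed.

Section Stage.
Context (n q e : nat).
Hypothesis e1 : (e <= 1)%N.
Hypothesis de : forall r x, x \in LamV r -> diff x \in LamV (r + e).
Hypothesis exq : forall z : LW, z \in words_ge LW (full_pred W) (n + q).+1 -> diff z = 0 ->
  exists2 y, y \in words_ge LW (full_pred W) q & z = diff y.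

(** Let G be the null homotopy h of the fibre, extended over Lambda Z with the sign of an
    operator of degree -1.  For the part x1 of base length exactly p, dG x1 + G xi is x1
    up to the defect of j, where xi is d x1 computed as if j were a chain map.  As
    d x = 0, xi has base length > p, and hence so has G xi. *)
Lemma push_stage p x : x \in bilength p (p + (n + q).+1) -> diff x = 0 ->
  exists y, x - diff y \in bilength p.+1 (p + q + e).
Proof.
move=> /bilength_lead [x1 [x2 [x1G x2G ->]]] dx.
have [h hP] : exists h : {linear LW -> LW}, forall b, b \in (LamW (n + q).+1 : submodClosed LW) ->
    diff (h b) + h (diff b) = b /\ h b \in (LamW q : submodClosed LW).
  apply: null_homotopy => //; first exact: diffK.
    by move=> b; apply: words_geS; lia.
  by move=> b; apply: word_ideal_diff.
have bil : bilinear_map (fun a b => im (sgn a) * j (h b)).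
  split=> [a c u v|b c u v]; first by rewrite linearP gmorL mulrDr scalerAr.
  by rewrite linearP gmorL mulrDl scalerAl.
pose G := tensor_lift (rs_tensor RS) bil.
have GE a b : G (im a * j b) = im (sgn a) * j (h b) by exact: (tensor_liftE (rs_tensor RS) bil).
pose K : {linear LV -> LV} := idfun \- (diff \o G).
have [xi [xiG xiD xiH]] : exists xi, [/\ xi \in prodspan im j (LamZ p) (LamW (n + q).+1),
    diff x1 - xi \in bilength p.+1 0 & K x1 - G xi \in bilength p.+1 (p + q + e)].
  move: x1 x1G {dx}; apply: span_ind.
  - by exists 0; rewrite !linear0 !addr0 !rpred0.
  - move=> c y1 y2 [u [h1 h2 h3]] [v [h4 h5 h6]]; exists (c *: u + v).
    rewrite rpredD ?rpredZ //.
    split=> //; first by rewrite (linearP diff) opprD addrACA -scalerBr rpredD ?rpredZ.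
    by rewrite (linearP K) (linearP G) opprD addrACA -scalerBr rpredD ?rpredZ.
  move=> _ [a [b [aZ bW ->]]].
  have daE : diff (im a) = im (diff a) by rewrite -[im a]/(incl a) -cdgamor_diff.
  exists (im (diff a) * j b + im (sgn a) * j (diff b)).
  have [hb hq] := hP _ bW.
  have bW' : diff b \in (LamW (n + q).+1 : submodClosed LW) by exact: word_ideal_diff.
  split.
  - apply: rpredD; apply: prodspan_gen => //; first exact: word_ideal_diff.
    exact: grsub_sgn.
  - rewrite diffMs daE -gmor_sgn opprD addrACA subrr add0r -mulrBr.
    by have := bilength_incl (grsub_sgn aZ) (j_defect_bilength b); rewrite add1n; apply: bilength_mono.
  rewrite -[K _]/(im a * j b - diff (G (im a * j b))).
  have -> : im a * j b - diff (G (im a * j b)) - G (im (diff a) * j b + im (sgn a) * j (diff b)) =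
      - (im a * j_defect (h b)).
    rewrite linearD !GE diffMs -gmor_sgn !sgnK.
    have -> : diff (im (sgn a)) = - im (sgn (diff a)).
      by rewrite -[im _]/(incl _) -cdgamor_diff diff_sgn -gmorN.
    have tE : diff (j (h b)) = j_defect (h b) + j (diff (h b)) by rewrite subrK.
    rewrite -{1}hb gmorD tE !mulrDr mulNr.
    exact: cancel_aux.
  rewrite rpredN; apply: bilength_mono (bilength_incl aZ (j_defect_words de hq)); lia.
have xiP : xi \in prodspan im j (LamZ p.+1) (LamW (n + q).+1).
  apply: bilength_cap; first by apply: prodspan_sub xiG.
  have -> : xi = - (diff x1 - xi) - diff x2.
    rewrite opprB -addrA -opprD -linearD dx subr0.
    by [].
  rewrite rpredB ?rpredN //; apply: bilength_diff; exact: bilength_mono x2G.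
exists (G x1).
have -> : x1 + x2 - diff (G x1) = (K x1 - G xi) + G xi + x2.
  by rewrite subrK addrAC.
apply: rpredD; last by apply: bilength_mono x2G => //; lia.
apply: rpredD => //; move: (xi) xiP; apply: span_ind; first by rewrite linear0 rpred0.
  by move=> c u v hu hv; rewrite linearP rpredD ?rpredZ.
move=> _ [a [b [aZ bW ->]]]; rewrite GE; have [_ hq] := hP _ bW.
by apply: bilength_gen (grsub_sgn aZ) hq => //; lia.
Qed.
End Stage.

(** Each step loses n + 1 - e in total length, and the next one needs one letter more for
    the base. *)
Lemma push_stages n e i : (e <= 1)%N -> (forall r x, x \in LamV r -> diff x \in LamV (r + e)) ->
  (forall q (z : LW), z \in words_ge LW (full_pred W) (n + q).+1 -> diff z = 0 ->
    exists2 y, y \in words_ge LW (full_pred W) q & z = diff y) ->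
  forall p r x, x \in bilength p r -> diff x = 0 -> (i * (n.+2 - e) + p + n < r)%N ->
  exists y, x - diff y \in bilength (p + i.+1) 0.
Proof.
move=> e1 de ex; elim: i => [|i IH] p r x xG dx.
  rewrite mul0n add0n => pr; have [|y yG] := @push_stage n 0 e e1 de (ex 0%N) p x _ dx.
    by apply: bilength_mono xG => //; lia.
  by exists y; rewrite addn1; apply: bilength_mono yG.
(* q is what a word of length r - p retains after the null homotopy *)
rewrite mulSn => pr; pose q := (r - p - n.+1)%N.
have [|y yG] := @push_stage n q e e1 de (ex q) p x _ dx.
  by apply: bilength_mono xG => //; rewrite /q; lia.
have [||y' yG'] := IH _ _ _ yG.
- by rewrite linearB dx diffK subrr.
- by rewrite /q; lia.
exists (y + y'); rewrite linearD opprD addrA addnS -addSn.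
exact: yG'.
Qed.

(** By the relative Sullivan condition, the generators of Lambda W lie in the stages of
    Lambda V = Lambda Z (x) Lambda W, which can therefore replace a resolution of itself. *)
Lemma base_exact m c : toomer (restrict incl (regular LV)) = Some m ->
  c \in bilength m.+1 0 -> diff c = 0 -> exists y, c = diff y.
Proof.
move=> /toomer_someE [P [g [gq inj]]] cG dc.
have Sex y : exists n, y \in (stages im j (@homog_diff _ LV) (full LW) n : submodClosed LW).
  have [F [Ff Fd]] := rs_filtration RS.
  pose Q y := exists n, y \in (stages im j (@homog_diff _ LV) (full LW) n : submodClosed LW).
  have QL c' u v : Q u -> Q v -> Q (c' *: u + v).
    move=> [a ha] [b hb]; exists (maxn a b); rewrite rpredD ?rpredZ //.
      exact: stages_mono (leq_maxl a b) _ ha.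
    exact: stages_mono (leq_maxr a b) _ hb.
  have Q0 : Q 0 by exists 0%N; apply: rpred0.
  have Q1 : Q 1 by exists 1%N; apply: stages1 => //; apply: diff1.
  have QM u v : Q u -> Q v -> Q (u * v).
    by move=> [a ha] [b hb]; exists (a + b)%N; apply: stagesM ha hb => //; apply: diffMs.
  have Qg w : Q (gen w).
    move: w; apply: (filtration_ind Ff) => [|n IH w wn]; first by rewrite linear0.
    suff [l hl] : exists l, diff (j (gen w)) \in
        prodspan im j (full LZ) (stages im j (@homog_diff _ LV) (full LW) l).
      by exists l.+1; rewrite stagesS hl andbT.
    move: (Fd _ _ wn); move: (diff _); apply: span_ind; first by exists 0%N; apply: rpred0.
      move=> c' u v [a ha] [b hb]; exists (maxn a b); rewrite rpredD ?rpredZ //.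
        by apply: stage_span_sub ha; apply: stages_mono (leq_maxl a b).
      by apply: stage_span_sub hb; apply: stages_mono (leq_maxr a b).
    move=> _ [b [x [_ xF ->]]]; have [l hl] : Q x.
      move: x xF; apply: words_ind => //.
      by move=> v x vF Qx; apply: QM => //; apply: IH.
    by exists l; apply: prodspan_gen.
  by move: y; apply: free_ind => // v x Qx; apply: QM.
have [|||||||y cE] := @stage_cocycle_exact k LZ LW LV im j diff (full LW) P _ g
  (idfun : {linear LV -> LV}) (word_ideal LZ m.+1) c (@homog_diff _ LV) _ _ _ (rs_tensor RS) gq _ _ _
    inj _ dc.
- exact: diffMs.
- exact: diffK.
- by move=> a; rewrite -[im a]/(incl a) -cdgamor_diff.
- by [].
- by [].
- by move=> y _; apply: Sex.
- move: cG; apply: span_min => _ [s [t [a [b [ms _ aZ bW ->]]]]]; apply: sub_span.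
  by exists a, b; split=> //; apply: words_geS aZ.
by exists y.
Qed.
End Main.

Theorem theorem1p3 (k : fieldType) (char0 : [pchar k] =i pred0)
    (Z W : gradedType k)
    (LZ : freeCDGA Z) (LW : freeCDGA W) (LV : freeCDGA (Z * W)%type)
    (incl : cdgamor LZ LV) (j : gcamor LW LV) (m n : nat) :
  sullivan LZ ->
  relative_sullivan incl j ->
  (forall z : Z, incl (gen z) = gen (z, 0)) ->
  (forall w : W, j (gen w) = gen (0, w)) ->
  toomer (restrict incl (regular LV)) = Some m ->
  (forall q : nat, toomer (sub_dgmod (word_ideal LW q)) = Some n) ->
  inf_leq (toomer (regular LV)) (m.+1 * n.+2 - 2)%N /\
  (minimal_sullivan LV -> inf_leq (toomer (regular LV)) (m.+1 * n.+1 - 1)%N).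
Proof.
move=> _ RS inclE jE tm tn.
have ex q (z : LW) : z \in words_ge LW (full_pred W) (n + q).+1 -> diff z = 0 ->
    exists2 y, y \in words_ge LW (full_pred W) q & z = diff y.
  exact: (toomer_ideal_exact char0 (rs_gens RS) (fibre_KS RS inclE jE) (tn q)).
(* e is the gain in word length under the differential *)
have key e N : (e <= 1)%N ->
    (forall r x, x \in words_ge LV (full_pred _) r -> diff x \in words_ge LV (full_pred _) (r + e)) ->
    (m * (n.+2 - e) + n <= N)%N -> inf_leq (toomer (regular LV)) N.
  move=> e1 de mN; apply: toomer_regular_le => z dz zN.
  have [|y yG] := push_stages RS inclE jE (i := m) e1 de ex (words_bilength inclE jE zN) dz.
    by rewrite addn0 ltnS.
  have [|y' e'] := base_exact RS tm yG; first by rewrite linearB dz diffK subrr.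
  by exists (y + y'); rewrite linearD -e' addrC subrK.
split=> [|[_ d2]].
  apply: (key 0%N) => // [r x xr|]; last by rewrite subn0; nia.
  by rewrite addn0; apply: word_ideal_diff.
apply: (key 1%N) => // [r x xr|]; last by rewrite subSS subn0; nia.
by rewrite addn1; apply: words_diff_incr.
Qed.
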